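(* Let $q$ be a fixed prime power with $q\equiv 1 \pmod 4$, and let $k$ be a fixed even natural number. Let $n=2g+1$ or $n=2g+2$, where $g\ge 1$ is an integer. Then \[ \frac{1}{|\mathcal{P}_{n}|}\sum_{P\in\mathcal{P}_{n}}L\left(\tfrac{1}{2},\chi_P\right)^k \gg_k (\log_q|P|)^{\frac{k(k+1)}{2}}, \] where $|P|=q^{n}$ for $P\in\mathcal{P}_n$, i.e. there is a constant $c>0$ depending on $k$ (and $q$) such that the left side is at least $c\,n^{k(k+1)/2}$ for all sufficiently large $g$.
   Context: $\mathbb{A}=\mathbb{F}_q[T]$. For nonzero $f\in\mathbb{A}$, $|f|=q^{\deg f}$. $\mathcal{P}_n$ denotes the set of monic irreducible polynomials of degree $n$ in $\mathbb{A}$. For a monic irreducible $P$, $\chi_P$ is the quadratic character given by the quadratic residue symbol modulo $P$: for $f\in\mathbb{A}$, $\chi_P(f)=0$ if $P\mid f$, $\chi_P(f)=1$ if $P\nmid f$ and $f$ is a square modulo $P$, and $\chi_P(f)=-1$ otherwise (for $q\equiv 1\pmod 4$ and monic arguments this coincides with the symbol $\left(\frac{P}{f}\right)$ by quadratic reciprocity). The Dirichlet $L$-function is $L(s,\chi_P)=\sum_{f\text{ monic}}\chi_P(f)|f|^{-s}$, which is a polynomial in $q^{-s}$ (of degree less than $\deg P$), so $L(\tfrac12,\chi_P)$ is a well-defined real number. *)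

(* Defs.v *)
From HB Require Import structures.
From mathcomp Require Import all_boot all_order all_algebra all_field.
From mathcomp Require Import boolp reals.
Set Implicit Arguments. Unset Strict Implicit. Unset Printing Implicit Defensive.
Import Order.TTheory GRing.Theory Num.Theory.
Local Open Scope ring_scope.

Section Defs.
Variable F : finFieldType.

Definition monic_of (d : nat) (c : {ffun 'I_d -> F}) : {poly F} :=
  'X^d + \sum_(i < d) (c i)%:P * 'X^i.

Definition chi (P f : {poly F}) : int :=
  if P %| f then 0
  else if `[< exists h : {poly F}, P %| h ^+ 2 - f >] then 1 else -1.

Definition Pset (n : nat) : {set {ffun 'I_n -> F}} :=
  [set c | `[< irreducible_poly (monic_of c) >]].

(* L(1/2, chi_P) = sum over monic f of degree < deg P of chi_P(f) |f|^{-1/2},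
   i.e. the polynomial L(s,chi_P) in u = q^{-s} (degree < deg P) evaluated
   at u = q^{-1/2}. *)
Definition Lhalf (R : realType) (P : {poly F}) : R :=
  \sum_(d < (size P).-1) \sum_(c : {ffun 'I_d -> F})
     (chi P (monic_of c))%:~R / (Num.sqrt (#|F|%:R : R)) ^+ d.
End Defs.

(* Main.v *)
Require Import Defs.
From HB Require Import structures.
From mathcomp Require Import all_boot all_order all_fingroup all_algebra all_solvable all_field.
From mathcomp Require Import boolp reals.
From mathcomp Require Import zify ring lra.

(** Let [A(P)] be the sum of [chi_P(f) |f|^(-1/2)] over the monic [f] of degree
    at most [y = g / 2k].  Since [k] is even, the tangent line inequality
    [L^k >= k L A^(k-1) - (k-1) A^k] bounds the [k]-th moment from below by two
    moments whose diagonal terms, coming from the [k]-tuples with square product,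
    are positive.  The functional equation writes [L] as a sum over degrees
    [<= g] with weights at least [|f|^(-1/2)] on degrees [< g], so the diagonal
    of [L A^(k-1)] dominates that of [A^k], and the latter is at least a constant
    times [y^(k(k+1)/2)]: use the tuples
    [f_i = h_i^2 * prod_(A contains i) g_A], [A] running over the 2-subsets.

    The off-diagonal terms need square root cancellation in the sum of [chi_P(f)]
    over [P] of degree [n] for [f] not a square.  Stepanov's method gives it with
    an auxiliary polynomial in [F_q[X]]: modulo [P^(q^g)] the element [X^(q^n)]
    plays the role of a root of [P], so no extension field is needed.

    The functional equation comes from the linear form "coefficient of
    [X^(n-1)]" on [F_q[X]/P], in the place of an additive character.  Its sign is
    decided for odd [n] by the parity of a sum of [q^g] signs, and for even [n]
    by Euler's formula together with averaging over the subfield of index 2. *)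

Set Implicit Arguments. Unset Strict Implicit. Unset Printing Implicit Defensive.
Import Order.TTheory GRing.Theory Num.Theory.
Local Open Scope ring_scope.

(** * The quadratic character of a finite field and of a residue field *)

(** Put v = sqrt q. Stepanov's method bounds a nonsquare character sum by a constant times v^(2g),
    and the weights |f|^(-1/2) in degrees up to m add up to order v^m. Summing L up to degree n - 1
    would thus give an error of order v^(4g) already before A enters, which v^(2n)/n primes cannot
    absorb. Cut at degree g, the error is of order v^(3g + (k-1)y); the choice of y makes (k-1)y at
    most g/2, and the remaining v^(g/2) beats n and all constants. The cut also keeps the degree of
    f_1...f_k below n, so that no prime of degree n divides it and every square product contributes
    exactly the number of primes.

    The exponent arises because each g_A enters two of the f_i, so that h_i and g_A both carry the
    weight 1/|.|, whose sum over monics of degree at most z is z + 1. This gives k + C(k,2) =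
    k(k+1)/2 factors of order y. The parametrization is injective only for squarefree, pairwise
    coprime g_A; families without small divisors contain a positive proportion of such ones, which
    avoids an Euler product.

    The hypothesis q = 1 mod 4 decides the sign for even n: it makes (q^h + 1)/2 odd, where n =
    2h. *)

Definition qchar (K : finFieldType) (y : K) : int :=
  if y == 0 then 0 else if [exists z, z ^+ 2 == y] then 1 else -1.

Section QuadraticCharacter.
Variable K : finFieldType.
Hypothesis oddK : odd #|K|.

Let m := (#|K|.-1)./2.

Lemma card_field_half : #|K| = m.*2.+1.
Proof.
have := finNzRing_gt1 K; rewrite /m; move: oddK; case: #|K| => //= k ok _.
by rewrite -[k in LHS]odd_double_half (negbTE ok).
Qed.

Lemma half_card_gt0 : (0 < m)%N.
Proof. by have := finNzRing_gt1 K; rewrite card_field_half; case: m. Qed.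

Lemma field_generator :
  exists z : K, [/\ forall y, y != 0 -> exists i, y = z ^+ i,
     z ^+ m = -1 & forall i, z ^+ i = 1 -> (m.*2 %| i)%N].
Proof.
have m0 := half_card_gt0.
have E : #|K|.-1 = m.*2 by rewrite card_field_half.
have root1 (y : K) : y != 0 -> y ^+ m.*2 = 1.
  move=> y0; apply: (mulfI y0); rewrite mulr1 -exprS -card_field_half.
  exact: expf_card.
pose rs := [seq y <- enum K | y != 0].
have srs : size rs = m.*2.
  rewrite -E -(cardC1 (0 : K)) cardE /rs; congr size.
  by rewrite enumT /= -enumT {2}/enum_mem -enumT; apply: eq_filter.
have/hasP[z _ pz] : has (m.*2).-primitive_root rs.
  apply: has_prim_root => //; first by rewrite double_gt0.
  - apply/allP => y; rewrite mem_filter => /andP[y0 _].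
    by rewrite unity_rootE root1.
  - by rewrite filter_uniq ?enum_uniq.
  - by rewrite srs.
exists z; split.
- move=> y y0; case: (prim_rootP pz (root1 _ y0)) => i ->; by exists i.
- have : (z ^+ m) ^+ 2 = 1 by rewrite -exprM muln2 (prim_expr_order pz).
  move/eqP; rewrite sqrf_eq1 => /orP[|/eqP//].
  rewrite -(prim_order_dvd pz) => /dvdn_leq-/(_ m0).
  by rewrite -addnn leqNgt -{1}(addn0 m) ltn_add2l m0.
- by move=> i /eqP; rewrite -(prim_order_dvd pz).
Qed.

Lemma neg1_neq1 : (-1 : K) != 1.
Proof.
have [z [_ zm z1]] := field_generator; rewrite -zm; apply/eqP => /z1.
by move/dvdn_leq => /(_ half_card_gt0); have := half_card_gt0; lia.
Qed.

(** Euler's criterion: a square w^2 has m-th power w^(2m) = 1, and a nonsquare is an odd power of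
    the generator z, for which z^m = -1. *)
Lemma qcharE (y : K) : (qchar y)%:~R = y ^+ m.
Proof.
have m0 := half_card_gt0.
rewrite /qchar; have [->|y0] := eqVneq y 0; first by rewrite expr0n gtn_eqF.
have [z [gz zm z1]] := field_generator.
have [i yE] := gz _ y0.
case: existsP => [[w /eqP wE]|ns].
  have w0 : w != 0 by apply: contraNneq y0 => w0; rewrite -wE w0 expr0n.
  apply: (mulfI w0); rewrite -wE -exprM mul2n -exprS mulr1.
  by rewrite -card_field_half expf_card.
have oi : odd i.
  apply/negPn/negP => ei; apply: ns; exists (z ^+ i./2).
  by rewrite -exprM muln2 yE -[X in _ == z ^+ X]odd_double_half (negbTE ei).
by rewrite yE -exprM mulnC exprM zm -signr_odd oi expr1.
Qed.

Lemma qchar0 : qchar (0 : K) = 0.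
Proof. by rewrite /qchar eqxx. Qed.

Lemma qchar_cases (y : K) : y != 0 -> qchar y = 1 \/ qchar y = -1.
Proof. by rewrite /qchar => /negbTE ->; case: ifP; [left|right]. Qed.

(** The values 0, 1, -1 stay distinct in [K], so integer identities for [qchar] can be checked on
    powers in [K]. *)
Lemma qchar_intr_inj (a b : int) : (a = 0 \/ a = 1 \/ a = -1) ->
  (b = 0 \/ b = 1 \/ b = -1) -> a%:~R = b%:~R :> K -> a = b.
Proof.
have n11 := neg1_neq1; have n10 := oner_neq0 K.
have nn0 : (-1 : K) != 0 by rewrite oppr_eq0.
case=> [->|[->|->]] [->|[->|->]] // /eqP; rewrite ?mulrNz ?mulr0z ?mulr1z;
  by rewrite ?[0 == _]eq_sym ?[1 == - _]eq_sym
     ?(negbTE n11) ?(negbTE n10) ?(negbTE nn0).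
Qed.

Lemma qchar_val (y : K) : qchar y = 0 \/ qchar y = 1 \/ qchar y = -1.
Proof.
have [->|/qchar_cases] := eqVneq y 0; last by right.
by left; exact: qchar0.
Qed.

Lemma qchar_eq (y : K) (a : int) : (a = 0 \/ a = 1 \/ a = -1) ->
  y ^+ m = a%:~R -> qchar y = a.
Proof. by move=> ha E; apply: qchar_intr_inj (qchar_val y) ha _; rewrite qcharE. Qed.

Lemma qcharM : {morph (@qchar K) : x y / x * y}.
Proof.
move=> x y; apply: qchar_eq.
  by case: (qchar_val x) => [->|[->|->]]; case: (qchar_val y) => [->|[->|->]];
     rewrite /= ?mul0r ?mulr0 ?mulr1 ?mul1r ?mulrNN ?mulr1; auto.
by rewrite exprMn -!qcharE rmorphM.
Qed.

Lemma qchar1 : qchar (1 : K) = 1.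
Proof. by apply: qchar_eq; rewrite ?expr1n; auto. Qed.

Lemma qchar_eq0 (y : K) : (qchar y == 0) = (y == 0).
Proof. rewrite /qchar; case: (y == 0) => //. case: [exists z, _]. done. done. Qed.

Lemma qchar_sqr (y : K) : y != 0 -> qchar y * qchar y = 1.
Proof. by case/qchar_cases => ->. Qed.

Lemma sum_qchar : \sum_(y : K) qchar y = 0.
Proof.
have [z [_ zm _]] := field_generator.
have qz : qchar z = -1 by apply: qchar_eq; [by right; right | rewrite zm mulrNz].
have z0 : z != 0 by rewrite -qchar_eq0 qz.
have E : \sum_(y : K) qchar y = - \sum_(y : K) qchar y.
  rewrite {1}(reindex_inj (mulfI z0)) -sumrN; apply: eq_bigr => y _.
  by rewrite qcharM qz mulN1r.
by move: E; move: (\sum_(y : K) qchar y) => S; lia.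
Qed.

Lemma qchar_expo (y : K) (i : nat) : qchar (y ^+ i) = qchar y ^+ i.
Proof. by elim: i => [|i IH]; rewrite ?expr0 ?qchar1 // !exprS qcharM IH. Qed.

End QuadraticCharacter.

(** * Residue fields: the quotient ring is opened only here, and later arguments use [K], [ev] and
    the three properties *)

Section ResidueField.
Variable F : finFieldType.

Lemma residue_field (P : {poly F}) : P \is monic -> irreducible_poly P ->
  exists (K : finFieldType) (ev : {rmorphism {poly F} -> K}),
  [/\ forall f, (ev f == 0) = (P %| f), #|K| = (#|F| ^ (size P).-1)%N
    & forall y, exists2 f : {poly F}, (size f < size P)%N & ev f = y].
Proof.
move=> Pm Pi; pose hI : monic_irreducible_poly P := (Pi, Pm).
exists ({poly %/ P with hI} : finFieldType).
exists (in_qpoly P : {rmorphism {poly F} -> {poly %/ P with hI}}).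
have mkE := mk_monicE hI; have sE : size (mk_monic P) = size P by rewrite mkE.
split.
- move=> f; apply/eqP/idP => [/val_eqP /= | hDp].
    by rewrite -Pdiv.IdomainMonic.modpE ?mkE.
  by apply/val_eqP; rewrite /= -Pdiv.IdomainMonic.modpE ?mkE.
- exact: card_qfpoly.
- move=> y; exists (val y); first by rewrite -sE; exact: size_mk_monic.
  by apply: val_inj; exact: in_qpoly_small (size_mk_monic y).
Qed.

End ResidueField.

Section Chi.
Variables (F : finFieldType) (P : {poly F}) (K : finFieldType).
Variable ev : {rmorphism {poly F} -> K}.
Hypothesis ev0 : forall f, (ev f == 0) = (P %| f).
Hypothesis ev_surj : forall y, exists2 f : {poly F}, (size f < size P)%N & ev f = y.

Lemma chi_qchar f : chi P f = qchar (ev f).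
Proof.
rewrite /chi /qchar ev0; case: ifP => // _.
congr (if _ then _ else _); apply/asboolP/existsP.
  by move=> [h hP]; exists (ev h); rewrite -subr_eq0 -rmorphXn -rmorphB ev0.
move=> [z]; have [h _ <-] := ev_surj z => /eqP hz.
by exists h; rewrite -ev0 rmorphB rmorphXn hz /= subrr.
Qed.

End Chi.

Section ChiMain.
Variables (F : finFieldType) (P : {poly F}).
Hypotheses (oddF : odd #|F|) (Pm : P \is monic) (Pi : irreducible_poly P).

Lemma chiM : {morph chi P : f g / f * g}.
Proof.
have [K [ev [ev0 cK sj]]] := residue_field Pm Pi.
by move=> f g; rewrite !(chi_qchar ev0 sj) rmorphM qcharM // cK oddX oddF orbT.
Qed.

Lemma chi_expf f : P %| f ^+ ((#|F| ^ (size P).-1).-1)./2 - (chi P f)%:~R.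
Proof.
have [K [ev [ev0 cK sj]]] := residue_field Pm Pi.
rewrite -ev0 rmorphB rmorphXn /= rmorph_int (chi_qchar ev0 sj) qcharE ?cK ?subrr //.
by rewrite oddX oddF orbT.
Qed.

Lemma fermat_poly f : P %| f ^+ (#|F| ^ (size P).-1) - f.
Proof.
have [K [ev [ev0 cK sj]]] := residue_field Pm Pi.
by rewrite -ev0 rmorphB rmorphXn /= -cK expf_card subrr.
Qed.

Lemma chi_cases f : ~~ (P %| f) -> chi P f = 1 \/ chi P f = -1.
Proof. by rewrite /chi => /negbTE ->; case: ifP; [left|right]. Qed.

Lemma chi_sqr f : ~~ (P %| f) -> chi P (f ^+ 2) = 1.
Proof. by move=> nf; rewrite expr2 chiM; case: (chi_cases nf) => ->. Qed.

Lemma chi1 : chi P 1 = 1.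
Proof.
by rewrite -(expr1n _ 2) chi_sqr // dvdp1; case: Pi => s _; rewrite gtn_eqF.
Qed.

End ChiMain.

(** * Stepanov's method *)

Section MonicOf.
Variable F : finFieldType.

(** The index [d] has no preimage in ['I_d], so the default value 1 of [insub] supplies the leading
    coefficient. *)
Lemma monic_ofE d (c : {ffun 'I_d -> F}) :
  monic_of c = \poly_(i < d.+1) (if insub i is Some j then c j else 1).
Proof.
rewrite /monic_of poly_def big_ord_recr /= addrC; congr (_ + _).
  by case: insubP => [j|]; rewrite ?ltnn ?scale1r.
apply: eq_bigr => i _; rewrite mul_polyC; congr (_ *: _).
by case: insubP => [j _ ij|]; [congr (c _); exact/val_inj | rewrite ltn_ord].
Qed.

Lemma size_monic_of d (c : {ffun 'I_d -> F}) : size (monic_of c) = d.+1.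
Proof.
rewrite monic_ofE size_poly_eq //; case: insubP => [j|]; rewrite ?ltnn //.
by rewrite oner_neq0.
Qed.

Lemma monic_of_monic d (c : {ffun 'I_d -> F}) : monic_of c \is monic.
Proof.
rewrite monicE lead_coefE size_monic_of /= monic_ofE coef_poly ltnSn.
by case: insubP => [j|]; rewrite ?ltnn.
Qed.

Lemma coef_monic_of d (c : {ffun 'I_d -> F}) (i : 'I_d) : (monic_of c)`_i = c i.
Proof.
rewrite monic_ofE coef_poly ltnS ltnW //.
by case: insubP => [j _ ij|]; [congr (c _); exact/val_inj | rewrite ltn_ord].
Qed.

Lemma monic_of_inj d : injective (@monic_of F d).
Proof. by move=> a b E; apply/ffunP => i; rewrite -!coef_monic_of E. Qed.

Lemma monic_of_coef (p : {poly F}) d : p \is monic -> size p = d.+1 ->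
  monic_of [ffun i : 'I_d => p`_i] = p.
Proof.
move=> pm ps; apply/polyP => i; rewrite monic_ofE coef_poly.
case: ltnP => [|di]; last by rewrite nth_default // ps.
rewrite ltnS leq_eqVlt => /orP[/eqP->|id].
  by case: insubP => [j|]; rewrite ?ltnn //; move/monicP: pm; rewrite lead_coefE ps.
by case: insubP => [j _ <-|]; rewrite ?id // ffunE.
Qed.

Lemma monic_of0 (c : {ffun 'I_0 -> F}) : monic_of c = 1.
Proof. by rewrite /monic_of big_ord0 addr0 expr0. Qed.

Lemma PsetP n (c : {ffun 'I_n -> F}) :
  reflect (irreducible_poly (monic_of c)) (c \in Pset F n).
Proof. by rewrite inE; exact: asboolP. Qed.

Lemma monic_of_neq0 d (c : {ffun 'I_d -> F}) : monic_of c != 0.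
Proof. exact: monic_neq0 (monic_of_monic c). Qed.

End MonicOf.

(** * Powers of Frobenius on polynomials *)

Section Frobenius.
Variable F : finFieldType.

Lemma pnat_pchar_poly k : [pchar {poly F}].-nat (#|F| ^ k)%N.
Proof.
have [p pr_p pcharFp] := finPcharP F.
have : (p.-group [set: F])%g by have /abelem_pgroup := fin_ring_pchar_abelem pcharFp.
rewrite /pgroup cardsT => pn; rewrite pnatX; apply/orP; left.
apply: sub_in_pnat pn => r _; rewrite inE => /eqP ->.
by rewrite pchar_poly.
Qed.

Lemma exprD_card (a b : {poly F}) k :
  (a + b) ^+ (#|F| ^ k) = a ^+ (#|F| ^ k) + b ^+ (#|F| ^ k).
Proof. exact: exprDn_pchar (pnat_pchar_poly k). Qed.

Lemma exprB_card (a b : {poly F}) k :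
  (a - b) ^+ (#|F| ^ k) = a ^+ (#|F| ^ k) - b ^+ (#|F| ^ k).
Proof.
by apply: (addIr (b ^+ (#|F| ^ k))); rewrite -exprD_card !subrK.
Qed.

Lemma expf_card_expn (c : F) k : c ^+ (#|F| ^ k) = c.
Proof. by elim: k => [|k IH]; rewrite ?expr1 // expnSr exprM IH expf_card. Qed.

Lemma expr_card_comp (p : {poly F}) k : p ^+ (#|F| ^ k) = p \Po 'X^(#|F| ^ k).
Proof.
elim/poly_ind: p => [|p c IH]; first by rewrite comp_poly0 expr0n expn_eq0 -leqn0
  leqNgt (ltnW (finNzRing_gt1 F)).
rewrite exprD_card exprMn IH comp_polyD comp_polyM comp_polyX comp_polyC.
by rewrite -polyC_exp expf_card_expn.
Qed.

(** A congruence modulo P becomes one modulo a high power of P. The multiplicities in Stepanov's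
    method come from this rather than from derivatives. *)
Lemma dvdp_exp_card (P a b : {poly F}) k :
  P %| a - b -> P ^+ (#|F| ^ k) %| a ^+ (#|F| ^ k) - b ^+ (#|F| ^ k).
Proof. by move=> /(dvdp_exp2r (#|F| ^ k)); rewrite exprB_card. Qed.

End Frobenius.

(** * Nonvanishing of the auxiliary polynomial *)

Section Independence.
Variable F : fieldType.
Variables (s : {poly F}) (d Q B : nat).
Hypothesis size_s : size s = d.+1.
Hypothesis d_gt0 : (0 < d)%N.
Hypothesis sqf : forall b : {poly F}, b ^+ 2 %| s -> (size b <= 1)%N.
Hypothesis hB : (B.*2 + d <= Q)%N.

Let s0 : s != 0. Proof. by rewrite -size_poly_eq0 size_s. Qed.

Lemma dvdXn_small (p : {poly F}) : 'X^Q %| p -> (size p <= Q)%N -> p = 0.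
Proof.
move=> dp sp; apply/eqP; apply: contraTT dp => p0.
by apply/negP => /(dvdp_leq p0); rewrite size_polyXn ltnNge sp.
Qed.

Lemma comp_Xn_dvd (p : {poly F}) : 'X^Q %| p \Po 'X^Q - (p.[0])%:P.
Proof.
elim/poly_ind: p => [|p c IH]; first by rewrite comp_poly0 horner0 subrr dvdp0.
rewrite comp_polyD comp_polyM comp_polyX comp_polyC !hornerE.
by rewrite addrK dvdp_mull.
Qed.

Lemma size_sqr_bound (r : {poly F}) : (size r <= B)%N -> (size (r ^+ 2 * s)%R <= Q)%N.
Proof.
have [->|r0] := eqVneq r 0; first by rewrite expr0n mul0r size_poly0.
move=> sr; rewrite size_mul ?expf_neq0 // size_s expr2 size_mul //.
have : (0 < size r)%N by rewrite size_poly_gt0.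
move: hB sr; rewrite -addnn addnS /=; move: (size r) => x *; lia.
Qed.

(* Modulo [X^Q] the identity reads [s * r^2 = s(0) * t^2] up to terms of degree at
   least [Q], and a nonconstant squarefree [s] is not a constant times a square.
   If [s(0) = 0], it vanishes to order one only, and [r], then [t], must vanish. *)
Lemma indep_first (r t R T : {poly F}) : (size r <= B)%N -> (size t <= B)%N ->
  (r + 'X^Q * R) ^+ 2 * s = (t + 'X^Q * T) ^+ 2 * (s \Po 'X^Q) ->
  r = 0 /\ t = 0.
Proof.
move=> sr st E.
have Q0 : (0 < Q)%N by lia.
have XQ0 : ('X^Q : {poly F}) != 0 by rewrite -size_poly_eq0 size_polyXn.
have st2 : (size (t ^+ 2)%R <= Q)%N.
  rewrite expr2 (leq_trans (size_polyMleq t t)) //.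
  by move: st hB; rewrite -addnn; move: (size t) => x *; lia.
have D1 : 'X^Q %| r ^+ 2 * s - t ^+ 2 * (s.[0])%:P.
  have -> : r ^+ 2 * s - t ^+ 2 * (s.[0])%:P =
    t ^+ 2 * (s \Po 'X^Q - (s.[0])%:P) +
    'X^Q * ((2%:R * t * T + 'X^Q * T ^+ 2) * (s \Po 'X^Q)
             - (2%:R * r * R + 'X^Q * R ^+ 2) * s).
    have -> : r ^+ 2 * s = (r + 'X^Q * R) ^+ 2 * s
               - 'X^Q * (2%:R * r * R + 'X^Q * R ^+ 2) * s by ring.
    rewrite E; ring.
  by apply: dvdp_add; [apply/dvdp_mull/comp_Xn_dvd | exact: dvdp_mulr].
have [z0|nz0] := eqVneq s.[0] 0; last first.
  have E1 : r ^+ 2 * s = s.[0] *: t ^+ 2.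
    apply/eqP; rewrite -subr_eq0 -mul_polyC mulrC; apply/eqP.
    rewrite [s * _]mulrC [(_)%:P * _]mulrC.
    apply: dvdXn_small D1 _.
    rewrite (leq_trans (size_polyD _ _)) // geq_max size_sqr_bound //= size_polyN.
    by rewrite mulrC mul_polyC (leq_trans (size_scale_leq _ _)).
  have [r0|rn0] := eqVneq r 0.
    split=> //; move/esym/eqP: E1; rewrite r0 expr0n mul0r scaler_eq0 (negbTE nz0) /=.
    by rewrite expf_eq0 => /eqP.
  have rt : r %| t.
    rewrite -(@dvdp_pexp2r _ _ _ 2) // -(dvdpZr _ _ nz0) -E1; exact: dvdp_mulr.
  move/dvdpP: rt => [c tE].
  have sE : s = s.[0] *: c ^+ 2.
    apply: (mulfI (expf_neq0 2 rn0)); rewrite E1 tE exprMn -scalerAr.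
    by rewrite mulrC.
  have/sqf c1 : c ^+ 2 %| s by rewrite sE dvdpZr.
  move/(congr1 (fun p : {poly F} => size p)): sE; rewrite size_s size_scale // => sE.
  have : (size (c ^+ 2)%R <= 1)%N.
    by rewrite (leq_trans (size_polyMleq c c)) //; lia.
  by rewrite -sE ltnS leqNgt d_gt0.
have r0 : r = 0.
  apply/eqP; have : r ^+ 2 * s == 0.
    apply/eqP/dvdXn_small; last exact: size_sqr_bound.
    by move: D1; rewrite z0 polyC0 mulr0 subr0.
  by rewrite mulf_eq0 (negbTE s0) orbF expf_eq0.
have [s1 sE] : exists s1, s = s1 * 'X.
  have : root s 0 by rewrite rootE z0.
  by move/factor_theorem => [s1]; rewrite subr0 => ->; exists s1.
have s10 : s1.[0] != 0.
  apply/negP => z1.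
  have /factor_theorem[s2] : root s1 0 by rewrite rootE z1.
  rewrite subr0 => s1E; have/sqf : 'X ^+ 2 %| s.
    by rewrite sE s1E -mulrA -expr2 dvdp_mull.
  by rewrite size_polyX.
split=> //; move: E; rewrite r0 add0r sE comp_polyM comp_polyX.
have -> : ('X^Q * R) ^+ 2 * (s1 * 'X) = 'X^Q * ('X^Q * R ^+ 2 * (s1 * 'X)) by ring.
have -> : (t + 'X^Q * T) ^+ 2 * ((s1 \Po 'X^Q) * 'X^Q) =
   'X^Q * ((t + 'X^Q * T) ^+ 2 * (s1 \Po 'X^Q)) by ring.
move/(mulfI XQ0) => E.
have D2 : 'X^Q %| t ^+ 2 * (s1.[0])%:P.
  have -> : t ^+ 2 * (s1.[0])%:P = 'X^Q * (R ^+ 2 * (s1 * 'X)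
     - (2%:R * t * T + 'X^Q * T ^+ 2) * (s1 \Po 'X^Q))
     - t ^+ 2 * (s1 \Po 'X^Q - (s1.[0])%:P).
    have E2 : 'X^Q * (R ^+ 2 * (s1 * 'X)) = (t + 'X^Q * T) ^+ 2 * (s1 \Po 'X^Q).
      by rewrite mulrA.
    by rewrite mulrBr E2; ring.
  by apply: dvdp_sub; [exact: dvdp_mulr | apply/dvdp_mull/comp_Xn_dvd].
move: D2; rewrite mulrC mul_polyC dvdpZr // => /dvdXn_small -/(_ st2) /eqP.
by rewrite expf_eq0 => /eqP.
Qed.

(** The lowest terms vanish by [indep_first]; then X^(2Q) cancels on both sides and the sums shift
    by one index. *)
Lemma indep_all J (r t : nat -> {poly F}) :
  (forall j, size (r j) <= B)%N -> (forall j, size (t j) <= B)%N ->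
  (\sum_(j < J) r j * 'X^(j * Q)) ^+ 2 * s =
  (\sum_(j < J) t j * 'X^(j * Q)) ^+ 2 * (s \Po 'X^Q) ->
  forall j, (j < J)%N -> r j = 0 /\ t j = 0.
Proof.
have XQ0 : ('X^Q : {poly F}) != 0 by rewrite -size_poly_eq0 size_polyXn.
elim: J r t => [//|J IH] r t sr st.
have split_sum (w : nat -> {poly F}) : \sum_(j < J.+1) w j * 'X^(j * Q) =
   w 0%N + 'X^Q * \sum_(j < J) w j.+1 * 'X^(j * Q).
  rewrite big_ord_recl mul0n expr0 mulr1; congr (_ + _).
  rewrite mulr_sumr; apply: eq_bigr => j _.
  by rewrite lift0 mulSn exprD; ring.
rewrite !split_sum => E; have [r0 t0] := indep_first (sr 0%N) (st 0%N) E.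
move: E; rewrite r0 t0 !add0r !exprMn -!mulrA. move=> /(mulfI XQ0)/(mulfI XQ0) E.
have IH' := IH (r \o S) (t \o S) (fun j => sr j.+1) (fun j => st j.+1).
rewrite !expr2 -!mulrA in IH'; have {}IH' := IH' E.
by case=> [//|j] jJ; exact: IH'.
Qed.

End Independence.

Lemma sum_nat_mul (V : nmodType) (f : nat -> V) (l N : nat) :
  \sum_(j < N * l) f j = \sum_(k < N) \sum_(i < l) f (i + k * l)%N.
Proof.
elim: N => [|N IH]; first by rewrite !big_ord0.
rewrite big_ord_recr /= -IH mulSn addnC big_split_ord /=; congr (_ + _).
by apply: eq_bigr => i _; rewrite addnC.
Qed.

Lemma pigeonhole_ker (U V : finZmodType) (f : U -> V) :
  {morph f : x y / x + y} -> (#|V| < #|U|)%N -> exists2 u, u != 0 & f u = 0.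
Proof.
move=> fD VU; have : ~ injective f.
  by move=> /leq_card; rewrite leqNgt VU.
move=> ninj; have [u /andP[u0 /eqP fu]|none] := pickP (fun u => (u != 0) && (f u == 0)).
  by exists u.
case: ninj => a b E; apply/eqP; rewrite -subr_eq0; apply/negPn/negP => ab.
have fab : f (a - b) = 0 by apply: (addIr (f b)); rewrite -fD subrK add0r.
by have := none (a - b); rewrite ab fab eqxx.
Qed.

Lemma dvdp_prod_coprime (F : fieldType) (I : eqType) (r : seq I) (f : I -> {poly F})
    (h : {poly F}) :
  uniq r -> (forall i, i \in r -> f i %| h) ->
  (forall i j, i \in r -> j \in r -> i != j -> coprimep (f i) (f j)) ->
  \prod_(i <- r) f i %| h.
Proof.
elim: r => [|i r IH] /=; first by rewrite big_nil dvd1p.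
move=> /andP[ir ur] dh cp; rewrite big_cons Gauss_dvdp.
  rewrite dh ?mem_head // IH // => [j jr|j k jr kr]; first by rewrite dh // inE jr orbT.
  by apply: cp; rewrite inE ?jr ?kr orbT.
elim: r ir {ur IH dh} cp => [|j r IH] ir cp; first by rewrite big_nil coprimep1.
move: ir; rewrite inE negb_or => /andP[ij ir].
rewrite big_cons coprimepMr cp ?mem_head ?inE ?eqxx ?orbT //=.
apply: IH => // a b ha hb; apply: cp; move: ha hb; rewrite !inE.
  by case/orP => ->; rewrite ?orbT.
by move=> _; case/orP => ->; rewrite ?orbT.
Qed.

Lemma size_mul_bound (R : nzRingType) (p r : {poly R}) a b :
  (size p <= a.+1)%N -> (size r <= b)%N -> (size (p * r)%R <= a + b)%N.
Proof.
move=> sp sr; apply: (leq_trans (size_polyMleq p r)).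
by move: sp sr; move: (size p) (size r) => x y; lia.
Qed.

Section Reduction.
Variables (F : fieldType) (l N : nat).

(* [lcoef i p] collects in the variable Y the coefficients of [p] with index
   congruent to [i] modulo [l], so that [p] is congruent to
   [\sum_(i < l) 'X^i * lcoef i p] modulo [X^l - Y^l]. *)
Definition lcoef (i : nat) (p : {poly F}) : {poly F} :=
  \sum_(k < N) p`_(i + k * l) *: 'X^(k * l).

Lemma lcoefD i p q : lcoef i (p + q) = lcoef i p + lcoef i q.
Proof.
rewrite /lcoef -big_split /=; apply: eq_bigr => k _.
by rewrite coefD scalerDl.
Qed.

Lemma size_lcoef i (p : {poly F}) m : (size p <= m)%N -> (size (lcoef i p) <= m)%N.
Proof.
move=> sp; apply: (leq_trans (size_sum _ _ _)); apply/bigmax_leqP => k _.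
have [E|lt] := leqP (size p) (i + k * l); first by rewrite nth_default // scale0r size_poly0.
rewrite (leq_trans (size_scale_leq _ _)) // size_polyXn.
by apply: leq_trans sp; apply: leq_ltn_trans lt; rewrite leq_addl.
Qed.

(** X^(i + kl) is X^i (X^l)^k, where X^l may be replaced by x^l modulo [M]. The size bound lets [N]
    blocks of length [l] cover all coefficients. *)
Lemma lcoef_mod (M x p : {poly F}) : M %| 'X^l - x ^+ l -> (size p <= N * l)%N ->
  M %| p - \sum_(i < l) 'X^i * (lcoef i p \Po x).
Proof.
move=> Mx sp.
have -> : \sum_(i < l) 'X^i * (lcoef i p \Po x) =
   \sum_(k < N) \sum_(i < l) p`_(i + k * l) *: ('X^i * (x ^+ l) ^+ k).
  rewrite exchange_big /=; apply: eq_bigr => i _.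
  rewrite /lcoef raddf_sum mulr_sumr; apply: eq_bigr => k _.
  by rewrite /= comp_polyZ comp_Xn_poly -scalerAr mulnC exprM.
have {1}-> : p = \sum_(k < N) \sum_(i < l) p`_(i + k * l) *: 'X^(i + k * l).
  rewrite -(sum_nat_mul (fun j => p`_j *: 'X^j)) -poly_def; apply/polyP => j.
  by rewrite coef_poly; case: ltnP => // h; rewrite nth_default // (leq_trans sp).
rewrite -sumrB; apply: (big_ind (fun h => M %| h)) => [|a b|k _]; rewrite ?dvdp0 //.
  exact: dvdp_add.
rewrite -sumrB; apply: (big_ind (fun h => M %| h)) => [|a b|i _]; rewrite ?dvdp0 //.
  exact: dvdp_add.
rewrite -scalerBr -mul_polyC exprD mulnC exprM -mulrBr mulrA dvdp_mull //.
by rewrite subrXX dvdp_mulr.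
Qed.

End Reduction.

(** Equations on the left: [l] polynomials with J + B + ed coefficients, where J = e + 1 + d;
    unknowns on the right. As 2J = l + 2d + 1, the unknowns exceed lB by (2d + 1)B, about (d +
    1/2)Q, while the other equations number l(e + 1)(d + 1), about l^2 (d + 1)/2, with l^2 at most
    Q. *)
Lemma stepanov_unknowns l e d B Q : (l = e.*2.+1 -> 0 < d -> Q <= B.*2 + d.+1 ->
  l * l <= Q -> l.*2 + 4 * d + 2 < Q ->
  l * (e.+1 + d + B + e * d) < (e.+1 + d) * B + (e.+1 + d) * B)%N.
Proof.
move=> le d0 QB ll Qb.
have h1 := leq_mul ll (leqnn d.+1).
have h2 := leq_mul QB (leqnn (1 + 2 * d)).
have h3 := leq_mul Qb (leqnn d).
have h4 : (l <= l * d)%N by rewrite leq_pmulr.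
have h5 : (d <= d * d)%N by rewrite leq_pmulr.
rewrite le in h1 h3 h4 *; lia.
Qed.

Lemma stepanov_degree X l e d B m Q : (l = e.*2.+1 -> Q = m.*2.+1 -> B.*2 + d <= Q ->
  X < B + d * m + (e + d) * Q -> 2 * X <= Q * (l + 3 * d))%N.
Proof.
move=> le Qm BQ hX; have h1 : (d * Q = 2 * (d * m) + d)%N by rewrite Qm; lia.
have h2 : (l * Q = 2 * (e * Q) + Q)%N by rewrite le; lia.
lia.
Qed.

Lemma stepanov_exponent l e w m : (l = e.*2.+1 -> odd w -> l * w = m.*2.+1 ->
  m = l * (w.-1)./2 + e)%N.
Proof.
move=> le ow; have wE : w = ((w.-1)./2).*2.+1.
  have w0 : (0 < w)%N by case: w ow.
  by rewrite -[LHS](prednK w0) -[w.-1 in LHS]odd_double_half -subn1 oddB // ow.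
by move: wE; move: (w.-1)./2 => v ->; rewrite le; lia.
Qed.

Lemma stepanov_size l e d B Q : (l = e.*2.+1 -> B.*2 + d <= Q -> e * d + B <= Q * l)%N.
Proof.
move=> -> BQ; have h1 : (e * d <= e * Q)%N by rewrite leq_mul2l; apply/orP; right; lia.
lia.
Qed.

(** * The auxiliary polynomial and the count of primes with a given character value *)

Section Stepanov.
Variables (F : finFieldType) (s : {poly F}) (d n g : nat) (a : int).
Let q := #|F|.
Hypothesis oddq : odd q.
Hypothesis size_s : size s = d.+1.
Hypothesis d_gt0 : (0 < d)%N.
Hypothesis sqf : forall b : {poly F}, b ^+ 2 %| s -> (size b <= 1)%N.
Hypothesis gn : (g.*2 <= n)%N.
Hypothesis ha : a = 1 \/ a = -1.

(** Each counted prime divides [aux] to the power [l]. There are [J] blocks in [aux], each with two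
    unknown polynomials of size at most [B], and [K] bounds the size of each of the [l] conditions
    [eqn]. It stays small since the conditions are written in the variable Y = X^Q, in which X^(jQ)
    has degree j. *)
Let l := (q ^ g)%N.
Let Q := (q ^ n)%N.
Let m := (Q.-1)./2.
Let e := (l.-1)./2.
Let B := ((Q - d)./2)%N.
Let J := (e.+1 + d)%N.
Let K := (J + B + e * d)%N.
Hypothesis Qbig : (l.*2 + (4 * d) + 2 < Q)%N.

Let oddl : odd l. Proof. by rewrite oddX oddq orbT. Qed.
Let oddQ : odd Q. Proof. by rewrite oddX oddq orbT. Qed.
Let lE : l = e.*2.+1.
Proof.
have l0 : (0 < l)%N by case: l oddl.
by rewrite /e -[l in LHS](prednK l0) -[l.-1 in LHS]odd_double_half -subn1 oddB // oddl.
Qed.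
Let QE : Q = m.*2.+1.
Proof.
have l0 : (0 < Q)%N by case: Q oddQ.
by rewrite /m -[Q in LHS](prednK l0) -[Q.-1 in LHS]odd_double_half -subn1 oddB // oddQ.
Qed.
Let QlE : Q = (l * q ^ (n - g))%N.
Proof. by rewrite -expnD subnKC // (leq_trans _ gn) // -addnn leq_addr. Qed.
Let ll_Q : (l * l <= Q)%N.
Proof. by rewrite -expnD addnn leq_exp2l // finNzRing_gt1. Qed.
Let BQ : (B.*2 + d <= Q)%N.
Proof. by rewrite /B; lia. Qed.
Let QB : (Q <= B.*2 + d.+1)%N.
Proof. by rewrite /B; lia. Qed.

Let aF : F := a%:~R.
Let rpol (r : 'M[F]_(J, B)) (j : nat) : {poly F} :=
  if insub j is Some i then rVpoly (row i r) else 0.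

Let size_rpol r j : (size (rpol r j) <= B)%N.
Proof. by rewrite /rpol; case: insubP => [i _ _|]; rewrite ?size_poly ?size_poly0. Qed.

Let rpolD r r' j : rpol (r + r') j = rpol r j + rpol r' j.
Proof. by rewrite /rpol; case: insubP => [i _ _|]; rewrite ?addr0 ?linearD. Qed.

Let rpol_eq0 r : (forall j, (j < J)%N -> rpol r j = 0) -> r = 0.
Proof.
move=> h; apply/row_matrixP => i; rewrite row0; have := h i (ltn_ord i).
rewrite /rpol; case: insubP => [j _ ij|]; last by rewrite ltn_ord.
have -> : j = i by exact/val_inj.
by move/(congr1 (@poly_rV F B)); rewrite rVpolyK raddf0.
Qed.

Let eqn (i : nat) (u : 'M[F]_(J, B) * 'M[F]_(J, B)) : {poly F} :=
  \sum_(j < J) 'X^j * (s ^+ e * lcoef l Q i (rpol u.1 j)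
                       + aF *: lcoef l Q i (rpol u.2 j * s ^+ e)).

Let eqnD i u v : eqn i (u + v) = eqn i u + eqn i v.
Proof.
rewrite /eqn -big_split /=; apply: eq_bigr => j _.
rewrite !rpolD mulrDl !lcoefD -!mul_polyC; ring.
Qed.

Let size_se : (size (s ^+ e)%R <= (e * d).+1)%N.
Proof. by rewrite (leq_trans (size_poly_exp_leq _ _)) // size_s /= mulnC. Qed.

Let size_eqn i u : (size (eqn i u) <= K)%N.
Proof.
apply: (leq_trans (size_sum _ _ _)); apply/bigmax_leqP => j _.
have A : (size (s ^+ e * lcoef l Q i (rpol u.1 j)
                       + aF *: lcoef l Q i (rpol u.2 j * s ^+ e))%R <= e * d + B)%N.
  rewrite (leq_trans (size_polyD _ _)) // geq_max; apply/andP; split.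
    exact: size_mul_bound size_se (size_lcoef l Q i (size_rpol u.1 j)).
  rewrite (leq_trans (size_scale_leq _ _)) //; apply: size_lcoef.
  by rewrite mulrC; exact: size_mul_bound size_se (size_rpol u.2 j).
apply: (@leq_trans (j + (e * d + B))); last by rewrite /K; have := ltn_ord j; lia.
by apply: size_mul_bound A; rewrite size_polyXn.
Qed.

Let count_ineq : (l * K < J * B + J * B)%N.
Proof.
exact: stepanov_unknowns lE d_gt0 QB ll_Q Qbig.
Qed.

Let exists_u : exists2 u, u != 0 & forall i, (i < l)%N -> eqn i u = 0.
Proof.
pose f (u : 'M[F]_(J, B) * 'M[F]_(J, B)) : 'M[F]_(l, K) :=
  \matrix_(i < l, k < K) (eqn i u)`_k.
have fD : {morph f : u v / u + v}.
  by move=> u v; apply/matrixP => i k; rewrite !mxE eqnD coefD.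
(* The two unknown matrices are glued into one, whose cardinality is a single power of q. *)
pose f' (w : 'M[F]_(J, B + B)) := f (lsubmx w, rsubmx w).
have fD' : {morph f' : u v / u + v}.
  move=> u v; rewrite /f'.
  have -> : lsubmx (u + v) = lsubmx u + lsubmx v by apply/matrixP => i k; rewrite !mxE.
  have -> : rsubmx (u + v) = rsubmx u + rsubmx v by apply/matrixP => i k; rewrite !mxE.
  exact: (fD (lsubmx u, rsubmx u) (lsubmx v, rsubmx v)).
have [|w w0 fw] := pigeonhole_ker fD'.
  by rewrite !card_mx ltn_exp2l ?finNzRing_gt1 // mulnDr count_ineq.
have u0 : (lsubmx w, rsubmx w) != 0.
  by apply: contra_neq w0 => -[wl wr]; rewrite -(hsubmxK w) wl wr row_mx0.
have : f (lsubmx w, rsubmx w) = 0 by exact: fw.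
move: (lsubmx w, rsubmx w) u0 => u u0 fu.
exists u => // i il; apply/polyP => k; rewrite coef0.
have [kK|kK] := ltnP k K; last by rewrite nth_default // (leq_trans (size_eqn i u)).
by move/matrixP: fu => /(_ (Ordinal il) (Ordinal kK)); rewrite !mxE.
Qed.

Let aux (u : 'M[F]_(J, B) * 'M[F]_(J, B)) : {poly F} :=
  \sum_(j < J) (rpol u.1 j + rpol u.2 j * s ^+ m) * 'X^(j * Q).

Let s0 : s != 0. Proof. by rewrite -size_poly_eq0 size_s. Qed.

Let aux_neq0 u : u != 0 -> aux u != 0.
Proof.
move=> u0; apply: contra_neq u0 => aux0.
(* If [aux u] vanishes, the first sum is -s^m times the second. Squaring and multiplying by s
   produces s^(2m+1) = s^Q, which is s(X^Q). *)
have E : (\sum_(j < J) rpol u.1 j * 'X^(j * Q)) ^+ 2 * s =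
         (\sum_(j < J) rpol u.2 j * 'X^(j * Q)) ^+ 2 * (s \Po 'X^Q).
  have -> : \sum_(j < J) rpol u.1 j * 'X^(j * Q) =
            - ((\sum_(j < J) rpol u.2 j * 'X^(j * Q)) * s ^+ m).
    apply/eqP; rewrite -addr_eq0; apply/eqP; rewrite mulr_suml -big_split /=.
    rewrite -[RHS]aux0 /aux; by apply: eq_bigr => j _; ring.
  rewrite sqrrN exprMn -mulrA -exprM -exprSr muln2 -QE; congr (_ * _).
  exact: expr_card_comp.
have H := indep_all size_s d_gt0 sqf BQ (size_rpol u.1) (size_rpol u.2) E.
case: u {aux0 E} H => r t /= H; congr (_, _).
  by apply: rpol_eq0 => j /H[].
by apply: rpol_eq0 => j /H[].
Qed.

Let size_aux u : (size (aux u) <= B + d * m + (J.-1) * Q)%N.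
Proof.
apply: (leq_trans (size_sum _ _ _)); apply/bigmax_leqP => j _.
rewrite (leq_trans (size_polyMleq _ _)) // size_polyXn addnS /=.
apply: leq_add; last by apply: leq_mul => //; exact: (ltn_ord j).
rewrite (leq_trans (size_polyD _ _)) // geq_max (leq_trans (size_rpol _ _)) ?leq_addr //=.
rewrite mulrC addnC; apply: size_mul_bound (size_rpol u.2 j).
by have := size_poly_exp_leq s m; rewrite size_s.
Qed.

(* Modulo [P^l], with [x = X^Q]: [X^l = x^l], [s^l = s(x)^l] and [s(x)^m = a];
   hence [s(x)^e * s^m = a * s^e], and [s(x)^e * aux u] reduces to a combination
   of the [eqn i u] evaluated at [x]. *)
Let aux_dvd u P : P \is monic -> irreducible_poly P -> size P = n.+1 -> ~~ (P %| s) ->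
  chi P s = a -> (forall i, (i < l)%N -> eqn i u = 0) -> P ^+ l %| aux u.
Proof.
move=> Pm Pi sP Ps chia eq0.
pose x : {poly F} := 'X^Q; pose sx := s ^+ Q.
have sxE : sx = s \Po x by exact: expr_card_comp.
have PX : P ^+ l %| 'X^l - x ^+ l.
  apply: dvdp_exp_card; rewrite -dvdpNr opprB.
  by have := fermat_poly Pm Pi 'X; rewrite sP.
have Ps1 : P ^+ l %| s ^+ l - sx ^+ l.
  apply: dvdp_exp_card; rewrite -dvdpNr opprB.
  by have := fermat_poly Pm Pi s; rewrite sP.
have aQ : (aF%:P) ^+ Q = aF%:P :> {poly F} by rewrite -polyC_exp expf_card_expn.
have Ps2 : P ^+ l %| sx ^+ m - aF%:P.
  apply: (@dvdp_trans _ (P ^+ Q)); first by apply: dvdp_exp2l; rewrite QlE leq_pmulr // expn_gt0 (ltnW (finNzRing_gt1 F)).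
  rewrite -aQ -exprM mulnC exprM; apply: dvdp_exp_card.
  have := chi_expf oddq Pm Pi s; rewrite sP /= chia.
  by rewrite -(rmorph_int (@polyC F)).
have cop : coprimep (P ^+ l) (sx ^+ e).
  apply: coprimep_expl; apply: coprimep_expr; apply: coprimep_expr.
  by rewrite irreducible_poly_coprime.
rewrite -(Gauss_dvdpr _ cop).
have me : (m = l * ((q ^ (n - g)).-1)./2 + e)%N.
  by apply: (stepanov_exponent lE); [rewrite oddX oddq orbT | rewrite -QE QlE].
pose w := ((q ^ (n - g)).-1)./2.
have key : P ^+ l %| sx ^+ e * s ^+ m - aF%:P * s ^+ e.
  have -> : sx ^+ e * s ^+ m - aF%:P * s ^+ e =
     s ^+ e * (sx ^+ e * ((s ^+ l) ^+ w - (sx ^+ l) ^+ w) + (sx ^+ m - aF%:P)).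
    by rewrite me !exprD !exprM -/w; ring.
  apply: dvdp_mull; apply: dvdp_add => //; apply: dvdp_mull.
  by rewrite subrXX; apply: dvdp_mulr.
have sizeQl (p : {poly F}) : (size p <= e * d + B)%N -> (size p <= Q * l)%N.
  by move=> h; apply: (leq_trans h); exact: stepanov_size lE BQ.
have main : P ^+ l %| sx ^+ e * aux u - \sum_(i < l) 'X^i * (eqn i u \Po x).
  have -> : \sum_(i < l) 'X^i * (eqn i u \Po x) =
    \sum_(j < J) x ^+ j * \sum_(i < l) 'X^i * (sx ^+ e * (lcoef l Q i (rpol u.1 j) \Po x)
       + aF%:P * (lcoef l Q i (rpol u.2 j * s ^+ e) \Po x)).
    transitivity (\sum_(i < l) \sum_(j < J) 'X^i * (x ^+ j * (sx ^+ e * (lcoef l Q i (rpol u.1 j) \Po x)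
       + aF%:P * (lcoef l Q i (rpol u.2 j * s ^+ e) \Po x)))).
      apply: eq_bigr => i _; rewrite /eqn raddf_sum mulr_sumr; apply: eq_bigr => j _.
      rewrite /= comp_polyM comp_Xn_poly comp_polyD comp_polyM comp_polyZ rmorphXn /= -sxE.
      by rewrite -mul_polyC.
    rewrite exchange_big /=; apply: eq_bigr => j _; rewrite mulr_sumr.
    by apply: eq_bigr => i _; ring.
  rewrite /aux mulr_sumr -sumrB.
  apply: (big_ind (fun h => P ^+ l %| h)) => [|b c|j _]; rewrite ?dvdp0 //.
    exact: dvdp_add.
  set r := rpol u.1 j; set t := rpol u.2 j.
  pose r' := \sum_(i < l) 'X^i * (lcoef l Q i r \Po x).
  pose t' := \sum_(i < l) 'X^i * (lcoef l Q i (t * s ^+ e) \Po x).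
  have -> : \sum_(i < l) 'X^i * (sx ^+ e * (lcoef l Q i r \Po x)
       + aF%:P * (lcoef l Q i (t * s ^+ e) \Po x)) = sx ^+ e * r' + aF%:P * t'.
    rewrite /r' /t' !mulr_sumr -big_split /=; apply: eq_bigr => i _; ring.
  have -> : 'X^(j * Q) = x ^+ j by rewrite /x -exprM mulnC.
  have -> : sx ^+ e * ((r + t * s ^+ m) * x ^+ j) - x ^+ j * (sx ^+ e * r' + aF%:P * t')
    = x ^+ j * (sx ^+ e * (r - r') + aF%:P * (t * s ^+ e - t')
         + t * (sx ^+ e * s ^+ m - aF%:P * s ^+ e)) by ring.
  apply: dvdp_mull; apply: dvdp_add; last exact: dvdp_mull.
  apply: dvdp_add; apply: dvdp_mull; apply: lcoef_mod => //; apply: sizeQl.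
    by rewrite (leq_trans (size_rpol _ _)) // leq_addl.
  by rewrite mulrC; exact: size_mul_bound size_se (size_rpol u.2 j).
move: main; rewrite big1 ?subr0 // => i _.
by rewrite eq0 // comp_poly0 mulr0.
Qed.

(** The powers P^l of the counted primes are pairwise coprime and divide the nonzero [aux u], so l n
    times their number is at most its degree. *)
Lemma stepanov : (forall c : {ffun 'I_n -> F}, c \in Pset F n -> ~~ (monic_of c %| s)) ->
  (2 * l * n * #|[set c in Pset F n | chi (monic_of c) s == a]| <= Q * (l + 3 * d))%N.
Proof.
move=> nd; set S := [set _ in _ | _].
have [u u0 eq0] := exists_u.
have dv : \prod_(c <- enum S) (monic_of c ^+ l) %| aux u.
  apply: dvdp_prod_coprime; first exact: enum_uniq.
    move=> c; rewrite mem_enum inE => /andP[cP /eqP chia].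
    apply: aux_dvd => //; [exact: monic_of_monic | exact/PsetP | exact: size_monic_of | exact: nd].
  move=> c c'; rewrite !mem_enum => hc hc' cc'; move: hc hc'.
  rewrite inE => /andP[/PsetP cP _]; rewrite inE => /andP[/PsetP cP' _].
  apply: coprimep_expl; apply: coprimep_expr; rewrite irreducible_poly_coprime //.
  apply: contra cc' => dcc; have := cP'.2 _ _ dcc.
  rewrite size_monic_of => /(_ _) E; apply/eqP/(@monic_of_inj F n).
  apply/eqP; rewrite -eqp_monic ?monic_of_monic //; apply: E.
  by have := cP.1; rewrite size_monic_of; lia.
have := dvdp_leq (aux_neq0 u0) dv => /leq_trans /(_ (size_aux u)).
have -> : size (\prod_(c <- enum S) monic_of c ^+ l) = (l * n * #|S|).+1.
  rewrite cardE; elim: (enum S) => [|c r IH]; first by rewrite big_nil size_poly1 muln0.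
  rewrite big_cons size_monicM ?monic_exp ?monic_of_monic // ?IH; last first.
    by apply/monic_neq0/monic_prod => i _; rewrite monic_exp ?monic_of_monic.
  have -> : size (monic_of c ^+ l) = (l * n).+1.
    rewrite -[LHS]prednK ?size_exp ?size_monic_of /= 1?mulnC //.
    by rewrite size_poly_gt0 monic_neq0 ?monic_exp ?monic_of_monic.
  by rewrite addnS /= mulnS addSn.
move=> h; have -> : (2 * l * n * #|S| = 2 * (l * n * #|S|))%N by rewrite !mulnA.
exact: stepanov_degree lE QE BQ h.
Qed.

End Stepanov.

(** * Character sums over primes *)

Section Factor.
Variable F : fieldType.

Lemma irreducible_factor (p : {poly F}) : (1 < size p)%N ->
  exists P, [/\ P \is monic, irreducible_poly P & P %| p].
Proof.
have [m] := ubnP (size p); elim: m p => // m IH p pm p1.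
have p0 : p != 0 by rewrite -size_poly_gt0 ltnW.
have [irr|nirr] := pselect (irreducible_poly p).
  have lp : (lead_coef p)^-1 != 0 by rewrite invr_eq0 lead_coef_eq0.
  exists ((lead_coef p)^-1 *: p); split; last by rewrite dvdpZl.
    by rewrite monicE lead_coefZ mulVf // lead_coef_eq0.
  split; first by rewrite size_scale.
  by move=> r r1; rewrite dvdpZr // eqp_sym (eqp_ltrans (eqp_scale _ lp)) eqp_sym; apply: irr.2.
apply: contrapT => no; apply: nirr; split => // r r1 rp.
have r0 : r != 0 by apply: contraTneq rp => ->; rewrite dvd0p.
rewrite -dvdp_size_eqp // eqn_leq dvdp_leq //= leqNgt; apply/negP => sr.
have sr1 : (1 < size r)%N by rewrite ltn_neqAle eq_sym r1 size_poly_gt0.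
have [|P [Pm Pi Pr]] := IH r _ sr1; first exact: leq_trans sr _.
by apply: no; exists P; split=> //; exact: dvdp_trans Pr rp.
Qed.

(** A prime factor of H / gcd(H, G) divides H, hence G, hence the gcd, so its square would divide
    H. *)
Lemma dvdp_squarefree (H G : {poly F}) : H != 0 ->
  (forall b : {poly F}, b ^+ 2 %| H -> (size b <= 1)%N) ->
  (forall P, P \is monic -> irreducible_poly P -> P %| H -> P %| G) -> H %| G.
Proof.
move=> H0 sqf dG; have /dvdpP[h hE] := dvdp_gcdl H G.
have [sh|sh] := leqP (size h) 1; last first.
  have [P [Pm Pi Ph]] := irreducible_factor sh.
  have PH : P %| H by rewrite hE dvdp_mulr.
  have : P ^+ 2 %| H by rewrite hE expr2 dvdp_mul // dvdp_gcd PH dG.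
  by move/sqf; rewrite leqNgt Pi.1.
have [c hc] : exists c, h = c%:P by exists h`_0; exact: size1_polyC.
have c0 : c != 0 by apply: contraNneq H0 => c0; rewrite hE hc c0 mul0r.
by rewrite hE hc mul_polyC dvdpZl // dvdp_gcdr.
Qed.

Lemma squarefree_decomp (f : {poly F}) : f \is monic ->
  exists s t, [/\ s \is monic, t \is monic, f = s * t ^+ 2
     & forall b : {poly F}, b ^+ 2 %| s -> (size b <= 1)%N].
Proof.
have [m] := ubnP (size f); elim: m f => // m IH f fm fmon.
have [sq|] := pselect (forall b : {poly F}, b ^+ 2 %| f -> (size b <= 1)%N).
  by exists f, 1; split=> //; rewrite ?monic1 // expr1n mulr1.
move/existsNP => [b /not_implyP[bf /negP]]; rewrite -ltnNge => b1.
have b0 : b != 0 by rewrite -size_poly_gt0 ltnW.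
pose c := (lead_coef b)^-1 *: b.
have lb : (lead_coef b)^-1 != 0 by rewrite invr_eq0 lead_coef_eq0.
have cm : c \is monic by rewrite monicE lead_coefZ mulVf // lead_coef_eq0.
have : c ^+ 2 %| f by rewrite exprZn dvdpZl // expf_neq0.
move/dvdpP => [f' fE].
have f'm : f' \is monic by rewrite -(monicMr _ (monic_exp 2 cm)) -fE.
have sc : size c = size b by rewrite size_scale.
have [||s [t [sm tm f'E sqf]]] := IH f'; rewrite ?f'm //.
  rewrite -ltnS; apply: leq_trans fm; rewrite ltnS fE size_monicM ?monic_neq0 ?monic_exp //.
  rewrite expr2 size_monicM ?monic_neq0 // sc.
  by move: b1 (size_poly_gt0 f'); rewrite monic_neq0 //; move: (size b) (size f') => x y; lia.
exists s, (t * c); split=> //; first by rewrite monicMr.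
by rewrite fE f'E -mulrA -exprMn.
Qed.

End Factor.

Lemma size1_polyC_monic (R : nzRingType) (p : {poly R}) :
  p \is monic -> size p = 1%N -> p = 1.
Proof.
move=> /monicP pm sp; have := size1_polyC (eq_leq sp).
by move: pm; rewrite lead_coefE sp /= => ->.
Qed.

Lemma size_prod_monic (R : nzRingType) (I : finType) (A : pred I) (f : I -> {poly R}) :
  (forall i, A i -> f i \is monic) ->
  size (\prod_(i | A i) f i) = (\sum_(i | A i) (size (f i)).-1).+1.
Proof.
move=> fm; pose K (p : {poly R}) k := size p = k.+1 /\ p \is monic.
suff [] : K (\prod_(i | A i) f i) (\sum_(i | A i) (size (f i)).-1)%N by [].
elim/big_rec2: _ => [|i k p Ai [sp pm]]; rewrite /K.
  by rewrite size_poly1 monic1.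
rewrite monicMr ?fm //; split=> //.
have f0 : (0 < size (f i))%N by rewrite size_poly_gt0 monic_neq0 ?fm.
rewrite size_monicM ?fm ?monic_neq0 // sp addnS /=.
by rewrite -[in LHS](prednK f0).
Qed.

(** * A lower bound for the number of primes of degree n *)

Section PrimeCount.
Variable F : finFieldType.
Let q := #|F|.
Let q1 : (1 < q)%N. Proof. exact: finNzRing_gt1. Qed.

Lemma card_field_fix (K : finFieldType) k : (1 < k)%N -> (forall y : K, y ^+ k = y) ->
  (#|K| <= k)%N.
Proof.
move=> k1 fix_k; have sz : size ('X^k - 'X : {poly K}) = k.+1.
  by rewrite size_polyDl ?size_polyXn // size_polyN size_polyX.
have p0 : 'X^k - 'X != 0 :> {poly K} by rewrite -size_poly_eq0 sz.
have := max_poly_roots p0 _ (enum_uniq K); rewrite sz -cardE ltnS; apply.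
by apply/allP => y _; rewrite rootE !hornerE fix_k subrr.
Qed.

(** The q^n-th power fixes X modulo P, hence the whole residue field, and so does the power of
    exponent q^(n mod e). If n mod e were positive, that would give q^e roots to a polynomial of
    smaller degree. *)
Lemma irreducible_dvd_degree (P : {poly F}) e n : P \is monic -> irreducible_poly P ->
  size P = e.+1 -> P %| 'X^(q ^ n) - 'X -> (e %| n)%N.
Proof.
move=> Pm Pi sP PX; have [K [ev [ev0 cK sj]]] := residue_field Pm Pi.
rewrite sP /= in cK.
have fixn (y : K) : y ^+ (q ^ n) = y.
  have [f _ <-] := sj y; rewrite -rmorphXn; apply/eqP; rewrite -subr_eq0 -rmorphB ev0.
  elim/poly_ind: f => [|p c IH]; first by rewrite expr0n expn_eq0 gtn_eqF ?subr0 ?dvdp0 // ltnW.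
  rewrite exprD_card exprMn -polyC_exp expf_card_expn.
  have -> : p ^+ (q ^ n) * 'X^(q ^ n) + c%:P - (p * 'X + c%:P) =
    (p ^+ (q ^ n) - p) * 'X^(q ^ n) + p * ('X^(q ^ n) - 'X) by ring.
  by apply: dvdp_add; [exact: dvdp_mulr | exact: dvdp_mull].
have fixe (y : K) : y ^+ (q ^ e) = y by rewrite -cK expf_card.
have fixm j (y : K) : y ^+ (q ^ (j * e)) = y.
  by elim: j => [|j IH]; rewrite ?expr1 // mulSn expnD exprM fixe.
have e0 : (0 < e)%N by have := Pi.1; rewrite sP ltnS.
rewrite /dvdn; apply/negPn; rewrite -lt0n; apply/negP => r0.
have : (#|K| <= q ^ (n %% e))%N.
  apply: card_field_fix; first by rewrite -(exp1n (n %% e)) ltn_exp2r.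
  by move=> y; have := fixn y; rewrite {1}(divn_eq n e) expnD exprM fixm.
by rewrite cK leq_exp2l // leqNgt ltn_mod e0.
Qed.

(** The derivative of X^(q^n) - X is -1, because q^n vanishes in [F]. *)
Lemma XqX_squarefree n (b : {poly F}) : (0 < n)%N -> b ^+ 2 %| 'X^(q ^ n) - 'X ->
  (size b <= 1)%N.
Proof.
move=> n0 /dvdpP[h hE].
have q0 : (q ^ n)%:R = 0 :> F.
  have [p pr_p pcharp] := finPcharP F; apply/eqP; rewrite -(dvdn_pcharf pcharp).
  have := pnat_pchar_poly F n; rewrite -/q => pn.
  have qn1 : (1 < q ^ n)%N by rewrite -(exp1n n) ltn_exp2r.
  have pd := pdiv_dvd (q ^ n); have pp := pdiv_prime qn1.
  have : pdiv (q ^ n) \in [pchar F].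
    by rewrite -pchar_poly; move/(pnatP _ (ltnW qn1)): pn; apply.
  by rewrite (pcharf_eq pcharp) inE => /eqP <-.
have : b %| ('X^(q ^ n) - 'X)^`().
  rewrite hE derivM expr2 derivM; apply: dvdp_add; apply: dvdp_mull.
    exact: dvdp_mulr.
  by apply: dvdp_add; [exact: dvdp_mull | exact: dvdp_mulr].
rewrite derivB derivXn derivX -mulr_natr -polyC_natr q0 polyC0 mulr0 sub0r dvdpNr.
by move/dvdp_leq; rewrite size_poly1 oner_neq0; apply.
Qed.

Lemma sum_geom_le h : (\sum_(e < h) q ^ e.+1 <= 2 * q ^ h)%N.
Proof.
elim: h => [|h IH]; first by rewrite big_ord0.
rewrite big_ord_recr /= expnS; move: IH q1; set w := (q ^ h)%N.
by move: (\sum_(_ < _) _)%N => S; nia.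
Qed.

(** The squarefree X^(q^n) - X has only prime factors of degree dividing n: those of degree n divide
    [G2], and the others, of degree at most n/2, divide [G1]. Comparing degrees replaces the exact
    count. *)
Lemma card_Pset_ge n : (0 < n)%N -> (q ^ n <= n * #|Pset F n| + 2 * q ^ n./2)%N.
Proof.
move=> n0.
pose G1 : {poly F} := \prod_(e < n./2) ('X^(q ^ e.+1) - 'X).
pose G2 : {poly F} := \prod_(c in Pset F n) monic_of c.
have monX k : (1 < k)%N -> 'X^k - 'X \is @monic F.
  move=> k1; rewrite monicE lead_coefDl ?lead_coefXn // size_polyN size_polyX size_polyXn.
  by rewrite ltnS.
have szX k : (1 < k)%N -> size ('X^k - 'X : {poly F}) = k.+1.
  by move=> k1; rewrite size_polyDl ?size_polyXn // size_polyN size_polyX.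
have qk k : (0 < k)%N -> (1 < q ^ k)%N by move=> k0; rewrite -(exp1n k) ltn_exp2r.
have G1m : G1 \is monic by apply: monic_prod => e _; apply: monX; exact: qk.
have G2m : G2 \is monic by apply: monic_prod => c _; exact: monic_of_monic.
have dv : 'X^(q ^ n) - 'X %| G1 * G2.
  apply: dvdp_squarefree; first by rewrite monic_neq0 // monX // qk.
    by move=> b; exact: XqX_squarefree.
  move=> P Pm Pi PX; have [e sP] : exists e, size P = e.+1.
    by exists (size P).-1; rewrite prednK // size_poly_gt0 monic_neq0.
  have en := irreducible_dvd_degree Pm Pi sP PX.
  have e0 : (0 < e)%N by have := Pi.1; rewrite sP ltnS.
  have [ene|nen] := eqVneq e n.
    apply: dvdp_mull; subst e; rewrite -(monic_of_coef Pm sP) /G2.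
    set c := [ffun _ => _]; rewrite (bigD1 c) ?dvdp_mulr //.
    by apply/PsetP; rewrite monic_of_coef.
  have eh : (e.-1 < n./2)%N.
    have e2n : (2 * e <= n)%N.
      case/dvdnP: en => -[|[|j]] nE; [lia | by rewrite nE mul1n eqxx in nen |].
      by rewrite nE leq_mul2r orbT.
    lia.
  apply: dvdp_mulr; rewrite /G1 (bigD1 (Ordinal eh)) // dvdp_mulr //= prednK //.
  by have := fermat_poly Pm Pi 'X; rewrite sP.
have G12m : G1 * G2 \is monic by rewrite monicMr.
have := dvdp_leq (monic_neq0 G12m) dv.
rewrite szX ?qk // size_monicM ?monic_neq0 //.
have -> : size G2 = (n * #|Pset F n|).+1.
  rewrite /G2 size_prod_monic => [|c _]; last exact: monic_of_monic.
  rewrite (eq_bigr (fun=> n)) => [|c _]; last by rewrite size_monic_of.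
  by rewrite sum_nat_const mulnC.
have -> : size G1 = (\sum_(e < n./2) q ^ e.+1).+1.
  rewrite /G1 size_prod_monic => [|e _]; last by rewrite monX // qk.
  by congr _.+1; apply: eq_bigr => e _; rewrite szX // qk.
have := sum_geom_le n./2; move: (\sum_(e < n./2) q ^ e.+1)%N => S.
move: (2 * q ^ n./2)%N (n * #|Pset F n|)%N (q ^ n)%N => x y z; lia.
Qed.

End PrimeCount.

(** * Square root cancellation for nonsquare arguments *)

Section CharSum.
Variables (F : finFieldType).
Let q := #|F|.
Hypothesis q4 : (q %% 4 = 1)%N.

Lemma card_ge5 : (5 <= q)%N.
Proof. by have := finNzRing_gt1 F; rewrite -/q; lia. Qed.

Lemma card_odd : odd q.
Proof. lia. Qed.

Lemma lt_exp_card g : (g < q ^ g)%N.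
Proof. exact: ltn_expl (finNzRing_gt1 F). Qed.

(** Stepanov's method only bounds N(1) and N(-1) from above; the lower bound for their sum, the
    number of primes, then bounds their difference on both sides. *)
Lemma charsum_squarefree (s : {poly F}) (d n g : nat) : size s = d.+1 -> (0 < d)%N ->
  (forall b : {poly F}, b ^+ 2 %| s -> (size b <= 1)%N) -> (1 <= g)%N ->
  (n = 2 * g + 1 \/ n = 2 * g + 2)%N -> (d < n)%N ->
  `|\sum_(c in Pset F n) chi (monic_of c) s| <= (4 * q ^ g.+2)%:Z.
Proof.
move=> ss d0 sqf g1 hn dn.
have n0 : (0 < n)%N by lia.
have s0 : s != 0 by rewrite -size_poly_eq0 ss.
have nd (c : {ffun 'I_n -> F}) : c \in Pset F n -> ~~ (monic_of c %| s).
  by move=> _; apply/negP => /(dvdp_leq s0); rewrite size_monic_of ss; lia.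
have gn : (g.*2 <= n)%N by lia.
have Qbig : ((q ^ g).*2 + 4 * d + 2 < q ^ n)%N.
  have nE : (g + g.+1 <= n)%N by lia.
  apply: (@leq_trans (q ^ (g + g.+1))%N); last by rewrite leq_exp2l // finNzRing_gt1.
  have xg := lt_exp_card g; have q5 := card_ge5.
  have x5 : (5 <= q ^ g)%N by apply: (leq_trans q5); rewrite -{1}(expn1 q) leq_exp2l // finNzRing_gt1.
  rewrite expnD expnS; move: (q ^ g)%N xg x5 => x xg x5.
  have h1 : (x * (5 * 5) <= x * (q * x))%N by rewrite leq_mul2l leq_mul ?orbT.
  lia.
pose N (a : int) := #|[set c in Pset F n | chi (monic_of c) s == a]|.
have st (a : int) : a = 1 \/ a = -1 -> (2 * q ^ g * n * N a <= q ^ n * (q ^ g + 3 * d))%N.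
  move=> ha; exact: (stepanov card_odd ss d0 sqf gn ha Qbig nd).
have N1 := st 1 (or_introl erefl); have N2 := st (-1) (or_intror erefl).
have Nsum : (N 1%R + N (-1)%R = #|Pset F n|)%N.
  rewrite /N -cardsUI -[RHS]addn0; congr (_ + _)%N.
    apply: eq_card => c; rewrite in_setU [X in X || _]in_set [X in _ || X]in_set.
    have [cP|//] := boolP (c \in Pset F n).
    by have [|] := chi_cases (nd _ cP) => ->.
  apply/eqP; rewrite cards_eq0; apply/eqP/setP => c.
  rewrite in_setI [X in X && _]in_set [X in _ && X]in_set in_set0.
  by case: (chi (monic_of c) s =P 1) => [->|_]; rewrite !andbF.
have sumE : \sum_(c in Pset F n) chi (monic_of c) s = (N 1)%:Z - (N (-1))%:Z.
  transitivity (\sum_(c in Pset F n) (((chi (monic_of c) s == 1) : nat)%:Z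
                  - ((chi (monic_of c) s == -1) : nat)%:Z)).
    by apply: eq_bigr => c /nd/chi_cases[] ->.
  have cnt (a : int) : (N a)%:Z = \sum_(c in Pset F n) ((chi (monic_of c) s == a) : nat)%:Z.
    rewrite /N -sum1_card -(big_morph Posz PoszD (erefl (0%:Z))); congr Posz.
    rewrite [RHS](eq_bigr (fun c => if chi (monic_of c) s == a then 1 else 0)%N); last first.
      by move=> c _; case: eqP.
    by rewrite -big_mkcondr /=; apply: eq_bigl => c; rewrite in_set.
  by rewrite sumrB !cnt.
have cP := card_Pset_ge F n0; rewrite -/q -Nsum in cP.
have hh : (q ^ n./2 <= q ^ g.+1)%N by rewrite leq_exp2l ?finNzRing_gt1 //; lia.
have QE : (q ^ n <= q ^ g * q ^ g.+2)%N.
  by rewrite -expnD leq_exp2l ?finNzRing_gt1 //; lia.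
have QE2 : exists2 w, (q ^ n = q ^ g * w)%N & (w <= q ^ g.+2)%N.
  exists (q ^ (n - g))%N; first by rewrite -expnD subnKC //; lia.
  by rewrite leq_exp2l ?finNzRing_gt1 //; lia.
case: QE2 => w Qw wq.
have h5 : (5 * q ^ g.+1 <= q ^ g.+2)%N by rewrite [(q ^ g.+2)%N]expnS leq_mul2r card_ge5 orbT.
have g0 : (0 < q ^ g)%N by rewrite expn_gt0 (ltnW (finNzRing_gt1 F)).
rewrite sumE; move: N1 N2 cP hh wq h5 g0; rewrite Qw.
move: (q ^ n./2)%N (q ^ g.+1)%N (q ^ g.+2)%N (q ^ g)%N (N 1%R) (N (-1)%R).
move=> a b e l x y N1 N2 cP hh wq h5 l0.
have M1 : (2 * n * x <= w * (l + 3 * d))%N.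
  by rewrite -(leq_pmul2l l0); move: N1; rewrite !mulnA [(2 * l)%N]mulnC.
have M2 : (2 * n * y <= w * (l + 3 * d))%N.
  by rewrite -(leq_pmul2l l0); move: N2; rewrite !mulnA [(2 * l)%N]mulnC.
have wd : (w * d <= e * d)%N by rewrite leq_mul2r wq orbT.
have de : (e * d + e <= e * n)%N by rewrite -mulnSr leq_mul2l dn orbT.
(* In n(x - y) = 2nx - n(x + y) the main terms wl cancel, leaving at most 3wd + 2q^(n/2). This is
   below 4n q^(g+2) as d < n. *)
have n1 : (n * (x - y) <= n * (4 * e))%N by rewrite mulnBr; lia.
have n2 : (n * (y - x) <= n * (4 * e))%N by rewrite mulnBr; lia.
rewrite !leq_pmul2l // in n1 n2; lia.
Qed.

Lemma charsum_nonsquare (f : {poly F}) (n g : nat) : f \is monic ->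
  (forall t : {poly F}, f <> t ^+ 2) -> (1 <= g)%N ->
  (n = 2 * g + 1 \/ n = 2 * g + 2)%N -> (size f <= n)%N ->
  `|\sum_(c in Pset F n) chi (monic_of c) f| <= (4 * q ^ g.+2)%:Z.
Proof.
move=> fm fns g1 hn fn.
have [s [t [sm tm fE sqf]]] := squarefree_decomp fm.
have t0 := monic_neq0 tm; have s0 := monic_neq0 sm.
have szf : (size f + 2 = size s + size t + size t)%N.
  rewrite fE size_monicM ?expf_neq0 // expr2 size_monicM //.
  move: (size_poly_gt0 t) (size_poly_gt0 s); rewrite t0 s0.
  by move: (size s) (size t) => x y; lia.
have [d sd] : exists d, size s = d.+1.
  by exists (size s).-1; rewrite prednK // size_poly_gt0.
have d0 : (0 < d)%N.
  rewrite lt0n; apply/eqP => d0; apply: (fns t).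
  by rewrite fE; have /eqP := sd; rewrite d0 => /eqP s1; rewrite (size1_polyC_monic sm s1) mul1r.
have dn : (d < n)%N.
  move: szf fn sd (size_poly_gt0 t); rewrite t0.
  by move: (size s) (size t) (size f) => x y z; lia.
have := charsum_squarefree sd d0 sqf g1 hn dn.
rewrite (eq_bigr (fun c => chi (monic_of c) f)) // => c cP.
have cm := monic_of_monic c; have/PsetP ci := cP.
rewrite fE chiM ?card_odd // chi_sqr ?card_odd ?mulr1 //.
apply/negP => /(dvdp_leq t0); rewrite size_monic_of.
move: szf fn sd; move: (size s) (size t) (size f) => x y z; lia.
Qed.

End CharSum.

(** * The functional equation *)

Definition pol_of (F : finFieldType) (d : nat) (c : {ffun 'I_d -> F}) : {poly F} :=
  \sum_(i < d) (c i)%:P * 'X^i.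

Lemma coef_pol_of (F : finFieldType) d (c : {ffun 'I_d -> F}) j :
  (pol_of c)`_j = if insub j is Some i then c i else 0.
Proof.
have -> : pol_of c = \poly_(i < d) (if insub i is Some j then c j else 0).
  rewrite poly_def; apply: eq_bigr => i _; rewrite mul_polyC; congr (_ *: _).
  by case: insubP => [k _ ik|]; [congr (c _); exact/val_inj | rewrite ltn_ord].
rewrite coef_poly; case: ltnP => // h.
by case: insubP => // i; rewrite ltnNge h.
Qed.

Lemma size_pol_of (F : finFieldType) d (c : {ffun 'I_d -> F}) : (size (pol_of c) <= d)%N.
Proof.
apply/leq_sizeP => j h; rewrite coef_pol_of; case: insubP => // i.
by rewrite ltnNge h.
Qed.

(** Shifting the coordinate [i0] translates the affine form by any prescribed amount, so it takes
    all values equally often. The factor q avoids a division in [int]. *)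
Lemma sum_equidistributed (F : finFieldType) e (b : F) (v : 'I_e -> F) (i0 : 'I_e)
    (f : F -> int) : v i0 != 0 ->
  #|F|%:R * (\sum_(c : {ffun 'I_e -> F}) f (b + \sum_(i < e) c i * v i)) =
  (#|F| ^ e)%:R * \sum_t f t.
Proof.
move=> v0; set S := (X in _ * X = _).
have ES (t : F) : S = \sum_(c : {ffun 'I_e -> F}) f ((b + \sum_(i < e) c i * v i) + t).
  rewrite /S (reindex_inj (addIr [ffun i => if i == i0 then t / v i0 else 0])) /=.
  apply: eq_bigr => c _; congr (f _); rewrite -addrA; congr (_ + _).
  rewrite (eq_bigr (fun i => c i * v i + (if i == i0 then t else 0))) => [|i _].
    by rewrite big_split /= -big_mkcond big_pred1_eq.
  by rewrite !ffunE mulrDl; case: eqP => [->|_]; rewrite ?divfK // ?mul0r.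
have -> : #|F|%:R * S = \sum_(t : F) \sum_(c : {ffun 'I_e -> F})
    f ((b + \sum_(i < e) c i * v i) + t).
  transitivity (\sum_(t : F) S); first by rewrite sumr_const mulr_natl.
  by apply: eq_bigr => t _; exact: ES.
rewrite exchange_big /= (eq_bigr (fun=> \sum_t f t)) => [|c _].
  by rewrite sumr_const card_ffun card_ord mulr_natl.
by rewrite [RHS](reindex_inj (addrI (b + \sum_(i < e) c i * v i))).
Qed.

Lemma sum_signs_neq0 (T : finType) (f : T -> int) : (forall x, f x = 1 \/ f x = -1) ->
  odd #|T| -> \sum_x f x != 0.
Proof.
move=> fs oT; apply/eqP => f0.
have : \sum_x (f x + 1) = 2%:R * \sum_x (f x == 1)%:R.
  rewrite mulr_sumr; apply: eq_bigr => x _.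
  by case: (fs x) => ->.
rewrite big_split /= f0 add0r sumr_const -natr_sum -natrM => /eqP; rewrite eqr_nat => /eqP E.
by move: oT; rewrite E oddM.
Qed.

Definition zero_ind (F : finFieldType) (t : F) : int := (t == 0)%:R.

Section ResidueSums.
Variables (F : finFieldType) (P : {poly F}) (n : nat) (K : finFieldType).
Variable ev : {rmorphism {poly F} -> K}.
Let q := #|F|.
Hypotheses (q4 : (q %% 4 = 1)%N) (n0 : (0 < n)%N).
Hypotheses (Pm : P \is monic) (Pi : irreducible_poly P) (sP : size P = n.+1).
Hypothesis ev0 : forall f, (ev f == 0) = (P %| f).
Hypothesis cK : #|K| = (q ^ n)%N.
Hypothesis ev_surj : forall y, exists2 f : {poly F}, (size f < size P)%N & ev f = y.

Lemma oddK : odd #|K|. Proof. by rewrite cK oddX (card_odd q4) orbT. Qed.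

Definition rep (y : K) : {poly F} := sval (cid2 (ev_surj y)).

Lemma size_rep y : (size (rep y) <= n)%N.
Proof. by rewrite -ltnS -sP /rep; case: cid2. Qed.

Lemma ev_rep y : ev (rep y) = y.
Proof. by rewrite /rep; case: cid2. Qed.

Lemma rep_ev (p : {poly F}) : (size p <= n)%N -> rep (ev p) = p.
Proof.
move=> sp; apply/eqP; rewrite -subr_eq0; apply/negPn/negP => h.
have : P %| rep (ev p) - p by rewrite -ev0 rmorphB ev_rep subrr.
move/(dvdp_leq h); rewrite sP ltnNge (leq_trans (size_polyD _ _)) //.
by rewrite geq_max size_rep size_polyN.
Qed.

Lemma repD y z : rep (y + z) = rep y + rep z.
Proof.
rewrite -{1}(ev_rep y) -{1}(ev_rep z) -rmorphD rep_ev //.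
by rewrite (leq_trans (size_polyD _ _)) // geq_max !size_rep.
Qed.

Lemma rep0 : rep 0 = 0.
Proof. by rewrite -(rmorph0 ev) rep_ev ?size_poly0. Qed.

Lemma repZ a y : rep (ev a%:P * y) = a *: rep y.
Proof.
rewrite -{1}(ev_rep y) -rmorphM mul_polyC rep_ev //.
by rewrite (leq_trans (size_scale_leq _ _)) ?size_rep.
Qed.

Lemma rep_eq0 y : (rep y == 0) = (y == 0).
Proof.
apply/eqP/eqP => [h|->]; last exact: rep0.
by rewrite -(ev_rep y) h rmorph0.
Qed.

Lemma sum_le_size (G : K -> int) e : (e <= n)%N ->
  \sum_(y | (size (rep y) <= e)%N) G y = \sum_(c : {ffun 'I_e -> F}) G (ev (pol_of c)).
Proof.
move=> en.
have coefK' (p : {poly F}) : (size p <= e)%N -> pol_of [ffun i : 'I_e => p`_i] = p.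
  move=> sp; apply/polyP => j; rewrite coef_pol_of.
  case: insubP => [i _ <-|]; first by rewrite ffunE.
  by rewrite -leqNgt => h; rewrite nth_default // (leq_trans sp).
rewrite (reindex_onto (fun c : {ffun 'I_e -> F} => ev (pol_of c))
   (fun y => [ffun i : 'I_e => (rep y)`_i])) /=.
  apply: eq_bigl => c; have sc := size_pol_of c.
  have -> : rep (ev (pol_of c)) = pol_of c by rewrite rep_ev // (leq_trans sc).
  rewrite sc /=.
  apply/eqP/ffunP => i; rewrite ffunE coef_pol_of.
  by case: insubP => [j _ ij|]; [congr (c _); exact/val_inj | rewrite ltn_ord].
by move=> y sy; rewrite coefK' // ev_rep.
Qed.

Lemma sum_eq_size (G : K -> int) e : (e < n)%N ->
  \sum_(y | (size (rep y) == e.+1)) G y =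
  \sum_(a : F | a != 0) \sum_(c : {ffun 'I_e -> F}) G (ev (a *: monic_of c)).
Proof.
move=> en; rewrite pair_big_dep /=.
rewrite (reindex_onto (fun u : F * {ffun 'I_e -> F} => ev (u.1 *: monic_of u.2))
   (fun y => (lead_coef (rep y), [ffun i : 'I_e => ((lead_coef (rep y))^-1 *: rep y)`_i]))) /=.
  apply: eq_bigl => -[a c] /=; rewrite andbT.
  have [->|a0] := eqVneq a 0; first by rewrite scale0r rmorph0 rep0 size_poly0.
  rewrite rep_ev ?size_scale ?size_monic_of // eqxx /=.
  rewrite lead_coefZ (monicP (monic_of_monic c)) mulr1 scalerA mulVf // scale1r.
  rewrite xpair_eqE eqxx /=; apply/eqP/ffunP => i; rewrite ffunE.
  exact: coef_monic_of.
move=> y /eqP sy; have l0 : lead_coef (rep y) != 0.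
  by rewrite lead_coef_eq0 -size_poly_eq0 sy.
rewrite monic_of_coef; first by rewrite scalerA mulfV // scale1r ev_rep.
  by rewrite monicE lead_coefZ mulVf.
by rewrite size_scale // invr_eq0.
Qed.

(** The coefficient of q^(-es) in L(s, chi_P). *)
Definition monsum e : int := \sum_(c : {ffun 'I_e -> F}) chi P (monic_of c).

Lemma chiE f : chi P f = qchar (ev f).
Proof. exact: chi_qchar ev0 ev_surj f. Qed.

Lemma monsum0 : monsum 0 = 1.
Proof.
rewrite /monsum (eq_bigr (fun=> 1)) => [|c _].
  by rewrite sumr_const card_ffun card_ord expn0.
by rewrite monic_of0 chiE rmorph1 (qchar1 oddK).
Qed.

(** (q^n - 1)/2 is (q - 1)/2 times 1 + q + ... + q^(n-1), and a^q = a turns the second factor into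
    n. *)
Lemma qchar_const a : qchar (ev a%:P) = qchar a ^+ n.
Proof.
have oF : odd #|F| := card_odd q4.
have half_exp k : a ^+ ((q ^ k).-1)./2 = a ^+ ((q.-1)./2 * k).
  elim: k => [|k IH]; first by rewrite muln0.
  have -> : ((q ^ k.+1).-1)./2 = (((q ^ k).-1)./2 * q + (q.-1)./2)%N.
    have : odd (q ^ k) by rewrite oddX oF orbT.
    rewrite expnSr; move: (q ^ k)%N => x ox.
    have [y ->] : exists y, x = y.*2.+1 by exists x./2; rewrite -[LHS]odd_double_half ox.
    have [z qz] : exists z, q = z.*2.+1 by exists q./2; rewrite -[LHS]odd_double_half oF.
    rewrite qz (_ : (_ * _).-1 = (y * z.*2.+1 + z).*2)%N; first by rewrite !doubleK.
    by nia.
  by rewrite exprD exprM expf_card IH mulnS addnC exprD.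
apply: (qchar_eq oddK).
  by case: (qchar_val a) => [->|[->|->]]; rewrite ?expr1n ?expr0n ?gtn_eqF //; auto;
    rewrite -signr_odd; case: (odd n); auto.
rewrite cK -rmorphXn /= -polyC_exp half_exp exprM -(qcharE oF) -rmorphXn /=.
by rewrite (rmorph_int (@polyC F)) rmorph_int.
Qed.

Lemma sum_qchar_size e (G : F -> int) : (e < n)%N ->
  \sum_(y | (size (rep y) == e.+1)) qchar y * G ((rep y)`_e) =
  (\sum_(a : F | a != 0) qchar a ^+ n * G a) * monsum e.
Proof.
move=> en; rewrite (sum_eq_size (fun y => qchar y * G ((rep y)`_e))) // mulr_suml.
apply: eq_bigr => a a0; rewrite /monsum mulr_sumr; apply: eq_bigr => c _.
rewrite rep_ev ?size_scale ?size_monic_of // coefZ.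
have -> : (monic_of c)`_e = 1.
  by have /monicP := monic_of_monic c; rewrite lead_coefE size_monic_of.
rewrite mulr1 -mul_polyC rmorphM (qcharM oddK) qchar_const chiE; ring.
Qed.

Definition top_coef (y : K) : F := (rep y)`_(n.-1).

Lemma top_coefD y z : top_coef (y + z) = top_coef y + top_coef z.
Proof. by rewrite /top_coef repD coefD. Qed.

Lemma top_coef_sum (I : finType) (f : I -> K) : top_coef (\sum_i f i) = \sum_i top_coef (f i).
Proof. by apply: (big_morph top_coef top_coefD); rewrite /top_coef rep0 coef0. Qed.

Lemma top_coefZ a y : top_coef (ev a%:P * y) = a * top_coef y.
Proof. by rewrite /top_coef repZ coefZ. Qed.

Lemma top_coef_shift y i : (size (rep y) + i <= n)%N ->
  top_coef (ev 'X^i * y) = (rep y)`_(n.-1 - i).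
Proof.
move=> h; have [->|y0] := eqVneq y 0.
  by rewrite mulr0 rep0 /top_coef rep0 !coef0.
rewrite /top_coef -{1}(ev_rep y) -rmorphM rep_ev; last first.
  by rewrite mulrC size_mulXn ?rep_eq0 // addnC.
rewrite mulrC coefMXn; case: ltnP => // ni.
have : (0 < size (rep y))%N by rewrite size_poly_gt0 rep_eq0.
by move: h ni; move: (size _) => s; lia.
Qed.

(** Together with [top_coef_orth0]: for the pairing that sends (p, y) to the top coefficient of p y,
    the polynomials of degree below n - e form the orthogonal complement of those of degree below
    e. *)
Lemma top_coef_orth y e : (e <= n)%N ->
  (size (rep y) <= n - e)%N \/
  exists i : 'I_e, top_coef (ev 'X^i * y) != 0.
Proof.
move=> en; have [|h] := leqP (size (rep y)) (n - e); [by left | right].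
have sy := size_rep y.
have ie : (n - size (rep y) < e)%N by move: sy h; move: (size _) => s; lia.
exists (Ordinal ie) => /=; rewrite top_coef_shift ?subnKC //.
have -> : (n.-1 - (n - size (rep y)) = (size (rep y)).-1)%N.
  by move: sy h; move: (size _) => s; lia.
by rewrite -lead_coefE lead_coef_eq0 -size_poly_gt0 (leq_ltn_trans _ h).
Qed.

Lemma top_coef_orth0 y e (i : 'I_e) : (e <= n)%N -> (size (rep y) <= n - e)%N ->
  top_coef (ev 'X^i * y) = 0.
Proof.
move=> en sy; have ie := ltn_ord i; rewrite top_coef_shift.
  by rewrite nth_default // (leq_trans sy) //; lia.
by move: sy; move: (size _) => s; lia.
Qed.

Lemma top_coef_pol_of e (c : {ffun 'I_e -> F}) y :
  top_coef (ev (pol_of c) * y) = \sum_(i < e) c i * top_coef (ev 'X^i * y).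
Proof.
rewrite /pol_of rmorph_sum mulr_suml top_coef_sum; apply: eq_bigr => i _.
by rewrite rmorphM -mulrA top_coefZ.
Qed.

Lemma top_coef_monic_of e (c : {ffun 'I_e -> F}) y :
  top_coef (ev (monic_of c) * y) = top_coef (ev 'X^e * y) + \sum_(i < e) c i * top_coef (ev 'X^i * y).
Proof.
by rewrite -top_coef_pol_of -top_coefD -mulrDl -rmorphD.
Qed.

(** A Gauss sum in which [G] of the linear form replaces the additive character. By [qchar_const]
    the character is nontrivial on constants exactly for odd n, so [G] is taken to be [qchar] for
    odd n and the indicator of 0 for even n. *)
Definition gauss (G : F -> int) : int := \sum_y qchar y * G (top_coef y).

Lemma gaussM G b : \sum_y qchar y * G (top_coef (b * y)) = qchar b * gauss G.
Proof.
have [->|b0] := eqVneq b 0.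
  rewrite qchar0 mul0r (eq_bigr (fun y => qchar y * G (top_coef 0))) => [|y _]; last by rewrite mul0r.
  by rewrite -mulr_suml (sum_qchar oddK) mul0r.
rewrite /gauss [in RHS](reindex_inj (mulfI b0)) mulr_sumr; apply: eq_bigr => y _.
by rewrite (qcharM oddK) !mulrA qchar_sqr // mul1r.
Qed.

Lemma q_neq0 : (q%:R : int) != 0.
Proof. by have := card_ge5 q4; rewrite -/q; lia. Qed.

(** Poisson summation. After the exchange of sums, the inner sum over [c] vanishes by
    equidistribution unless y is orthogonal to all degrees below e. On this complement it is
    constant, equal to q^e times [qchar] of the coefficient of index n - 1 - e, which is 0 unless y
    has exactly that degree. *)
Lemma feq_odd e : odd n -> (e < n)%N ->
  gauss (@qchar F) * monsum e = (q ^ e)%:R * ((q%:R - 1) * monsum (n.-1 - e)).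
Proof.
move=> on en.
have -> : gauss (@qchar F) * monsum e = \sum_y qchar y *
    \sum_(c : {ffun 'I_e -> F}) qchar (top_coef (ev (monic_of c) * y)).
  rewrite /monsum mulr_sumr.
  transitivity (\sum_(c : {ffun 'I_e -> F}) \sum_y qchar y * qchar (top_coef (ev (monic_of c) * y))).
    by apply: eq_bigr => c _; rewrite chiE (gaussM (@qchar F)) mulrC.
  by rewrite exchange_big; apply: eq_bigr => y _; rewrite mulr_sumr.
rewrite (bigID (fun y => (size (rep y) <= n - e)%N)) /= [X in _ + X]big1 ?addr0; last first.
  move=> y sy; have [sy'|[i vi]] := top_coef_orth y (ltnW en); first by rewrite sy' in sy.
  apply/eqP; rewrite mulf_eq0; apply/orP; right; apply/eqP/(mulfI q_neq0).
  rewrite mulr0; under eq_bigr do rewrite top_coef_monic_of.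
  rewrite (sum_equidistributed (top_coef (ev 'X^e * y)) (v := fun i => top_coef (ev 'X^i * y)) (@qchar F) vi).
  by rewrite (sum_qchar (card_odd q4)) mulr0.
rewrite (bigID (fun y => (size (rep y) == n - e)%N)) /= [X in _ + X]big1 ?addr0; last first.
  move=> y /andP[sy nsy]; rewrite big1 ?mulr0 // => c _.
  rewrite top_coef_monic_of big1 ?addr0 => [|i _]; last by rewrite top_coef_orth0 ?mulr0 // ltnW.
  rewrite top_coef_shift; last by move: sy; move: (size _) => s; lia.
  rewrite nth_default ?qchar0 //; move: sy nsy; move: (size _) => s; lia.
have ne : (n - e = (n.-1 - e).+1)%N by lia.
rewrite (eq_bigl (fun y => size (rep y) == (n.-1 - e).+1)); last first.
  by move=> y; rewrite -ne; case: eqP => [->|]; rewrite ?leqnn ?andbF.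
transitivity ((q ^ e)%:R * \sum_(y | size (rep y) == (n.-1 - e).+1)
    qchar y * qchar ((rep y)`_(n.-1 - e))).
  rewrite mulr_sumr; apply: eq_bigr => y /eqP sy.
  rewrite (eq_bigr (fun=> qchar ((rep y)`_(n.-1 - e)))) => [|c _].
    by rewrite sumr_const card_ffun card_ord -mulr_natl -/q; ring.
  rewrite top_coef_monic_of big1 ?addr0 => [|i _].
    by rewrite top_coef_shift // sy; lia.
  by rewrite top_coef_orth0 ?mulr0 ?sy ?ne // ltnW.
rewrite (sum_qchar_size (@qchar F)); last by lia.
congr (_ * (_ * _)).
rewrite (eq_bigr (fun=> 1)) => [|a a0].
  rewrite sumr_const cardC1; have := card_ge5 q4; rewrite -/q; case: q => // k _.
  by rewrite /= mulrS; ring.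
by rewrite -exprSr; case: (qchar_cases a0) => ->; rewrite ?expr1n // -signr_odd /= on.
Qed.

(* [monsum g] is a sum of [q^g] signs, hence odd; applied to it, the relation
   [monsum (2g) * monsum g = q^g * monsum g] decides the sign [monsum (2g) = q^g]. *)
Lemma monsum_odd g e : n = (2 * g + 1)%N -> (e <= 2 * g)%N ->
  (q ^ g)%:R * monsum e = (q ^ e)%:R * monsum (2 * g - e).
Proof.
move=> nE eg; have on : odd n by rewrite nE; lia.
have E (j : nat) : (j < n)%N -> monsum (2 * g) * monsum j = (q ^ j)%:R * monsum (2 * g - j).
  move=> jn; have q10 : (q%:R - 1 : int) != 0 by have := card_ge5 q4; rewrite -/q; lia.
  apply: (mulfI q10); rewrite mulrA.
  have := feq_odd on n0; rewrite monsum0 mulr1 expn0 mul1r subn0 => G0.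
  have := feq_odd on jn; rewrite G0 nE addn1 /= => ->; ring.
have gn : (g < n)%N by lia.
have A0 : monsum g != 0.
  apply: sum_signs_neq0; last by rewrite card_ffun card_ord oddX (card_odd q4) orbT.
  move=> c; apply: chi_cases; apply/negP => /(dvdp_leq (monic_of_neq0 c)).
  by rewrite size_monic_of sP; lia.
have := E g gn; have -> : (2 * g - g = g)%N by lia.
move/(mulIf A0) => <-; apply: E; lia.
Qed.

(** For even n the character is trivial on constants and L has a zero at q^(-s) = 1. The number
    [cumsum e.+1] is the coefficient of index e of L divided by 1 - q^(-s), the factor with a
    symmetric functional equation. *)
Definition cumsum e : int := \sum_(d < e) monsum d.

Lemma sum_le_qchar e : ~~ odd n -> (e <= n)%N ->
  \sum_(y | (size (rep y) <= e)%N) qchar y = (q%:R - 1) * cumsum e.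
Proof.
move=> en; elim: e => [|e IH] le; rewrite /cumsum.
  rewrite big_ord0 mulr0 big1 // => y; rewrite leqn0 size_poly_eq0 rep_eq0 => /eqP ->.
  exact: qchar0.
rewrite big_ord_recr /= mulrDr -IH 1?ltnW // (bigID (fun y => (size (rep y) <= e)%N)) /=.
congr (_ + _).
  apply: eq_bigl => y; have [h|h] := leqP (size (rep y)) e; last by rewrite andbF.
  by rewrite andbT leqW.
transitivity (\sum_(y | size (rep y) == e.+1) qchar y * (fun=> 1) ((rep y)`_e)).
  by apply: eq_big => [y|y _]; rewrite ?mulr1 // eqn_leq; case: (leqP (size _) e).
rewrite (sum_qchar_size (fun=> 1) le); congr (_ * _).
rewrite (eq_bigr (fun=> 1)) => [|a a0].
  rewrite sumr_const cardC1; have := card_ge5 q4; rewrite -/q; case: q => // k _.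
  by rewrite /= mulrS; ring.
by rewrite mulr1; case: (qchar_cases a0) => ->; rewrite ?expr1n // -signr_odd (negbTE en).
Qed.

Lemma gauss_zero_ind : ~~ odd n -> gauss (@zero_ind F) = (q%:R - 1) * cumsum n.-1.
Proof.
move=> en; rewrite -sum_le_qchar ?leq_pred // /gauss [RHS]big_mkcond /=.
apply: eq_bigr => y _; rewrite /zero_ind /top_coef.
have -> : ((rep y)`_n.-1 == 0) = (size (rep y) <= n.-1)%N.
  apply/eqP/idP => [h|h]; last by rewrite nth_default.
  rewrite leqNgt; apply/negP => h2; move: h.
  have -> : n.-1 = (size (rep y)).-1.
    by have := size_rep y; move: h2; move: (size _) => s; lia.
  rewrite -lead_coefE => /eqP; rewrite lead_coef_eq0 -size_poly_eq0 => /eqP h3.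
  by move: h2; rewrite h3.
by case: leqP; rewrite ?mulr1 ?mulr0.
Qed.

Lemma feq_even e : ~~ odd n -> (e <= n)%N ->
  q%:R * (cumsum n.-1 * cumsum e) = (q ^ e)%:R * cumsum (n - e).
Proof.
move=> on en; have q10 : (q%:R - 1 : int) != 0 by have := card_ge5 q4; rewrite -/q; lia.
have E : q%:R * (gauss (@zero_ind F) * \sum_(y | (size (rep y) <= e)%N) qchar y) =
   (q ^ e)%:R * ((q%:R - 1) * \sum_(y | (size (rep y) <= n - e)%N) qchar y).
  rewrite (sum_le_size (fun y => qchar y)) // mulr_sumr.
  rewrite (eq_bigr (fun c : {ffun 'I_e -> F} => \sum_y qchar y * zero_ind (top_coef (ev (pol_of c) * y)))); last first.
    by move=> c _; rewrite gaussM mulrC.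
  rewrite exchange_big mulr_sumr.
  (* Of the q^e polynomials of degree below e, those annihilating y number q^(e-1) off the
     orthogonal complement and q^e on it. After multiplication by q the common part q^e is removed
     by [sum_qchar]. *)
  transitivity (\sum_y ((q ^ e)%:R * qchar y +
     (q ^ e)%:R * ((q%:R - 1) * (if (size (rep y) <= n - e)%N then qchar y else 0)))); last first.
    by rewrite big_split /= -!mulr_sumr (sum_qchar oddK) mulr0 add0r -big_mkcond.
  apply: eq_bigr => y _; rewrite -mulr_sumr.
  case: (boolP (size (rep y) <= n - e)%N) => sy.
    rewrite (eq_bigr (fun=> 1)) => [|c _].
      by rewrite sumr_const card_ffun card_ord -/q; ring.
    by rewrite top_coef_pol_of big1 ?/zero_ind ?eqxx // => i _; rewrite top_coef_orth0 ?mulr0.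
  have [sy'|[i vi]] := top_coef_orth y en; first by rewrite sy' in sy.
  under eq_bigr do rewrite top_coef_pol_of -[X in zero_ind X]add0r.
  have := sum_equidistributed 0 (v := fun i => top_coef (ev 'X^i * y)) (@zero_ind F) vi.
  rewrite -/q mulrCA => ->.
  rewrite (bigD1 0) //= /zero_ind eqxx big1 ?addr0 => [|t /negbTE ->] //=.
  by ring.
move: E; rewrite gauss_zero_ind // !sum_le_qchar ?leq_subr // => E.
apply: (mulfI q10); apply: (mulfI q10).
by transitivity (q%:R * ((q%:R - 1) * cumsum n.-1 * ((q%:R - 1) * cumsum e))); [ring | rewrite E; ring].
Qed.

Lemma cumsum_n : ~~ odd n -> cumsum n = 0.
Proof.
move=> en; have q10 : (q%:R - 1 : int) != 0 by have := card_ge5 q4; rewrite -/q; lia.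
apply: (mulfI q10); rewrite mulr0 -sum_le_qchar // -[RHS](sum_qchar oddK).
by apply: eq_bigl => y; rewrite size_rep.
Qed.

(** Taking e = n - 1 in [feq_even] gives q B^2 = q^(2g+1) for B = [cumsum n.-1], and the positive
    Gauss sum selects B = q^g. *)
Lemma cumsum_even g e : n = (2 * g + 2)%N -> 0 < gauss (@zero_ind F) -> (e <= 2 * g)%N ->
  (q ^ g)%:R * cumsum e.+1 = (q ^ e)%:R * cumsum (2 * g - e).+1.
Proof.
move=> nE G0 eg; have on : ~~ odd n by rewrite nE; lia.
have q0 := q_neq0.
have n1E : n.-1 = (2 * g).+1 by rewrite nE; lia.
have B0 : 0 < cumsum n.-1.
  move: G0; rewrite gauss_zero_ind // pmulr_rgt0 //.
  by have := card_ge5 q4; rewrite -/q; lia.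
have B1 : cumsum 1 = 1 by rewrite /cumsum big_ord1 monsum0.
have BE : cumsum n.-1 = (q ^ g)%:R.
  have := feq_even on (leq_pred n); rewrite -expr2.
  have -> : (n - n.-1 = 1)%N by lia.
  rewrite B1 mulr1 n1E expnS natrM => /(mulfI q0).
  rewrite -n1E mulnC expnM natrX => /eqP; rewrite eqrXn2 ?ler0n ?(ltW B0) //.
  by move=> /eqP.
have en : (e.+1 <= n)%N by lia.
have := feq_even on en; rewrite BE expnS natrM -mulrA => /(mulfI q0) ->.
by congr (_ * cumsum _); lia.
Qed.

End ResidueSums.

Lemma deriv_root (R : comNzRingType) (a : R) (p : {poly R}) :
  (('X - a%:P) * p)^`().[a] = p.[a].
Proof. by rewrite derivM derivXsubC mul1r !hornerE subrr mul0r addr0. Qed.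

(** * The sign of the functional equation in even degree *)

Section RootNumber.
Variables (F : finFieldType) (P : {poly F}) (n : nat) (K : finFieldType).
Variable ev : {rmorphism {poly F} -> K}.
Let q := #|F|.
Hypotheses (q4 : (q %% 4 = 1)%N) (n0 : (0 < n)%N).
Hypotheses (Pm : P \is monic) (Pi : irreducible_poly P) (sP : size P = n.+1).
Hypothesis ev0 : forall f, (ev f == 0) = (P %| f).
Hypothesis cK : #|K| = (q ^ n)%N.
Hypothesis ev_surj : forall y, exists2 f : {poly F}, (size f < size P)%N & ev f = y.

Let q_gt0 : (0 < q)%N. Proof. by have := card_ge5 q4; rewrite -/q; lia. Qed.

Lemma expD_card_res (y z : K) j : (y + z) ^+ (q ^ j) = y ^+ (q ^ j) + z ^+ (q ^ j).
Proof.
have [f _ <-] := ev_surj y; have [f' _ <-] := ev_surj z.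
by rewrite -rmorphD -!rmorphXn exprD_card rmorphD.
Qed.

Lemma expN_card_res (y : K) j : (- y) ^+ (q ^ j) = - y ^+ (q ^ j).
Proof.
by apply: (addrI (y ^+ (q ^ j))); rewrite -expD_card_res !subrr expr0n expn_eq0 gtn_eqF.
Qed.

Lemma exp_card_n (y : K) : y ^+ (q ^ n) = y.
Proof. by rewrite -cK expf_card. Qed.

Let em : {rmorphism F -> K} := (ev \o polyC)%FUN.
Let x := ev 'X.
Let xj j := x ^+ (q ^ j).

Lemma map_horner_conj (f : {poly F}) j : (map_poly em f).[xj j] = ev f ^+ (q ^ j).
Proof.
rewrite -rmorphXn expr_card_comp /xj /x -rmorphXn /comp_poly -horner_map -map_poly_comp.
by [].
Qed.

Lemma conj_inj i j : (i < j)%N -> (j < n)%N -> xj i != xj j.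
Proof.
move=> ij jn; apply/negP => /eqP E.
have E2 : xj (j - i) = x.
  apply/eqP; rewrite -subr_eq0.
  have : (xj (j - i) - x) ^+ (q ^ i) = 0.
    rewrite expD_card_res expN_card_res -/(xj i) E /xj -exprM -expnD subnK ?subrr //.
    exact: ltnW.
  by move/eqP; rewrite expf_eq0 => /andP[].
have : P %| 'X^(q ^ (j - i)) - 'X.
  by rewrite -ev0 rmorphB rmorphXn -/x -/(xj _) E2 subrr.
move/(irreducible_dvd_degree Pm Pi sP)/dvdn_leq; lia.
Qed.

Let conjs := [seq xj j | j <- index_iota 0 n].

Lemma uniq_conjs : uniq conjs.
Proof.
rewrite map_inj_in_uniq ?iota_uniq // => i j; rewrite !mem_index_iota /= => hi hj E.
apply/eqP/negPn/negP; rewrite neq_ltn => /orP[h|h].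
  by have := conj_inj h hj; rewrite E eqxx.
by have := conj_inj h hi; rewrite E eqxx.
Qed.

Lemma map_prod_conj : map_poly em P = \prod_(0 <= j < n) ('X - (xj j)%:P).
Proof.
rewrite (@all_roots_prod_XsubC _ (map_poly em P) conjs).
- by rewrite lead_coef_map (monicP Pm) rmorph1 scale1r big_map.
- by rewrite size_map_poly sP size_map size_iota subn0.
- apply/allP => y /mapP[j _ ->]; rewrite rootE map_horner_conj.
  by rewrite (eqP (_ : ev P == 0)) ?ev0 ?dvdpp // expr0n expn_eq0 gtn_eqF.
- by rewrite uniq_rootsE uniq_conjs.
Qed.

Let D := ev P^`().

Lemma D_prod : D = \prod_(1 <= j < n) (x - xj j).
Proof.
have -> : D = (map_poly em P^`()).[xj 0] by rewrite map_horner_conj expr1.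
rewrite -deriv_map map_prod_conj big_ltn // deriv_root /xj expn0 expr1 horner_prod.
by apply: eq_bigr => j _; rewrite !hornerE.
Qed.

Lemma D_conj (j : 'I_n) : D ^+ (q ^ j) = (\prod_(i < n | i != j) ('X - (xj i)%:P)).[xj j].
Proof.
by rewrite -map_horner_conj -deriv_map map_prod_conj big_mkord (bigD1 j) //= deriv_root.
Qed.

Lemma D_neq0 : D != 0.
Proof.
rewrite D_prod prodf_seq_neq0; apply/allP => j; rewrite mem_index_iota => /andP[j0 jn].
by apply/implyP => _; rewrite subr_eq0; have := conj_inj j0 jn; rewrite {1}/xj expn0 expr1.
Qed.

Let lam := top_coef n ev_surj.

(* Lagrange interpolation at the conjugates of [x] identifies the leading
   coefficient functional with the trace of [y / P'(x)] (Euler's formula). *)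
Lemma lam_trace y : em (lam y) = \sum_(j < n) (y / D) ^+ (q ^ j).
Proof.
set f := rep ev_surj y; have ef : ev f = y by exact: ev_rep.
pose R (j : 'I_n) := \prod_(i < n | i != j) ('X - (xj i)%:P).
pose L := \sum_(j < n) ((y / D) ^+ (q ^ j)) *: R j.
have Rm j : R j \is monic by apply: monic_prod => i _; exact: monicXsubC.
have sR j : size (R j) = n.
  rewrite /R size_prod_monic => [|i _]; last exact: monicXsubC.
  rewrite (eq_bigr (fun=> 1%N)) => [|i _]; last by rewrite size_XsubC.
  by rewrite sum1_card cardC1 card_ord prednK.
have sL : (size L <= n)%N.
  apply: (leq_trans (size_sum _ _ _)); apply/bigmax_leqP => j _.
  by rewrite (leq_trans (size_scale_leq _ _)) ?sR.
have E : map_poly em f = L.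
  apply/eqP; rewrite -subr_eq0; apply/eqP; apply: (@roots_geq_poly_eq0 _ _ conjs).
  - apply/allP => z /mapP[j]; rewrite mem_index_iota /= => jn ->.
    rewrite rootE hornerD hornerN map_horner_conj ef horner_sum.
    rewrite (bigD1 (Ordinal jn)) //= big1 ?addr0 => [|i ij].
      by rewrite hornerZ -(D_conj (Ordinal jn)) /= -exprMn divfK ?D_neq0 // subrr.
    by rewrite hornerZ /R (bigD1 (Ordinal jn)) 1?eq_sym //= hornerM hornerXsubC subrr mul0r mulr0.
  - exact: uniq_conjs.
  - rewrite size_map size_iota subn0 (leq_trans (size_polyD _ _)) // geq_max size_polyN sL.
    by rewrite size_map_poly (size_rep sP).
rewrite /lam /top_coef -/f -coef_map /= E coef_sum; apply: eq_bigr => j _.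
by rewrite coefZ; have /monicP := Rm j; rewrite lead_coefE sR => ->; rewrite mulr1.
Qed.

Variable h : nat.
Hypothesis nE : n = (2 * h)%N.
Let r := (q ^ h)%N.

Let oK : odd #|K|. Proof. by rewrite cK oddX (card_odd q4) orbT. Qed.
Let h0 : (0 < h)%N. Proof. by move: n0; rewrite nE; case: h. Qed.
Let r4 : exists v, r = (4 * v).+1.
Proof.
have : (r %% 4 = 1)%N by rewrite /r -modnXm q4 exp1n.
by exists (r %/ 4)%N; rewrite {1}(divn_eq r 4); lia.
Qed.
Let cKr : ((#|K|.-1)./2 = (r.-1) * (r.+1)./2)%N.
Proof.
have -> : #|K| = (r * r)%N by rewrite cK nE -expnD addnn mul2n.
have [v ->] := r4; have -> : ((4 * v).+1.+1)./2 = (2 * v).+1 by lia.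
rewrite (_ : ((4 * v).+1 * (4 * v).+1).-1 = ((4 * v) * (2 * v).+1).*2)%N ?doubleK //.
by nia.
Qed.
Let r_gt0 : (0 < r)%N. Proof. by have [v ->] := r4. Qed.

(** Elements of the subfield of r elements are squares in [K], since r - 1 divides (r^2 - 1)/2. *)
Lemma qchar_fix (t : K) : t != 0 -> t ^+ r = t -> qchar t = 1.
Proof.
move=> t0 tr; apply: (qchar_eq oK); first by right; left.
have t1 : t ^+ r.-1 = 1 by apply: (mulfI t0); rewrite -exprS prednK // mulr1.
by rewrite cKr exprM t1 expr1n.
Qed.

(** Here z^(r-1) = -1, and the cofactor (r + 1)/2 is odd because r = 1 mod 4. *)
Lemma qchar_anti (z : K) : z != 0 -> z ^+ r = - z -> qchar z = -1.
Proof.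
move=> z0 zr; apply: (qchar_eq oK); first by right; right.
have z1 : z ^+ r.-1 = -1 by apply: (mulfI z0); rewrite -exprS prednK // mulrN1.
have [v rE] := r4; rewrite cKr exprM z1 -signr_odd rE.
have -> : odd ((4 * v).+1.+1)./2 by lia.
by rewrite expr1 mulrNz.
Qed.

Lemma qchar_neg1 : qchar (-1 : K) = 1.
Proof.
apply: qchar_fix; first by rewrite oppr_eq0 oner_eq0.
by rewrite expN_card_res expr1n.
Qed.

Let w j := x - xj j.

Let xjn : xj n = x. Proof. exact: exp_card_n. Qed.

Lemma w_neq0 j : (0 < j)%N -> (j < n)%N -> w j != 0.
Proof.
by move=> j0 jn; rewrite /w subr_eq0; have := conj_inj j0 jn; rewrite {1}/xj expn0 expr1.
Qed.

Lemma w_anti : w h ^+ r = - w h.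
Proof.
rewrite /w expD_card_res expN_card_res -/(xj h) /xj -exprM -expnD addnn -mul2n -nE.
by rewrite -/(xj n) xjn opprB.
Qed.

Lemma qchar_w j : (j <= n)%N -> qchar (w (n - j)) = qchar (w j).
Proof.
move=> jn; have -> : w (n - j) = -1 * (w j) ^+ (q ^ (n - j)).
  rewrite /w expD_card_res expN_card_res.
  have -> : xj j ^+ (q ^ (n - j)) = x by rewrite /xj -exprM -expnD subnKC // exp_card_n.
  by rewrite mulN1r opprB.
rewrite (qcharM oK) qchar_neg1 mul1r (qchar_expo oK).
have oq : odd (q ^ (n - j)) by rewrite oddX (card_odd q4) orbT.
have [->|w0] := eqVneq (w j) 0; first by rewrite qchar0 expr0n expn_eq0 gtn_eqF.
by case: (qchar_cases w0) => ->; rewrite ?expr1n // -signr_odd oq.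
Qed.

(** In the product of the x - x^(q^j), the factors j and n - j have equal characters and cancel. The
    middle factor j = h is anti-invariant and contributes -1. *)
Lemma qchar_D : qchar D = -1.
Proof.
have -> : qchar D = \prod_(1 <= j < n) qchar (w j).
  by rewrite D_prod (big_morph _ (qcharM oK) (qchar1 oK)).
rewrite (big_cat_nat _ (n := h)) //=; last by lia.
rewrite [X in _ * X]big_ltn; last by lia.
have -> : \prod_(h.+1 <= j < n) qchar (w j) = \prod_(1 <= j < h) qchar (w j).
  rewrite -[h.+1]add1n (big_addn 1 n h) /=.
  have -> : (n - h = h)%N by lia.
  rewrite big_nat_rev /=; apply: eq_big_nat => j /andP[j1 jh].
  rewrite -[in RHS]qchar_w; last by lia.
  by congr (qchar (w _)); lia.
rewrite (qchar_anti _ w_anti); last by apply: w_neq0; lia.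
rewrite mulN1r mulrN; congr (- _).
rewrite -expr2 -prodrXl big_nat big1 // => j /andP[j1 jh].
by rewrite expr2; apply: qchar_sqr; apply: w_neq0; lia.
Qed.

(** [T] is the multiplicative group of the subfield of q^h elements, and on this subfield [tr] is
    the trace to [F]. *)
Let T := [set t : K | (t != 0) && (t ^+ r == t)].
Let tr (c : K) := \sum_(j < h) c ^+ (q ^ j).

Lemma lam_tr (t y : K) : t ^+ r = t -> em (lam (t * y)) = tr (t * (y / D + (y / D) ^+ r)).
Proof.
move=> tr_t; rewrite lam_trace.
have -> : \sum_(j < n) (t * y / D) ^+ (q ^ j) = \sum_(j < h + h) (t * y / D) ^+ (q ^ j).
  by rewrite nE mul2n addnn.
rewrite big_split_ord /= -big_split /=; apply: eq_bigr => j _.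
rewrite expnD exprM -/r -expD_card_res -!mulrA mulrDr; congr ((_ + _) ^+ _).
by rewrite exprMn tr_t.
Qed.

Let trace_zero (c : K) : int := (tr c == 0)%:R.
Let N0 : int := \sum_(t in T) trace_zero t.

Lemma tr_mul (c : K) : c != 0 -> c ^+ r = c -> \sum_(t in T) trace_zero (t * c) = N0.
Proof.
move=> c0 cr; rewrite /N0 [RHS](reindex_inj (mulIf c0)); apply: eq_bigl => t.
rewrite !inE mulf_eq0 (negbTE c0) orbF exprMn cr.
by rewrite (inj_eq (mulIf c0)).
Qed.

Lemma lam_surj : exists y, lam y != 0.
Proof.
exists (ev 'X^(n.-1)); rewrite /lam /top_coef (rep_ev sP ev0) ?size_polyXn ?prednK //.
by rewrite coefXn eqxx oner_neq0.
Qed.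

(** The trace from the subfield is not identically zero, since the coefficient functional factors
    through it and is nonzero. *)
Lemma card_T_gt : N0 < #|T|%:R.
Proof.
have [y ly] := lam_surj.
pose t := y / D + (y / D) ^+ r.
have l1 : em (lam y) = tr t by rewrite -[y]mul1r lam_tr ?expr1n // mul1r.
have trt : tr t != 0 by rewrite -l1 fmorph_eq0.
have tT : t \in T.
  rewrite inE; apply/andP; split.
    apply: contraNneq trt => ->; rewrite /tr big1 // => j _.
    by rewrite expr0n expn_eq0 gtn_eqF.
  apply/eqP; rewrite /t expD_card_res -exprM -expnD addnn -mul2n -nE exp_card_n.
  by rewrite addrC.
rewrite /N0 (bigD1 t) //= /trace_zero (negbTE trt) add0r (cardD1 t) tT natrD.
rewrite ltr_pwDl //.
have -> : #|[predD1 T & t]|%:R = \sum_(i in T | i != t) (1 : int).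
  rewrite -sumr_const; apply: eq_bigl => i; rewrite inE /= andbC.
  by congr (_ && _).
by apply: ler_sum => i _; case: (_ == _).
Qed.

(* The sum is unchanged when [y] is multiplied by a [t] of the subfield of [q^h]
   elements, as [t] is a square; averaging over [t] isolates the [y] for which
   [y / D] is anti-invariant under the [q^h]-Frobenius, and these are squares. *)
Lemma gauss_zero_ind_gt0 : 0 < gauss n ev_surj (@zero_ind F).
Proof.
set G := gauss _ _ _.
pose c y := y / D + (y / D) ^+ r.
have cr y : c y ^+ r = c y.
  by rewrite /c expD_card_res -exprM -expnD addnn -mul2n -nE exp_card_n addrC.
have E : #|T|%:R * G = \sum_y qchar y * \sum_(t in T) zero_ind (lam (t * y)).
  transitivity (\sum_(t in T) \sum_y qchar y * zero_ind (lam (t * y))).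
    rewrite mulr_natl -sumr_const; apply: eq_bigr => t; rewrite inE => /andP[t0 /eqP tr_t].
    rewrite (gaussM q4 cK ev_surj (@zero_ind F) t).
    by rewrite qchar_fix // mul1r.
  by rewrite exchange_big; apply: eq_bigr => y _; rewrite mulr_sumr.
have NE y : \sum_(t in T) zero_ind (lam (t * y)) =
    N0 + (if c y == 0 then #|T|%:R - N0 else 0).
  transitivity (\sum_(t in T) trace_zero (t * c y)).
    apply: eq_bigr => t; rewrite inE => /andP[_ /eqP tr_t].
    by rewrite /zero_ind /trace_zero -lam_tr // fmorph_eq0.
  case: eqP => [->|/eqP c0]; last by rewrite addr0 tr_mul.
  rewrite addrC subrK -sumr_const; apply: eq_bigr => t _; rewrite mulr0 /trace_zero /tr.
  by rewrite big1 ?eqxx // => j _; rewrite expr0n expn_eq0 gtn_eqF.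
have E2 : #|T|%:R * G = (#|T|%:R - N0) * \sum_(y | c y == 0) qchar y.
  rewrite E (eq_bigr (fun y => qchar y * N0 + (if c y == 0 then (#|T|%:R - N0) * qchar y else 0))).
    by rewrite big_split /= -mulr_suml (sum_qchar oK) mul0r add0r -big_mkcond mulr_sumr.
  by move=> y _; rewrite NE mulrDr; case: eqP => _; rewrite ?mulr0 // [X in _ = _ + X]mulrC.
(* The signs -1 of [D] and of the anti-invariant y / D cancel. *)
have q1 y : y != 0 -> c y == 0 -> qchar y = 1.
  move=> y0; rewrite /c addrC addr_eq0 => /eqP cy.
  have z0 : y / D != 0 by rewrite mulf_neq0 // invr_eq0 D_neq0.
  rewrite -(divfK D_neq0 y) (qcharM oK) qchar_D (qchar_anti z0 cy).
  by [].
have T0 : (0 : int) < #|T|%:R.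
  have N00 : 0 <= N0 by apply: sumr_ge0 => t _; rewrite /trace_zero; case: (_ == _).
  exact: le_lt_trans N00 card_T_gt.
rewrite -(pmulr_rgt0 _ T0) E2 pmulr_rgt0 ?subr_gt0 ?card_T_gt //.
(* The sum has a positive term, at y = (x - x^(q^h)) D. *)
have wh0 : w h != 0 by apply: w_neq0; lia.
have cw : c (w h * D) == 0 by rewrite /c mulfK ?D_neq0 // w_anti subrr.
have wD0 : w h * D != 0 by rewrite mulf_neq0 // D_neq0.
rewrite (bigD1 (w h * D)) //= (q1 _ wD0 cw) ltr_pwDl // sumr_ge0 // => y /andP[cy _].
by have [->|y0] := eqVneq y 0; rewrite ?qchar0 // q1.
Qed.

End RootNumber.

(** * From the functional equation to a sum over degrees at most g *)

Section Symmetric.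
Variables (R : realFieldType) (u v : R).
Hypothesis uv : u * v = 1.

Lemma sum_symmetric (b : nat -> R) g :
  (forall e, (e <= 2 * g)%N -> v ^+ (2 * g) * b e = v ^+ (2 * e) * b (2 * g - e)%N) ->
  \sum_(d < (2 * g).+1) b d * u ^+ d = 2%:R * (\sum_(d < g) b d * u ^+ d) + b g * u ^+ g.
Proof.
move=> sym.
have refl d : (d <= 2 * g)%N -> b (2 * g - d)%N * u ^+ (2 * g - d) = b d * u ^+ d.
  move=> dg; have -> : b (2 * g - d)%N = u ^+ (2 * d) * (v ^+ (2 * g) * b d).
    by rewrite sym // mulrA -exprMn uv expr1n mul1r.
  transitivity (b d * (v ^+ (2 * g) * (u ^+ (2 * d) * u ^+ (2 * g - d)))); first by ring.
  rewrite -exprD (_ : (2 * d + (2 * g - d) = 2 * g + d)%N); last by lia.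
  by rewrite exprD [v ^+ _ * _]mulrA -exprMn [v * u]mulrC uv expr1n mul1r.
have -> : \sum_(d < (2 * g).+1) b d * u ^+ d = \sum_(d < g.+1 + g) b d * u ^+ d.
  by rewrite (_ : (2 * g).+1 = g.+1 + g)%N //; lia.
rewrite big_split_ord /= big_ord_recr /=.
have -> : \sum_(i < g) b (g.+1 + i)%N * u ^+ (g.+1 + i) = \sum_(i < g) b i * u ^+ i.
  rewrite (reindex_inj rev_ord_inj) /=; apply: eq_bigr => i _.
  have ig := ltn_ord i; rewrite -[RHS]refl; last by lia.
  by rewrite (_ : (g.+1 + (g - i.+1) = 2 * g - i)%N) //; lia.
ring.
Qed.

Lemma sum_by_parts (a B : nat -> R) m : B 0%N = 0 -> (forall d, B d.+1 = B d + a d) ->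
  \sum_(d < m.+1) a d * u ^+ d = (1 - u) * (\sum_(d < m) B d.+1 * u ^+ d) + B m.+1 * u ^+ m.
Proof.
move=> B0 BS; elim: m => [|m IH].
  by rewrite big_ord1 big_ord0 expr0 BS B0; ring.
by rewrite big_ord_recr /= IH big_ord_recr /= [B m.+2]BS exprS; ring.
Qed.

(** Abel summation undoes the division of L by 1 - u. The boundary term at g produces the
    corrections -u^g - u^(g+1). *)
Lemma sum_even_weights (a B : nat -> R) g : B 0%N = 0 -> (forall d, B d.+1 = B d + a d) ->
  (1 - u) * (2%:R * (\sum_(d < g) B d.+1 * u ^+ d) + B g.+1 * u ^+ g) =
  \sum_(e < g.+1) (2%:R * u ^+ e - u ^+ g - u ^+ g.+1) * a e.
Proof.
move=> B0 BS; have E := sum_by_parts g B0 BS.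
have BE m : B m = \sum_(e < m) a e.
  by elim: m => [|m IH]; rewrite ?big_ord0 // big_ord_recr /= BS IH.
rewrite (eq_bigr (fun e : 'I_g.+1 => 2%:R * (a e * u ^+ e) - (u ^+ g + u ^+ g.+1) * a e)).
  by rewrite sumrB -!mulr_sumr E -BE exprS; ring.
by move=> e _; ring.
Qed.

End Symmetric.

Section Lhalf.
Variables (F : finFieldType) (R : realType).
Let q := #|F|.
Hypothesis q4 : (q %% 4 = 1)%N.

Definition sqrtq : R := Num.sqrt (q%:R).
Definition invsq : R := sqrtq^-1.

Lemma sqrtq_sqr : sqrtq ^+ 2 = q%:R.
Proof. by rewrite sqr_sqrtr ?ler0n. Qed.

Lemma sqrtq_ge2 : 2%:R <= sqrtq.
Proof.
rewrite -(@ler_pXn2r _ 2) ?nnegrE ?sqrtr_ge0 ?ler0n // sqrtq_sqr -natrX ler_nat.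
by have := card_ge5 q4; rewrite -/q; lia.
Qed.

Lemma sqrtq_gt0 : 0 < sqrtq.
Proof. by apply: lt_le_trans sqrtq_ge2; rewrite ltr0n. Qed.

Lemma invsq_gt0 : 0 < invsq.
Proof. by rewrite invr_gt0 sqrtq_gt0. Qed.

Lemma invsq_sqrtq : invsq * sqrtq = 1.
Proof. by rewrite mulVf // gt_eqF // sqrtq_gt0. Qed.

Lemma invsq_le : 2%:R * invsq <= 1.
Proof. by rewrite -[leRHS]invsq_sqrtq [leRHS]mulrC ler_pM2r ?invsq_gt0 // sqrtq_ge2. Qed.

Lemma LhalfE (P : {poly F}) n : size P = n.+1 ->
  Lhalf R P = \sum_(d < n) (monsum P d)%:~R * invsq ^+ d.
Proof.
move=> sP; rewrite /Lhalf sP; apply: eq_bigr => d _.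
rewrite /monsum rmorph_sum mulr_suml; apply: eq_bigr => c _.
by rewrite /invsq exprVn.
Qed.

Lemma Lhalf_odd (P : {poly F}) n g : P \is monic -> irreducible_poly P -> size P = n.+1 ->
  n = (2 * g + 1)%N -> Lhalf R P =
  \sum_(e < g.+1) (if (e < g)%N then 2%:R * invsq ^+ e else invsq ^+ e) * (monsum P e)%:~R.
Proof.
move=> Pm Pi sP nE; have [K [ev [ev0 cK sj]]] := residue_field Pm Pi.
rewrite sP /= in cK; have n0 : (0 < n)%N by lia.
rewrite (LhalfE sP) nE addn1 (sum_symmetric invsq_sqrtq (b := fun e => (monsum P e)%:~R)).
  rewrite big_ord_recr /= ltnn mulrC [_ * invsq ^+ g]mulrC; congr (_ + _).
  rewrite mulr_suml; apply: eq_bigr => e _; rewrite ltn_ord; ring.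
move=> e eg; rewrite !exprM sqrtq_sqr -!natrX.
have := congr1 (fun t : int => t%:~R : R) (monsum_odd q4 n0 Pm sP ev0 cK sj nE eg).
by rewrite /= !rmorphM /= !rmorph_nat.
Qed.

Lemma Lhalf_even (P : {poly F}) n g : P \is monic -> irreducible_poly P -> size P = n.+1 ->
  n = (2 * g + 2)%N -> Lhalf R P =
  \sum_(e < g.+1) (2%:R * invsq ^+ e - invsq ^+ g - invsq ^+ g.+1) * (monsum P e)%:~R.
Proof.
move=> Pm Pi sP nE; have [K [ev [ev0 cK sj]]] := residue_field Pm Pi.
rewrite sP /= in cK; have n0 : (0 < n)%N by lia.
pose B e : R := (cumsum P e)%:~R; pose a e : R := (monsum P e)%:~R.
have B0 : B 0%N = 0 by rewrite /B /cumsum big_ord0.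
have BS d : B d.+1 = B d + a d by rewrite /B /a /cumsum big_ord_recr /= rmorphD.
rewrite (LhalfE sP) -(sum_even_weights _ _ B0 BS).
have nE' : n = (2 * g).+2 by rewrite nE; lia.
rewrite nE' (sum_by_parts _ _ B0 BS) -nE'.
have -> : B n = 0 by rewrite /B (cumsum_n q4 n0 Pm sP ev0 cK sj) //; lia.
rewrite mul0r addr0; congr (_ * _).
apply: (sum_symmetric invsq_sqrtq (b := fun e => B e.+1)) => e eg.
rewrite !exprM sqrtq_sqr -!natrX.
have nE2 : n = (2 * g.+1)%N by lia.
have := gauss_zero_ind_gt0 q4 n0 Pm Pi sP ev0 cK sj nE2.
move/(cumsum_even q4 n0 Pm sP ev0 cK nE) => /(_ e eg)/(congr1 (fun t : int => t%:~R : R)).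
by rewrite /= !rmorphM /= !rmorph_nat.
Qed.

(** The two parities share only these bounds on the weights. The lower bound excludes e = g, where
    the even weight is u^g - u^(g+1); for e < g it follows from u <= 1/2. *)
Lemma Lhalf_weights n g : (n = 2 * g + 1 \/ n = 2 * g + 2)%N ->
  exists w : nat -> R,
  [/\ forall e, (e < g)%N -> invsq ^+ e <= w e,
      forall e, (e <= g)%N -> 0 <= w e <= 2%:R * invsq ^+ e
    & forall c, c \in Pset F n ->
        Lhalf R (monic_of c) = \sum_(e < g.+1) w e * (monsum (monic_of c) e)%:~R].
Proof.
have u0 := invsq_gt0; have u2 := invsq_le; have u1 : invsq <= 1 by lra.
have ue e : 0 < invsq ^+ e by rewrite exprn_gt0.
case=> nE.
  exists (fun e => if (e < g)%N then 2%:R * invsq ^+ e else invsq ^+ e); split.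
  - by move=> e ->; have := ue e; lra.
  - by move=> e _; have := ue e; case: ifP => _ h; apply/andP; split; lra.
  - move=> c /PsetP ci; apply: Lhalf_odd nE => //; first exact: monic_of_monic.
    exact: size_monic_of.
have dec e e' : (e <= e')%N -> invsq ^+ e' <= invsq ^+ e.
  by move=> h; apply: ler_wiXn2l => //; exact: ltW.
exists (fun e => 2%:R * invsq ^+ e - invsq ^+ g - invsq ^+ g.+1); split.
- move=> e eg; have := ue e; have := dec _ _ eg; rewrite [invsq ^+ e.+1]exprS.
  have := dec _ _ (leqW eg); rewrite ![invsq ^+ e.+1]exprS.
  have h : 2%:R * (invsq * invsq ^+ e) <= invsq ^+ e.
    by rewrite mulrA ler_piMl // ltW.
  lra.
- move=> e eg; apply/andP; split.
    by have := dec _ _ eg; have := dec _ _ (leqW eg); lra.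
  by have := ue g; have := ue g.+1; lra.
- move=> c /PsetP ci; apply: Lhalf_even nE => //; first exact: monic_of_monic.
  exact: size_monic_of.
Qed.

End Lhalf.

(** * Tuples of monic polynomials with square product *)

Lemma sum_inj_le (R : numDomainType) (I J : finType) (phi : I -> J) (A : pred I) (B : pred J)
    (f : I -> R) (g : J -> R) :
  {in A &, injective phi} -> (forall i, A i -> B (phi i)) ->
  (forall i, A i -> f i <= g (phi i)) -> (forall j, B j -> 0 <= g j) ->
  \sum_(i | A i) f i <= \sum_(j | B j) g j.
Proof.
move=> inj AB fg g0; apply: (@le_trans _ _ (\sum_(i | A i) g (phi i))); first exact: ler_sum.
have -> : \sum_(i | A i) g (phi i) = \sum_(j in phi @: [set i | A i]) g j.
  rewrite big_imset /=; last by move=> i j; rewrite !inE; exact: inj.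
  by apply: eq_bigl => i; rewrite inE.
rewrite [leRHS](bigID (mem (phi @: [set i | A i]))) /=.
rewrite (eq_bigl (fun j => B j && (j \in phi @: [set i | A i]))).
  by rewrite lerDl sumr_ge0 // => j /andP[/g0].
move=> j; case: imsetP => [[i]|]; rewrite ?andbF //.
by rewrite inE => /AB Bi ->; rewrite Bi.
Qed.

Section Monics.
Variable F : finFieldType.

(* Monic polynomials of degree at most [y], with the degree as the tag. *)
Definition mon (y : nat) : finType := {d : 'I_y.+1 & {ffun 'I_d -> F}}.

Definition mon_poly y (i : mon y) : {poly F} := monic_of (tagged i).

Lemma mp_monic y (i : mon y) : mon_poly i \is monic. Proof. exact: monic_of_monic. Qed.

Lemma size_mp y (i : mon y) : size (mon_poly i) = (tag i).+1.
Proof. exact: size_monic_of. Qed.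

Lemma size_mp_le y (i : mon y) : (size (mon_poly i) <= y.+1)%N.
Proof. by rewrite size_mp ltn_ord. Qed.

Lemma mp_neq0 y (i : mon y) : mon_poly i != 0. Proof. exact: monic_neq0 (mp_monic i). Qed.

Lemma mp_inj y : injective (@mon_poly y).
Proof.
move=> [d c] [d' c'] E; have sE : d = d'.
  by have := congr1 (fun p : {poly F} => size p) E; rewrite !size_mp => -[/val_inj].
by subst d'; congr existT; exact: monic_of_inj E.
Qed.

Definition mon_of y (p : {poly F}) : mon y :=
  Tagged (fun d : 'I_y.+1 => {ffun 'I_d -> F})
    [ffun i : 'I_(@inord y (size p).-1) => p`_i].

Lemma mon_ofK y (p : {poly F}) : p \is monic -> (size p <= y.+1)%N -> mon_poly (mon_of y p) = p.
Proof.
move=> pm sp; rewrite /mon_poly /mon_of /=; apply: monic_of_coef => //.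
have s0 : (0 < size p)%N by rewrite size_poly_gt0 monic_neq0.
by rewrite inordK prednK.
Qed.

Lemma sum_mon (R : zmodType) y (G : {poly F} -> R) :
  \sum_(i : mon y) G (mon_poly i) = \sum_(d < y.+1) \sum_(c : {ffun 'I_d -> F}) G (monic_of c).
Proof. by rewrite sig_big_dep. Qed.

End Monics.

(** * Weighted sums over monic polynomials, and those without small divisors *)

Section Weights.
Variables (F : finFieldType) (R : realFieldType) (u : R).
Let q := #|F|.
Hypotheses (u0 : 0 < u) (uq : u ^+ 2 * q%:R = 1) (q2 : (2 <= q)%N).

(* [uw] and [nw] are [|p|^(-1/2)] and [|p|^(-1)]; here [u = q^(-1/2)]. *)
Definition uw (p : {poly F}) : R := u ^+ (size p).-1.

Lemma uwM (p r : {poly F}) : p \is monic -> r \is monic -> uw (p * r) = uw p * uw r.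
Proof.
move=> pm rm; rewrite /uw -exprD size_monicM ?monic_neq0 //; congr (_ ^+ _).
have : (0 < size p)%N by rewrite size_poly_gt0 monic_neq0.
have : (0 < size r)%N by rewrite size_poly_gt0 monic_neq0.
by move: (size p) (size r) => a b; lia.
Qed.

Lemma uw1 : uw 1 = 1. Proof. by rewrite /uw size_poly1 expr0. Qed.

Lemma uw_gt0 p : 0 < uw p. Proof. by rewrite exprn_gt0. Qed.

Lemma uw_prod (I : finType) (A : pred I) (f : I -> {poly F}) :
  (forall i, A i -> f i \is monic) -> uw (\prod_(i | A i) f i) = \prod_(i | A i) uw (f i).
Proof.
move=> fm; have : uw (\prod_(i | A i) f i) = \prod_(i | A i) uw (f i) /\
  \prod_(i | A i) f i \is monic; last by case.
pose K p r := uw p = r /\ p \is monic; rewrite -/(K _ _).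
elim/big_rec2: _ => [|i r p Ai [<- pm]]; rewrite /K; first by rewrite uw1 monic1.
by rewrite uwM ?fm // monicMr ?fm.
Qed.

Definition nw (p : {poly F}) : R := uw p ^+ 2.

Lemma nwE p : nw p = (q%:R^-1) ^+ (size p).-1.
Proof.
rewrite /nw /uw -exprM mulnC exprM; congr (_ ^+ _).
have q0 : (q%:R : R) != 0 by rewrite pnatr_eq0; lia.
by apply: (mulIf q0); rewrite uq mulVf.
Qed.

Lemma nwM (p r : {poly F}) : p \is monic -> r \is monic -> nw (p * r) = nw p * nw r.
Proof. by move=> pm rm; rewrite /nw uwM // exprMn. Qed.

Lemma nw_gt0 p : 0 < nw p. Proof. by rewrite exprn_gt0 // uw_gt0. Qed.

Lemma sum_nw z : \sum_(i : mon F z) nw (mon_poly i) = z.+1%:R.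
Proof.
have q0 : (q%:R : R) != 0 by rewrite pnatr_eq0; lia.
rewrite (sum_mon z nw) (eq_bigr (fun=> 1)) => [|d _].
  by rewrite sumr_const card_ord.
rewrite (eq_bigr (fun=> (q%:R^-1) ^+ d)) => [|c _]; last by rewrite nwE size_monic_of.
by rewrite sumr_const card_ffun card_ord -[_ *+ (_ ^ _)%N]mulr_natl natrX -exprMn mulfV // expr1n.
Qed.

Lemma sum_nw_sqr z D : \sum_(i : mon F z | (D <= tag i)%N) nw (mon_poly i) ^+ 2 <= 2%:R * (q%:R^-1) ^+ D.
Proof.
have q0 : (q%:R : R) != 0 by rewrite pnatr_eq0; lia.
have qi0 : 0 < (q%:R^-1 : R) by rewrite invr_gt0 ltr0n; lia.
have qi2 : 2%:R * (q%:R^-1 : R) <= 1.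
  by rewrite ler_pdivrMr ?mul1r ?ler_nat // ltr0n; lia.
have -> : \sum_(i : mon F z | (D <= tag i)%N) nw (mon_poly i) ^+ 2 =
   \sum_(d < z.+1 | (D <= d)%N) (q%:R^-1) ^+ d.
  transitivity (\sum_(d < z.+1 | (D <= d)%N) \sum_(c : {ffun 'I_d -> F}) nw (monic_of c) ^+ 2).
    rewrite sig_big_dep /=; apply: eq_bigl => i; by rewrite andbT.
  apply: eq_bigr => d _.
  rewrite (eq_bigr (fun=> (q%:R^-1) ^+ d * (q%:R^-1) ^+ d)) => [|c _].
    by rewrite sumr_const card_ffun card_ord -[_ *+ (_ ^ _)%N]mulr_natl natrX mulrA -exprMn mulfV // expr1n mul1r.
  by rewrite nwE size_monic_of.
have pw m : 0 <= (q%:R^-1 : R) ^+ m by rewrite exprn_ge0 // ltW.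
(* The remaining geometric tail is added on the left so that the induction on z closes. *)
suff : \sum_(d < z.+1 | (D <= d)%N) (q%:R^-1 : R) ^+ d +
    2%:R * (q%:R^-1) ^+ (maxn D z.+1) <= 2%:R * (q%:R^-1) ^+ D.
  by apply: le_trans; rewrite lerDl mulr_ge0.
elim: z.+1 => [|m IH]; first by rewrite big_ord0 add0r maxn0.
rewrite big_mkcond big_ord_recr /= -big_mkcond /=; move: IH.
have [Dm|mD] := leqP D m; last first.
  by rewrite addr0 (maxn_idPl mD).
rewrite (maxn_idPr (leqW Dm)); apply: le_trans.
rewrite -addrA lerD2l exprS mulrA; have := pw m; move: ((q%:R^-1 : R) ^+ m) => x x0.
have : 2%:R * (q%:R^-1) * x <= 1 * x by rewrite ler_wpM2r.
lra.
Qed.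


(* Tuples are sieved by their small divisors, so that the sum of [|b|^(-2)] over the
   possible common or repeated divisors [b] is as small as needed. *)
Definition rough (D : nat) (p : {poly F}) : bool :=
  `[< forall b, b \is monic -> (1 < size b <= D)%N -> ~ (b %| p) >].

Lemma rough_dvd D (p r : {poly F}) : rough D p -> r %| p -> rough D r.
Proof.
move=> /asboolP h rp; apply/asboolP => b bm sb br.
exact: (h b bm sb) (dvdp_trans br rp).
Qed.

Section Rough.
Variables (z D : nat).
Hypothesis D2 : (2 <= D)%N.

Definition rough_mass : R := \sum_(i : mon F z | rough D (mon_poly i)) nw (mon_poly i).

Lemma rough_mass_ge0 : 0 <= rough_mass.
Proof. by apply: sumr_ge0 => i _; rewrite ltW // nw_gt0. Qed.

(** Division by [b] is injective on its multiples, keeps them rough and scales the weight by that of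
    [b]. *)
Lemma rough_dvd_mass b : b \is monic ->
  \sum_(i : mon F z | rough D (mon_poly i) && (b %| mon_poly i)) nw (mon_poly i) <= nw b * rough_mass.
Proof.
move=> bm; rewrite /rough_mass mulr_sumr.
have quo (i : mon F z) : b %| mon_poly i -> exists2 r, r \is monic & mon_poly i = r * b.
  case/dvdpP => r rE; exists r => //.
  by rewrite -(monicMr _ bm) -rE mp_monic.
have divE (i : mon F z) : b %| mon_poly i ->
    [/\ (mon_poly i %/ b)%R \is monic, (size (mon_poly i %/ b)%R <= z.+1)%N & mon_poly i = (mon_poly i %/ b)%R * b].
  move=> bi; have [r rm iE] := quo i bi.
  have dE : (mon_poly i %/ b)%R = r by rewrite iE mulpK // monic_neq0.
  rewrite dE; split=> //; apply: leq_trans (size_mp_le i).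
  by rewrite dvdp_leq ?mp_neq0 // iE dvdp_mulr.
apply: (sum_inj_le (phi := fun i => mon_of z (mon_poly i %/ b)%R)).
- move=> i j /andP[_ bi] /andP[_ bj] E.
  have [im zero_ind iE] := divE i bi; have [jm jsz jE] := divE j bj.
  by apply: mp_inj; rewrite iE jE; congr (_ * _); rewrite -(mon_ofK im zero_ind) E mon_ofK.
- move=> i /andP[ri bi]; have [im zero_ind iE] := divE i bi.
  by rewrite mon_ofK //; apply: rough_dvd ri _; rewrite [X in _ %| X]iE dvdp_mulr.
- move=> i /andP[ri bi]; have [im zero_ind iE] := divE i bi.
  by rewrite mon_ofK // {1}iE nwM // mulrC.
- by move=> j _; rewrite mulr_ge0 ?ltW // nw_gt0.
Qed.

End Rough.

Lemma rough_mass_lower D : (2 <= D)%N -> exists o : nat, forall z, (o <= z)%N ->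
  (q%:R^-1) ^+ o * (z - o).+1%:R <= rough_mass z D.
Proof.
move=> D2; pose W : {poly F} := \prod_(e < D) \prod_(c : {ffun 'I_e -> F}) monic_of c.
have Wm : W \is monic.
  by apply: monic_prod => e _; apply: monic_prod => c _; exact: monic_of_monic.
have Wdvd (b : {poly F}) : b \is monic -> (1 < size b <= D)%N -> b %| W.
  move=> bm /andP[b1 bD]; have [e sb] : exists e, size b = e.+1.
    by exists (size b).-1; rewrite prednK // ltnW.
  have eD : (e < D)%N by rewrite -sb.
  rewrite /W (bigD1 (Ordinal eD)) //= dvdp_mulr //.
  rewrite -(monic_of_coef bm sb) (bigD1 [ffun i : 'I_e => b`_i]) //=; exact: dvdp_mulr.
have W1 : (1 < size W)%N.
  have : 'X %| W by apply: Wdvd; rewrite ?monicX // size_polyX.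
  by move/(dvdp_leq (monic_neq0 Wm)); rewrite size_polyX.
pose o := (size W).-1; have sW : size W = o.+1 by rewrite prednK // ltnW.
exists o => z oz; rewrite -sum_nw mulr_sumr /rough_mass.
have props (m : mon F (z - o)) : [/\ W * mon_poly m + 1 \is monic, (size (W * mon_poly m + 1)%R <= z.+1)%N
    & (size (W * mon_poly m + 1)%R).-1 = (o + (size (mon_poly m)).-1)%N].
  have sM : size (W * mon_poly m) = (o + (size (mon_poly m))).-1.+1.
    by rewrite size_monicM ?mp_neq0 // sW size_mp addSn addnS.
  have o0 : (0 < o)%N by move: W1; rewrite sW.
  have lt1 : (size (1%R : {poly F}) < size (W * mon_poly m)%R)%N.
    by rewrite size_poly1 sM size_mp addnS /= ltnS addn_gt0 o0.
  have s1 : size (W * mon_poly m + 1) = size (W * mon_poly m) by rewrite size_polyDl.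
  split; rewrite ?s1 ?sM.
  - by rewrite monicE lead_coefDl // -monicE monicMl ?mp_monic.
  - by have := size_mp_le m; rewrite size_mp; lia.
  - by rewrite size_mp addnS.
apply: (sum_inj_le (phi := fun m => mon_of z (W * mon_poly m + 1))).
- move=> m m' _ _ /(congr1 (@mon_poly F z)); have [m1 m2 _] := props m; have [m1' m2' _] := props m'.
  rewrite !mon_ofK // => /addIr /(mulfI (monic_neq0 Wm)); exact: mp_inj.
- move=> m _; have [m1 m2 _] := props m; rewrite mon_ofK //; apply/asboolP => b bm sb.
  rewrite dvdp_addr ?dvdp_mulr ?Wdvd // dvdp1; case/andP: sb => b1 _.
  by rewrite gtn_eqF.
- by move=> m _; have [m1 m2 m3] := props m; rewrite mon_ofK // !nwE m3 exprD.
- by move=> j _; rewrite ltW // nw_gt0.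
Qed.

End Weights.

Lemma prod_perturb (R : numFieldType) (I : finType) (S : I -> R) (T : R) (A : {set I}) (x : R) :
  0 <= T -> 0 <= x -> (forall i, 0 <= S i) -> (forall i, i \notin A -> S i <= T) ->
  (forall i, i \in A -> S i <= x * T) -> \prod_i S i <= x ^+ #|A| * T ^+ #|I|.
Proof.
move=> T0 x0 S0 ST SA.
have -> : x ^+ #|A| * T ^+ #|I| = \prod_i ((if i \in A then x else 1) * T).
  by rewrite big_split /= -big_mkcond /= !prodr_const.
apply: ler_prod => i _; rewrite S0 /=; case: ifP => [/SA//|/negbT/ST].
by rewrite mul1r.
Qed.

Lemma union_bound (R : numDomainType) (I J : finType) (A : pred I) (P : pred J)
    (Q : I -> pred J) (f : J -> R) :
  (forall j, 0 <= f j) -> (forall j, P j -> exists2 i, A i & Q i j) ->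
  \sum_(j | P j) f j <= \sum_(i | A i) \sum_(j | Q i j) f j.
Proof.
move=> f0 cov; rewrite (exchange_big_dep xpredT) //= big_mkcond /=.
apply: ler_sum => j _; case: ifP => [/cov[i Ai Qi]|_]; last exact: sumr_ge0.
by rewrite (bigD1 i) /= ?Ai // lerDl sumr_ge0.
Qed.

(** * Most rough families are squarefree and pairwise coprime *)

Section Families.
Variables (F : finFieldType) (R : realFieldType) (u : R).
Let q := #|F|.
Hypotheses (u0 : 0 < u) (uq : u ^+ 2 * q%:R = 1) (q2 : (2 <= q)%N).
Variable E : finType.
Variables (z D : nat).

Let T := rough_mass F u z D.

Definition rough_fam (g : {ffun E -> mon F z}) : bool := [forall e, rough D (mon_poly (g e))].

Definition separated (g : {ffun E -> mon F z}) : bool :=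
  `[< (forall e e', e != e' -> coprimep (mon_poly (g e)) (mon_poly (g e'))) /\
      (forall e (b : {poly F}), b ^+ 2 %| mon_poly (g e) -> (size b <= 1)%N) >].

Definition fam_weight (g : {ffun E -> mon F z}) : R := \prod_e nw u (mon_poly (g e)).

Let clash (e e' : E) (b : {poly F}) (g : {ffun E -> mon F z}) : bool :=
  if e == e' then b ^+ 2 %| mon_poly (g e) else (b %| mon_poly (g e)) && (b %| mon_poly (g e')).

Let T0 : 0 <= T. Proof. exact: rough_mass_ge0. Qed.
Let nw0 (p : {poly F}) : 0 <= nw u p. Proof. by rewrite ltW // nw_gt0. Qed.

Lemma sum_rough_fam : \sum_(g | rough_fam g) fam_weight g = T ^+ #|E|.
Proof.
rewrite /T /rough_mass big_mkcond [X in X ^+ _]big_mkcond /= -prodr_const.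
rewrite bigA_distr_bigA /=; apply: eq_bigr => g _.
rewrite /rough_fam; case: forallP => [h|].
  by apply: eq_bigr => e _; rewrite h.
move/forallP; rewrite negb_forall => /existsP[e he].
by rewrite (bigD1 e) //= (negbTE he) mul0r.
Qed.

(** The sum factors over [E]. A repeated factor gains |b|^(-2) at one place, a common factor gains
    |b|^(-1) at two; both give the same bound. *)
Lemma sum_clash e e' (b : {poly F}) : b \is monic ->
  \sum_(g | rough_fam g && clash e e' b g) fam_weight g <= nw u b ^+ 2 * T ^+ #|E|.
Proof.
move=> bm; pose A := [set e; e'].
pose cond (i : E) (p : {poly F}) :=
  if i \in A then (if e == e' then b ^+ 2 %| p else b %| p) else true.
pose S i := \sum_(j : mon F z | rough D (mon_poly j) && cond i (mon_poly j)) nw u (mon_poly j).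
have -> : \sum_(g | rough_fam g && clash e e' b g) fam_weight g = \prod_i S i.
  rewrite /S; under [RHS]eq_bigr do rewrite big_mkcond.
  rewrite bigA_distr_bigA big_mkcond /=; apply: eq_bigr => g _.
  have -> : rough_fam g && clash e e' b g =
    [forall i, rough D (mon_poly (g i)) && cond i (mon_poly (g i))].
    apply/andP/forallP => [[/forallP rg cl] i|h].
      rewrite rg /= /cond; case: ifP => //; rewrite !inE => iA; move: cl; rewrite /clash.
      case: (e =P e') iA => [<-|_]; first by rewrite orbb => /eqP ->.
      by case/orP => /eqP -> /andP[].
    split; first by apply/forallP => i; case/andP: (h i).
    have := h e; have := h e'; rewrite /clash /cond !inE !eqxx orbT /=.
    by case: (e == e') => /andP[_ h1] /andP[_ h2]; rewrite ?h2 ?h1.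
  case: forallP => [h|].
    by apply: eq_bigr => i _; rewrite h.
  move/forallP; rewrite negb_forall => /existsP[i hi].
  by rewrite (bigD1 i) //= (negbTE hi) mul0r.
have S0 i : 0 <= S i by apply: sumr_ge0.
have ST i : i \notin A -> S i <= T.
  move=> iA; rewrite /S /T /rough_mass (eq_bigl (fun j => rough D (mon_poly j))) // => j.
  by rewrite /cond (negbTE iA) andbT.
have [ee|nee] := eqVneq e e'.
  have SA i : i \in A -> S i <= nw u b ^+ 2 * T.
    move=> iA; rewrite /S /cond iA ee eqxx.
    have := rough_dvd_mass u0 q2 z D (monic_exp 2 bm).
    by rewrite expr2 nwM // -expr2.
  have := prod_perturb T0 (exprn_ge0 2 (nw0 b)) S0 ST SA.
  by rewrite /A ee setUid cards1 expr1.
have SA i : i \in A -> S i <= nw u b * T.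
  move=> iA; rewrite /S /cond iA (negbTE nee).
  exact: rough_dvd_mass.
have := prod_perturb T0 (nw0 b) S0 ST SA.
by rewrite /A cards2 nee.
Qed.

(** A family that is not separated has a clash at some [b], and roughness forces deg b >= D. The
    union bound over pairs of indices and all such [b] costs at most half of the total mass, by the
    choice of [D]. *)
Lemma separated_mass : 4%:R * ((#|E| * #|E|)%:R * (q%:R^-1) ^+ D) <= 1 :> R ->
  T ^+ #|E| <= 2%:R * \sum_(g | rough_fam g && separated g) fam_weight g.
Proof.
move=> hD.
have fw0 g : 0 <= fam_weight g by apply: prodr_ge0 => e _; exact: nw0.
pose A (t : (E * E) * mon F z) := (D <= tag t.2)%N.
pose Q (t : (E * E) * mon F z) g := rough_fam g && clash t.1.1 t.1.2 (mon_poly t.2) g.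
have TE0 : 0 <= T ^+ #|E| by rewrite exprn_ge0.
pose bad := \sum_(t | A t) \sum_(g | Q t g) fam_weight g.
have badle : bad <= (#|E| * #|E|)%:R * (2%:R * (q%:R^-1) ^+ D * T ^+ #|E|).
  apply: (@le_trans _ _ (\sum_(t | A t) nw u (mon_poly t.2) ^+ 2 * T ^+ #|E|)).
    by apply: ler_sum => t _; apply: sum_clash; exact: mp_monic.
  rewrite /A -(pair_big xpredT (fun b : mon F z => (D <= tag b)%N)
     (fun _ b => nw u (mon_poly b) ^+ 2 * T ^+ #|E|)) /=.
  rewrite sumr_const card_prod -[leLHS]mulr_natl ler_wpM2l ?ler0n //.
  by rewrite -mulr_suml ler_wpM2r //; exact: sum_nw_sqr.
have cover : T ^+ #|E| <= \sum_(g | rough_fam g && separated g) fam_weight g + bad.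
  rewrite -sum_rough_fam (bigID separated) /= lerD2l; apply: union_bound => // g.
  case/andP => rg /asboolPn nsep.
  have big_b e (b : {poly F}) : b \is monic -> (1 < size b)%N -> b %| mon_poly (g e) ->
      exists2 b' : mon F z, mon_poly b' = b & (D <= tag b')%N.
    move=> bm b1 be; have sb : (size b <= z.+1)%N.
      exact: leq_trans (dvdp_leq (mp_neq0 _) be) (size_mp_le _).
    exists (mon_of z b); first exact: mon_ofK.
    rewrite -ltnS -size_mp mon_ofK // ltnNge; apply/negP => bD.
    have/forallP/(_ e)/asboolP := rg => /(_ b bm); rewrite b1 bD => /(_ isT); exact.
  have monicize (b : {poly F}) : (1 < size b)%N -> exists c : {poly F},
      [/\ c \is monic, size c = size b & c %= b].
    move=> b1; have b0 : b != 0 by rewrite -size_poly_gt0 ltnW.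
    have lb : (lead_coef b)^-1 != 0 by rewrite invr_eq0 lead_coef_eq0.
    exists ((lead_coef b)^-1 *: b); rewrite monicE lead_coefZ mulVf ?lead_coef_eq0 //.
    by rewrite size_scale // eqp_scale.
  have [[e [e' [ee nc]]]|allc] := pselect (exists e e', e != e' /\ ~~ coprimep (mon_poly (g e)) (mon_poly (g e'))).
    have [|c [cm sc cb]] := monicize (gcdp (mon_poly (g e)) (mon_poly (g e'))).
      have : gcdp (mon_poly (g e)) (mon_poly (g e')) != 0 by rewrite gcdp_eq0 negb_and mp_neq0.
      move: nc; rewrite /coprimep -size_poly_gt0.
      by move: (size _) => [|[]].
    have ce : c %| mon_poly (g e) by rewrite (eqp_dvdl _ cb) dvdp_gcdl.
    have ce' : c %| mon_poly (g e') by rewrite (eqp_dvdl _ cb) dvdp_gcdr.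
    have c1 : (1 < size c)%N.
      have : gcdp (mon_poly (g e)) (mon_poly (g e')) != 0 by rewrite gcdp_eq0 negb_and mp_neq0.
      by rewrite sc; move: nc; rewrite /coprimep -size_poly_gt0; case: (size _) => [|[]].
    have [b' b'E b'D] := big_b e c cm c1 ce.
    by exists (e, e', b'); rewrite // /Q /clash rg /= (negbTE ee) b'E ce ce'.
  have [[e [b [be b1]]]|allb] := pselect (exists e (b : {poly F}), b ^+ 2 %| mon_poly (g e) /\ (1 < size b)%N).
    have [c [cm sc cb]] := monicize b b1.
    have ce : c ^+ 2 %| mon_poly (g e) by rewrite (eqp_dvdl _ (eqp_exp 2 cb)).
    have [||b' b'E b'D] := big_b e c cm; rewrite ?sc //.
      by apply: dvdp_trans ce; rewrite expr2 dvdp_mulr.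
    by exists (e, e, b'); rewrite // /Q /clash rg /= eqxx b'E ce.
  case: nsep; split.
    by move=> e e' ee; apply/negPn/negP => nc; apply: allc; exists e, e'.
  by move=> e b be; rewrite leqNgt; apply/negP => b1; apply: allb; exists e, b.
have bad2 : 2%:R * bad <= T ^+ #|E|.
  apply: (@le_trans _ _ (4%:R * ((#|E| * #|E|)%:R * q%:R^-1 ^+ D) * T ^+ #|E|)).
    apply: (@le_trans _ _ (2%:R * ((#|E| * #|E|)%:R * (2%:R * q%:R^-1 ^+ D * T ^+ #|E|)))).
      by rewrite ler_pM2l ?ltr0n.
    by rewrite le_eqVlt; apply/orP; left; apply/eqP; ring.
  by rewrite -[leRHS]mul1r ler_wpM2r.
lra.
Qed.

End Families.

(** * A lower bound for the mass of tuples with square product *)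

Section Squares.
Variables (F : finFieldType) (R : realFieldType) (u : R).
Let q := #|F|.
Hypotheses (u0 : 0 < u) (uq : u ^+ 2 * q%:R = 1) (q2 : (2 <= q)%N).
Variable k : nat.

Definition is_square (p : {poly F}) : bool := `[< exists t, p = t ^+ 2 >].

Definition square_mass (y : nat) : R :=
  \sum_(f : {ffun 'I_k -> mon F y} | is_square (\prod_i mon_poly (f i))) \prod_i u ^+ tag (f i).

Let E : finType := {A : {set 'I_k} | #|A| == 2}.

Lemma card_edges : #|E| = 'C(k, 2).
Proof.
by rewrite card_sig -[in RHS](card_ord k) -card_draws -cardsE; apply: eq_card => A; rewrite !inE.
Qed.

Section Param.
Variables (z y : nat).
Hypothesis zy : ((#|E| + 2) * z <= y)%N.

Let edge_prod (g : {ffun E -> mon F z}) (i : 'I_k) : {poly F} :=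
  \prod_(e : E | i \in val e) mon_poly (g e).

Let param (v : {ffun E -> mon F z} * {ffun 'I_k -> mon F z}) : {ffun 'I_k -> mon F y} :=
  [ffun i => mon_of y (mon_poly (v.2 i) ^+ 2 * edge_prod v.1 i)].

Let edge_prod_monic g i : edge_prod g i \is monic.
Proof. by apply: monic_prod => e _; exact: mp_monic. Qed.

Let paramE v i : mon_poly (param v i) = mon_poly (v.2 i) ^+ 2 * edge_prod v.1 i.
Proof.
rewrite ffunE mon_ofK ?monicMr ?monic_exp ?mp_monic ?edge_prod_monic //.
rewrite size_monicM ?monic_exp ?mp_monic ?monic_neq0 ?edge_prod_monic //.
rewrite /edge_prod size_prod_monic => [|e _]; last exact: mp_monic.
have -> : size (mon_poly (v.2 i) ^+ 2) = (tag (v.2 i)).*2.+1.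
  rewrite expr2 size_monicM ?mp_monic ?mp_neq0 // size_mp addSn addnS /= -addnn; lia.
have : (\sum_(e : E | i \in val e) (size (mon_poly (v.1 e))).-1 <= #|E| * z)%N.
  rewrite -sum_nat_const big_mkcond; apply: leq_sum => e _; case: ifP => // _.
  by rewrite size_mp /= -ltnS ltn_ord.
have := ltn_ord (tag (v.2 i)); move: (\sum_(_ | _) _)%N => s.
by move: zy; lia.
Qed.

Let good (v : {ffun E -> mon F z} * {ffun 'I_k -> mon F z}) := separated v.1.

Lemma squarefree_edge_prod g i (b : {poly F}) :
  separated g -> b ^+ 2 %| edge_prod g i -> (size b <= 1)%N.
Proof.
move=> /asboolP[cop sqf] bs; rewrite leqNgt; apply/negP => b1.
have [p [pm pirr pb]] := irreducible_factor b1.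
have ps : p ^+ 2 %| edge_prod g i by apply: dvdp_trans bs; rewrite dvdp_exp2r.
have [e ie pe] : exists2 e : E, i \in val e & p %| mon_poly (g e).
  apply: contrapT => none; have : coprimep p (edge_prod g i).
    apply: (big_ind (fun r => coprimep p r)) => [|r t cr ct|e ie]; first exact: coprimep1.
      by rewrite coprimepMr cr.
    by rewrite irreducible_poly_coprime //; apply/negP => pe; apply: none; exists e.
  rewrite irreducible_poly_coprime // => /negP; apply.
  by apply: dvdp_trans ps; rewrite expr2 dvdp_mulr.
move: ps; rewrite /edge_prod (bigD1 e) //= Gauss_dvdpl.
  by move/sqf; have := pirr.1; rewrite ltnNge => /negP.
apply: (big_ind (fun r => coprimep (p ^+ 2) r)) => [|r t cr ct|e' /andP[_ ee']].
- exact: coprimep1.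
- by rewrite coprimepMr cr.
by apply: coprimep_expl; apply: coprimep_dvdr pe _; rewrite cop // eq_sym.
Qed.

(** After division by d = gcd(a, b), the coprime squares (a/d)^2 and (b/d)^2 divide t and s
    respectively, so both quotients are constants. *)
Lemma square_squarefree_unique (a b s t : {poly F}) : a \is monic -> b \is monic ->
  (forall c : {poly F}, c ^+ 2 %| s -> (size c <= 1)%N) ->
  (forall c : {poly F}, c ^+ 2 %| t -> (size c <= 1)%N) ->
  a ^+ 2 * s = b ^+ 2 * t -> a = b.
Proof.
move=> am bm sqs sqt abst; have a0 := monic_neq0 am; have b0 := monic_neq0 bm.
pose d := gcdp a b; have d0 : d != 0 by rewrite gcdp_eq0 negb_and a0.
have cop : coprimep (a %/ d) (b %/ d) by rewrite coprimep_div_gcd ?a0.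
have aE : a = (a %/ d) * d by rewrite divpK // dvdp_gcdl.
have bE : b = (b %/ d) * d by rewrite divpK // dvdp_gcdr.
have E1 : (a %/ d) ^+ 2 * s = (b %/ d) ^+ 2 * t.
  apply: (mulfI (expf_neq0 2 d0)).
  transitivity (((a %/ d) * d) ^+ 2 * s); first by ring.
  by rewrite -aE abst {1}bE; ring.
have sa : (size (a %/ d)%R <= 1)%N.
  apply: sqt; rewrite -(@Gauss_dvdpr _ _ ((b %/ d) ^+ 2)) ?coprimep_expl ?coprimep_expr //.
  by rewrite -E1 dvdp_mulr.
have sb : (size (b %/ d)%R <= 1)%N.
  apply: sqs; rewrite -(@Gauss_dvdpr _ _ ((a %/ d) ^+ 2)); last first.
    by rewrite coprimep_expl ?coprimep_expr // coprimep_sym.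
  by rewrite E1 dvdp_mulr.
have unit_eqp (c : {poly F}) : c != 0 -> (size c <= 1)%N -> c * d %= d.
  move=> c0 /size1_polyC cE; rewrite cE mul_polyC eqp_scale //.
  by apply: contraNneq c0 => c0; rewrite cE c0.
have ad0 : (a %/ d) != 0 by apply: contraNneq a0 => h; rewrite aE h mul0r.
have bd0 : (b %/ d) != 0 by apply: contraNneq b0 => h; rewrite bE h mul0r.
apply/eqP; rewrite -eqp_monic // {1}aE [X in _ %= X]bE.
by apply: eqp_trans (unit_eqp _ ad0 sa) _; rewrite eqp_sym unit_eqp.
Qed.

(** For e = {i, j}, no other 2-subset e' through i contains j. Hence the factor of g' at e' is
    coprime to the product at j, which is a multiple of g at e; in the product at i only the factor
    at e itself can absorb it. *)
Lemma edge_prod_dvd g g' : separated g -> separated g' ->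
  (forall i, edge_prod g i = edge_prod g' i) -> forall e, mon_poly (g e) %| mon_poly (g' e).
Proof.
move=> /asboolP[cop _] /asboolP[cop' _] E12 e.
have /cards2P[i [j [ij eE]]] : #|val e| == 2 by exact: (valP e).
have ie : i \in val e by rewrite eE !inE eqxx.
have je : j \in val e by rewrite eE !inE eqxx orbT.
have dvd_prod l : l \in val e -> mon_poly (g e) %| edge_prod g' l.
  by move=> le; rewrite -E12 /edge_prod (bigD1 e) //= dvdp_mulr.
have := dvd_prod i ie; rewrite /edge_prod (bigD1 e) //=.
set rest := \prod_(_ | _) _.
suff cr : coprimep (mon_poly (g e)) rest by rewrite Gauss_dvdpl.
rewrite /rest; apply: (big_ind (fun r => coprimep (mon_poly (g e)) r)) => [|r t cr ct|e' /andP[ie' ee']].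
- exact: coprimep1.
- by rewrite coprimepMr cr.
apply: coprimep_dvdr (dvd_prod j je) _; rewrite coprimep_sym.
apply: (big_ind (fun r => coprimep (mon_poly (g' e')) r)) => [|r t cr ct|e'' je''].
- exact: coprimep1.
- by rewrite coprimepMr cr.
apply: cop'; apply: contraNneq ee' => e'e''; apply/eqP/val_inj/eqP.
rewrite eq_sym eqEcard (eqP (valP e : #|val e| == 2)) (eqP (valP e' : #|val e'| == 2)) leqnn andbT.
rewrite eE; apply/subsetP => l; rewrite !inE => /orP[]/eqP -> //.
by rewrite e'e''.
Qed.

Let param_inj v v' : good v -> good v' -> param v = param v' -> v = v'.
Proof.
move=> gv gv' E12.
have Ei i : mon_poly (v.2 i) ^+ 2 * edge_prod v.1 i = mon_poly (v'.2 i) ^+ 2 * edge_prod v'.1 i.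
  by rewrite -!paramE E12.
have hE i : mon_poly (v.2 i) = mon_poly (v'.2 i).
  apply: square_squarefree_unique (Ei i); rewrite ?mp_monic // => c.
    exact: squarefree_edge_prod.
  exact: squarefree_edge_prod.
have sE i : edge_prod v.1 i = edge_prod v'.1 i.
  by have := Ei i; rewrite hE; apply: mulfI; rewrite expf_neq0 ?mp_neq0.
have sE' i : edge_prod v'.1 i = edge_prod v.1 i by rewrite sE.
case: v v' gv gv' hE sE sE' {E12 Ei} => g h [g' h'] /= gv gv' hE sE sE'.
congr (_, _); apply/ffunP => e; apply: mp_inj; last exact: hE.
apply/eqP; rewrite -eqp_monic ?mp_monic // /eqp.
by rewrite (edge_prod_dvd gv gv' sE) (edge_prod_dvd gv' gv sE').
Qed.


(** Each edge has two endpoints, so its polynomial enters with |.|^(-1/2) twice. *)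
Let param_weight (v : {ffun E -> mon F z} * {ffun 'I_k -> mon F z}) :
  fam_weight u v.1 * \prod_i nw u (mon_poly (v.2 i)) = \prod_i u ^+ tag (param v i).
Proof.
transitivity (\prod_i (nw u (mon_poly (v.2 i)) * \prod_(e : E | i \in val e) uw u (mon_poly (v.1 e)))).
  rewrite [RHS]big_split /= [LHS]mulrC; congr (_ * _); rewrite (exchange_big_dep xpredT) //=.
  rewrite /fam_weight; apply: eq_bigr => e _.
  by rewrite prodr_const (eqP (valP e : #|val e| == 2)).
apply: eq_bigr => i _.
have -> : u ^+ tag (param v i) = uw u (mon_poly (param v i)) by rewrite /uw size_mp.
rewrite paramE (uwM u0 q2) ?monic_exp ?mp_monic ?edge_prod_monic //.
rewrite /edge_prod (uw_prod u0 q2) => [|e _]; last exact: mp_monic.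
by congr (_ * _); rewrite expr2 (uwM u0 q2) ?mp_monic.
Qed.

Let param_square (v : {ffun E -> mon F z} * {ffun 'I_k -> mon F z}) : is_square (\prod_i mon_poly (param v i)).
Proof.
apply/asboolP; exists ((\prod_i mon_poly (v.2 i)) * \prod_(e : E) mon_poly (v.1 e)).
rewrite exprMn -!prodrXl (eq_bigr _ (fun i _ => paramE v i)) big_split /=; congr (_ * _).
rewrite /edge_prod (exchange_big_dep xpredT) //=; apply: eq_bigr => e _.
by rewrite prodr_const (eqP (valP e : #|val e| == 2)).
Qed.

Lemma square_mass_ge D :
  (\sum_(g : {ffun E -> mon F z} | rough_fam D g && separated g) fam_weight u g) * z.+1%:R ^+ k
  <= square_mass y.
Proof.
have -> : (z.+1%:R : R) ^+ k = \sum_(h : {ffun 'I_k -> mon F z}) \prod_i nw u (mon_poly (h i)).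
  by rewrite -(sum_nw u0 uq q2 z) -[in LHS](card_ord k) -prodr_const bigA_distr_bigA.
rewrite big_distrlr /= pair_big /=.
apply: (sum_inj_le (phi := param)).
- by move=> v v' /andP[/andP[_ gv] _] /andP[/andP[_ gv'] _]; exact: param_inj.
- by move=> v _; exact: param_square.
- by move=> v _; rewrite param_weight.
- by move=> f _; apply: prodr_ge0 => i _; rewrite exprn_ge0 // ltW.
Qed.

End Param.

Lemma square_mass_lower : exists2 c : R, 0 < c & exists z0 : nat, forall z y, (z0 <= z)%N ->
  (('C(k, 2) + 2) * z <= y)%N -> c * z.+1%:R ^+ (k + 'C(k, 2)) <= square_mass y.
Proof.
have q0 : 0 < (q%:R : R) by rewrite ltr0n; lia.
(* The inequality q^D > D >= 4 #|E|^2 gives the hypothesis of [separated_mass]. *)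
pose D := (4 * (#|E| * #|E|) + 2)%N.
have hD : 4%:R * ((#|E| * #|E|)%:R * (q%:R^-1) ^+ D) <= 1 :> R.
  rewrite mulrA exprVn -natrM -natrX ler_pdivrMr ?mul1r ?ltr0n ?expn_gt0 ?(ltnW q2) //.
  by rewrite ler_nat ltnW // (leq_ltn_trans _ (ltn_expl D q2)) // leq_addr.
have [o ho] := rough_mass_lower u0 uq q2 (leq_addl _ 2 : (2 <= D)%N).
have o0 : 0 < (q%:R^-1 : R) ^+ o by rewrite exprn_gt0 // invr_gt0.
exists (2%:R^-1 * ((q%:R^-1) ^+ o / 2%:R) ^+ #|E|).
  by rewrite mulr_gt0 ?invr_gt0 ?ltr0n // exprn_gt0 // divr_gt0 ?ltr0n.
(* For z >= 2o the factor (z - o) + 1 is at least half of z + 1; the other factor 1/2 in the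
   constant is lost to [separated_mass]. *)
exists (2 * o)%N => z y zo; rewrite -card_edges => zy.
have := square_mass_ge zy D; apply: le_trans.
have z1 : 0 <= (z.+1%:R : R) ^+ k by rewrite exprn_ge0 ?ler0n.
rewrite exprD mulrCA [leLHS]mulrC ler_wpM2r //.
rewrite -mulrA -exprMn -(ler_pM2l (_ : 0 < 2%:R)) ?ltr0n // mulrA mulfV ?pnatr_eq0 // mul1r.
apply: le_trans (separated_mass u0 uq q2 z hD).
apply: lerXn2r; rewrite ?nnegrE ?rough_mass_ge0 //.
  by rewrite !mulr_ge0 ?invr_ge0 ?ler0n // ltW.
apply: (@le_trans _ _ ((q%:R^-1) ^+ o * (z - o).+1%:R)); last by apply: ho; lia.
rewrite -mulrA ler_pM2l // mulrC ler_pdivrMr ?ltr0n // -natrM ler_nat; lia.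
Qed.

End Squares.

(** * The moment inequality *)

(** The tangent line of x^(k+1) at t, by induction on k: each step loses only the nonnegative (k +
    1) t^k (x - t)^2. *)
Lemma young_nonneg (R : realFieldType) (x t : R) k : 0 <= x -> 0 <= t ->
  k.+1%:R * (x * t ^+ k) - k%:R * t ^+ k.+1 <= x ^+ k.+1.
Proof.
move=> x0 t0; elim: k => [|k IH]; first by rewrite mul1r expr0 mulr1 mul0r subr0 expr1.
rewrite [leRHS]exprS; apply: le_trans (ler_wpM2l x0 IH).
rewrite -subr_ge0.
have -> : x * (k.+1%:R * (x * t ^+ k) - k%:R * t ^+ k.+1) -
  (k.+2%:R * (x * t ^+ k.+1) - k.+1%:R * t ^+ k.+2) = k.+1%:R * t ^+ k * (x - t) ^+ 2.
  by rewrite !exprS -[k.+2]addn2 -[k.+1]addn1 !natrD; ring.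
by apply: mulr_ge0; [apply: mulr_ge0; [exact: ler0n | exact: exprn_ge0] | exact: sqr_ge0].
Qed.

Lemma young_even (R : realFieldType) (x t : R) k : odd k ->
  k.+1%:R * (x * t ^+ k) - k%:R * t ^+ k.+1 <= x ^+ k.+1.
Proof.
move=> ok; have := young_nonneg k (normr_ge0 x) (normr_ge0 t).
have even_norm (a : R) : `|a| ^+ k.+1 = a ^+ k.+1.
  by rewrite -normrX ger0_norm // exprn_even_ge0 //= ok.
rewrite !even_norm; apply: le_trans; rewrite lerD2r ler_wpM2l ?ler0n //.
by rewrite -normrX -normrM ler_norm.
Qed.

Section Moments.
Variables (F : finFieldType) (R : realType).
Let q := #|F|.
Hypothesis q4 : (q %% 4 = 1)%N.
Let u : R := invsq F R.
Let v : R := sqrtq F R.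

Let uv : u * v = 1. Proof. exact: invsq_sqrtq. Qed.
Let v2 : 2%:R <= v. Proof. exact: sqrtq_ge2. Qed.
Let v0 : 0 < v. Proof. exact: sqrtq_gt0. Qed.
Let u0 : 0 < u. Proof. exact: invsq_gt0. Qed.
Let vq : v ^+ 2 = q%:R. Proof. exact: sqrtq_sqr. Qed.

Lemma sum_pow_sqrtq m : \sum_(d < m.+1) v ^+ d <= 2%:R * v ^+ m.
Proof.
elim: m => [|m IH]; first by rewrite big_ord1 expr0; lra.
rewrite big_ord_recr /=; have := ler_wpM2r (exprn_ge0 m (ltW v0)) v2.
rewrite -exprS => h; lra.
Qed.

Lemma sum_tag_mon g (G : nat -> R) :
  \sum_(j : mon F g) G (tag j) = \sum_(d < g.+1) (q%:R) ^+ d * G d.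
Proof.
transitivity (\sum_(d < g.+1) \sum_(c : {ffun 'I_d -> F}) G d); first by rewrite sig_big_dep.
by apply: eq_bigr => d _; rewrite sumr_const card_ffun card_ord -[LHS]mulr_natl natrX.
Qed.

Lemma q_pow_u d : (q%:R : R) ^+ d * u ^+ d = v ^+ d.
Proof. by rewrite -vq -exprMn expr2 -mulrA [v * u]mulrC uv mulr1. Qed.

Variables (n g y k : nat).
Hypothesis hn : (n = 2 * g + 1 \/ n = 2 * g + 2)%N.
Hypothesis g1 : (1 <= g)%N.
Hypothesis kyg : (k * y <= g)%N.
Hypothesis yg : (y <= g)%N.

Definition dsum (b : nat -> R) (P : {poly F}) : R :=
  \sum_(j : mon F g) b (tag j) * (chi P (mon_poly j))%:~R.

Lemma sum_weight_le (b : nat -> R) m : (m <= g)%N ->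
  (forall e, `|b e| <= 2%:R * u ^+ e) -> (forall e, (m < e)%N -> (e <= g)%N -> b e = 0) ->
  \sum_(j : mon F g) `|b (tag j)| <= 4%:R * v ^+ m.
Proof.
move=> mg bu b0; rewrite (sum_tag_mon g (fun e => `|b e|)).
apply: (@le_trans _ _ (2%:R * \sum_(d < m.+1) v ^+ d)); last first.
  by have := sum_pow_sqrtq m; lra.
rewrite (big_ord_widen g.+1 (fun d => v ^+ d)) // mulr_sumr [leRHS]big_mkcond /=.
apply: ler_sum => d _; case: ltnP => dm.
  apply: le_trans (ler_wpM2l (exprn_ge0 _ (ler0n _ _)) (bu d)) _.
  by rewrite mulrCA q_pow_u.
by rewrite b0 ?normr0 ?mulr0 // -ltnS.
Qed.

(** Only index 0 may reach degree g, so the product has degree at most g + ky <= 2g < n and is prime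
    to every P of degree n. Squares then contribute the full count of primes, and the other tuples
    fall under [charsum_nonsquare]. *)
Lemma moment (b : 'I_k.+1 -> nat -> R) :
  (forall i e, `|b i e| <= 2%:R * u ^+ e) ->
  (forall i e, i != ord0 -> (y < e)%N -> b i e = 0) ->
  `|\sum_(c in Pset F n) \prod_i dsum (b i) (monic_of c) - #|Pset F n|%:R *
     \sum_(f : {ffun 'I_k.+1 -> mon F g} | is_square (\prod_i mon_poly (f i))) \prod_i b i (tag (f i))|
  <= (4 * q ^ g.+2)%:R * (4%:R * v ^+ g * (4%:R * v ^+ y) ^+ k).
Proof.
move=> bu by0.
pose X (f : {ffun 'I_k.+1 -> mon F g}) : int :=
  \sum_(c in Pset F n) chi (monic_of c) (\prod_i mon_poly (f i))
   - (if is_square (\prod_i mon_poly (f i)) then #|Pset F n|%:R else 0).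
have -> : \sum_(c in Pset F n) \prod_i dsum (b i) (monic_of c) - #|Pset F n|%:R *
     \sum_(f : {ffun 'I_k.+1 -> mon F g} | is_square (\prod_i mon_poly (f i))) \prod_i b i (tag (f i))
   = \sum_(f : {ffun 'I_k.+1 -> mon F g}) (\prod_i b i (tag (f i))) * (X f)%:~R.
  rewrite [X in _ * X]big_mkcond mulr_sumr /=.
  have -> : \sum_(c in Pset F n) \prod_i dsum (b i) (monic_of c) =
    \sum_(f : {ffun 'I_k.+1 -> mon F g}) (\prod_i b i (tag (f i))) *
       (\sum_(c in Pset F n) chi (monic_of c) (\prod_i mon_poly (f i)))%:~R.
    under [RHS]eq_bigr do rewrite rmorph_sum mulr_sumr.
    rewrite exchange_big; apply: eq_bigr => c /PsetP ci.
    rewrite /dsum bigA_distr_bigA; apply: eq_bigr => f _; rewrite big_split /=.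
    congr (_ * _); rewrite -rmorph_prod; congr (_%:~R).
    have cm := monic_of_monic c.
    by rewrite (big_morph _ (chiM (card_odd q4) cm ci) (chi1 (card_odd q4) cm ci)).
  rewrite -sumrB; apply: eq_bigr => f _; rewrite /X rmorphB mulrBr; congr (_ - _).
  by case: ifP => _; rewrite ?mulr0 // rmorph_nat mulrC.
apply: le_trans (ler_norm_sum _ _ _) _.
apply: (@le_trans _ _ (\sum_(f : {ffun 'I_k.+1 -> mon F g})
    (4 * q ^ g.+2)%:R * \prod_i `|b i (tag (f i))|)).
  apply: ler_sum => f _; rewrite normrM normr_prod mulrC.
  have [/existsP[i /andP[i0 yi]]|small] := boolP [exists i, (i != ord0) && (y < tag (f i))%N].
    by rewrite [X in _ * X](bigD1 i) //= by0 // normr0 mul0r !mulr0 mulr_ge0 ?prodr_ge0 ?ler0n.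
  apply: ler_wpM2r; first exact: prodr_ge0.
  have fm : \prod_i mon_poly (f i) \is monic by apply: monic_prod => i _; exact: mp_monic.
  have sf : (size (\prod_i mon_poly (f i))%R <= n)%N.
    rewrite size_prod_monic => [|i _]; last exact: mp_monic.
    rewrite big_ord_recl size_mp /=.
    have h1 : (\sum_(i < k) (size (mon_poly (f (lift ord0 i)))).-1 <= k * y)%N.
      rewrite -[k in (_ <= k * _)%N]card_ord -sum_nat_const; apply: leq_sum => i _.
      rewrite size_mp /= leqNgt; apply/negP => yi; move/existsP: small; apply.
      by exists (lift ord0 i); rewrite yi andbT.
    apply: (@leq_ltn_trans (g + k * y)); last by case: hn => ->; move: kyg; clear; lia.
    by apply: leq_add; [rewrite -ltnS; exact: ltn_ord | exact: h1].
  have nd (c : {ffun 'I_n -> F}) : ~~ (monic_of c %| \prod_i mon_poly (f i)) by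
    apply/negP => /(dvdp_leq (monic_neq0 fm)) h; have := leq_trans h sf; rewrite size_monic_of ltnn.
  rewrite -intr_norm -[leRHS](rmorph_nat intr) ler_int /X.
  case: ifP => [/asboolP[t ft]|/negbT/asboolPn nsq]; last first.
    rewrite subr0; apply: (@le_trans _ _ (4 * q ^ g.+2)%:Z); last by rewrite natz.
    apply: charsum_nonsquare => //.
    by move=> t ft; apply: nsq; exists t.
  have -> : \sum_(c in Pset F n) chi (monic_of c) (\prod_i mon_poly (f i)) = #|Pset F n|%:R.
    rewrite -sumr_const; apply: eq_bigr => c /PsetP ci; have := nd c; rewrite ft => ndc.
    rewrite chi_sqr ?(card_odd q4) ?monic_of_monic //.
    by apply: contra ndc => tc; rewrite expr2; exact: dvdp_mulr.
  by rewrite subrr normr0 ler0n.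
rewrite -mulr_sumr ler_wpM2l ?ler0n //.
rewrite -(bigA_distr_bigA (fun i (j : mon F g) => `|b i (tag j)|)) big_ord_recl.
have S0 i : 0 <= \sum_(j : mon F g) `|b i (tag j)| by apply: sumr_ge0.
apply: ler_pM => //; first exact: prodr_ge0.
  apply: sum_weight_le => // e ge le; by move: ge; rewrite ltnNge le.
rewrite -[k in leRHS]card_ord -prodr_const; apply: ler_prod => i _; rewrite S0 /=.
by apply: sum_weight_le => // e ye _; apply: by0.
Qed.

End Moments.

(** * The lower bound for the moment of L *)

Section Average.
Variables (F : finFieldType) (R : realType).
Let q := #|F|.
Hypothesis q4 : (q %% 4 = 1)%N.
Let u : R := invsq F R.
Let v : R := sqrtq F R.

Lemma card_Pset_half n g : (n = 2 * g + 1 \/ n = 2 * g + 2)%N -> (1 <= g)%N ->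
  (q ^ n <= 2 * n * #|Pset F n|)%N.
Proof.
move=> hn g1; have n0 : (0 < n)%N by case: hn => ->; clear; lia.
have h := card_Pset_ge F n0; rewrite -/q in h.
have h5 : (5 * q ^ n./2 <= q ^ n)%N.
  have -> : (q ^ n = q ^ (n - n./2) * q ^ n./2)%N by rewrite -expnD subnK //; move: n0; clear; lia.
  rewrite leq_mul2r; apply/orP; right; apply: (leq_trans (card_ge5 q4)).
  by rewrite -/q -{1}(expn1 q) leq_exp2l ?finNzRing_gt1 //; move: n0; clear; lia.
rewrite -mulnA; move: h h5; move: (q ^ n)%N (n * _)%N (q ^ n./2)%N => a b c; clear; lia.
Qed.

Lemma Lhalf_moment_lower n g y k : (n = 2 * g + 1 \/ n = 2 * g + 2)%N -> (1 <= g)%N ->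
  odd k -> (k * y <= g)%N -> (y < g)%N ->
  #|Pset F n|%:R * square_mass F u k.+1 y <=
  \sum_(c in Pset F n) Lhalf R (monic_of c) ^+ k.+1 +
  (2 * k + 1)%:R * ((4 * q ^ g.+2)%:R * (4%:R * v ^+ g * (4%:R * v ^+ y) ^+ k)).
Proof.
move=> hn g1 ok kyg yg; have u0 : 0 < u by exact: invsq_gt0.
have ue e : 0 < u ^+ e by rewrite exprn_gt0.
have [w [w_lo w_hi LE]] := Lhalf_weights R q4 hn.
pose al (e : nat) : R := if (e <= y)%N then u ^+ e else 0.
pose wg (e : nat) : R := if (e <= g)%N then w e else 0.
(* Index 0 carries the weights of L, the other k indices those of A. *)
pose be (i : 'I_k.+1) : nat -> R := if i == ord0 then wg else al.
have al_u e : 0 <= al e <= 2%:R * u ^+ e.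
  by rewrite /al; have := ue e; case: ifP => _ h; apply/andP; split; lra.
have wg_u e : 0 <= wg e <= 2%:R * u ^+ e.
  rewrite /wg; case: ifP => [/w_hi //|_].
  by have := ue e => h; apply/andP; split; lra.
have al_w e : al e <= wg e.
  rewrite /al; case: leqP => ey; last by case/andP: (wg_u e).
  by rewrite /wg (leq_trans ey (ltnW yg)); apply: w_lo; exact: leq_ltn_trans ey yg.
have al_n e : `|al e| <= 2%:R * u ^+ e by case/andP: (al_u e) => h1 h2; rewrite ger0_norm.
have wg_n e : `|wg e| <= 2%:R * u ^+ e by case/andP: (wg_u e) => h1 h2; rewrite ger0_norm.
have be_n i e : `|be i e| <= 2%:R * u ^+ e by rewrite /be; case: ifP.
have al_0 e : (y < e)%N -> al e = 0 by move=> ye; rewrite /al leqNgt ye.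
have be_0 i e : i != ord0 -> (y < e)%N -> be i e = 0.
  by move=> /negbTE i0; rewrite /be i0; exact: al_0.
set Er := (4 * q ^ g.+2)%:R * _.
have m1 := moment q4 hn g1 kyg (ltnW yg) be_n be_0.
have m2 := moment (b := fun=> al) q4 hn g1 kyg (ltnW yg) (fun _ => al_n) (fun _ e _ => al_0 e).
rewrite -/u -/v -/q -/Er in m1 m2.
pose M1 := \sum_(f : {ffun 'I_k.+1 -> mon F g} | is_square (\prod_i mon_poly (f i)))
  \prod_i be i (tag (f i)).
pose M2 := \sum_(f : {ffun 'I_k.+1 -> mon F g} | is_square (\prod_i mon_poly (f i)))
  \prod_i al (tag (f i)).
rewrite -/M1 in m1; rewrite -/M2 in m2.
pose L (c : {ffun 'I_n -> F}) := Lhalf R (monic_of c).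
pose A (c : {ffun 'I_n -> F}) := dsum (R := R) g al (monic_of c).
have S1 : \sum_(c in Pset F n) \prod_i dsum g (be i) (monic_of c) =
    \sum_(c in Pset F n) L c * A c ^+ k.
  apply: eq_bigr => c cP; rewrite big_ord_recl; congr (_ * _).
    rewrite /L LE // /dsum /be eqxx.
    transitivity (\sum_(d < g.+1) \sum_(e : {ffun 'I_d -> F}) wg d * (chi (monic_of c) (monic_of e))%:~R).
      by rewrite sig_big_dep.
    apply: eq_bigr => d _; rewrite /monsum rmorph_sum mulr_sumr.
    by apply: eq_bigr => e _; rewrite /wg -ltnS ltn_ord.
  by rewrite -[k in RHS]card_ord -prodr_const; apply: eq_bigr => i _; rewrite /be.
have S2 : \sum_(c in Pset F n) \prod_(i < k.+1) dsum g al (monic_of c) =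
    \sum_(c in Pset F n) A c ^+ k.+1.
  by apply: eq_bigr => c cP; rewrite prodr_const card_ord.
rewrite S1 in m1; rewrite S2 in m2.
move: m1 m2; rewrite !ler_norml => /andP[m1 _] /andP[_ m2].
(* All weights are nonnegative, so the diagonals compare termwise. Hence (k + 1) M1 - k M2 is at
   least M2, at the cost of 2k + 1 errors. *)
have M12 : M2 <= M1.
  apply: ler_sum => f _; apply: ler_prod => i _; rewrite /be.
  by case/andP: (al_u (tag (f i))) => -> _ /=; case: ifP.
have MM : square_mass F u k.+1 y <= M2.
  pose phi (f : {ffun 'I_k.+1 -> mon F y}) : {ffun 'I_k.+1 -> mon F g} :=
    [ffun i => mon_of g (mon_poly (f i))].
  have phiE f i : mon_poly (phi f i) = mon_poly (f i).
    by rewrite ffunE mon_ofK ?mp_monic // (leq_trans (size_mp_le _)) // ltnS ltnW.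
  apply: (sum_inj_le (phi := phi)).
  - move=> f f' _ _ E; apply/ffunP => i; apply: mp_inj.
    by rewrite -!phiE E.
  - by move=> f; rewrite (eq_bigr _ (fun i _ => phiE f i)).
  - move=> f _; apply: ler_prod => i _; rewrite exprn_ge0 ?(ltW u0) //=.
    have -> : (tag (phi f i) : nat) = tag (f i) by apply: succn_inj; rewrite -!size_mp phiE.
    by rewrite /al -ltnS ltn_ord.
  - by move=> f _; apply: prodr_ge0 => i _; case/andP: (al_u (tag (f i))).
have young : \sum_(c in Pset F n) (k.+1%:R * (L c * A c ^+ k) - k%:R * A c ^+ k.+1) <=
   \sum_(c in Pset F n) L c ^+ k.+1 by apply: ler_sum => c _; exact: young_even.
rewrite sumrB -!mulr_sumr in young.
have P0 : 0 <= (#|Pset F n|%:R : R) by rewrite ler0n.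
have k0 : 0 <= (k%:R : R) by rewrite ler0n.
move: m1 m2 young; set s1 := \sum_(c in _) _; set s2 := \sum_(c in _) _.
move: (\sum_(c in _) _) => s3; rewrite -[k.+1%:R]natr1 natrD natrM => m1 m2 young.
have h1 : #|Pset F n|%:R * M2 <= #|Pset F n|%:R * M1 by rewrite ler_wpM2l.
have h2 : #|Pset F n|%:R * square_mass F u k.+1 y <= #|Pset F n|%:R * M2 by rewrite ler_wpM2l.
have h3 : (k%:R + 1) * (#|Pset F n|%:R * M2 - Er) <= (k%:R + 1) * s1.
  by rewrite ler_wpM2l ?addr_ge0 //; lra.
have h4 : k%:R * s2 <= k%:R * (#|Pset F n|%:R * M2 + Er) by rewrite ler_wpM2l //; lra.
have h5 : (k%:R + 1) * (#|Pset F n|%:R * M2 - Er) - k%:R * (#|Pset F n|%:R * M2 + Er) =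
  #|Pset F n|%:R * M2 - (2%:R * k%:R + 1) * Er by ring.
lra.
Qed.

End Average.

Lemma linear_le_exp (R : realType) (C : R) : exists N, forall g, (N <= g)%N ->
  C * g.+1%:R <= 2%:R ^+ g./2.
Proof.
(* With j = g / 4, the bound j + 1 <= 2^j is used twice: one factor j + 1 absorbs g + 1, the other
   the constant 4|C|. *)
pose m := Num.bound (4%:R * `|C|).
have mC : 4%:R * `|C| <= m%:R by rewrite ltW // archi_boundP // mulr_ge0 ?ler0n.
exists (4 * m)%N => g mg; pose j := (g %/ 4)%N.
have mj : (m <= j)%N by rewrite /j leq_divRL // mulnC.
have gj : (g.+1 <= 4 * j.+1)%N by rewrite /j; clear; lia.
have jg : (j + j <= g./2)%N by rewrite /j; clear; lia.
have e1 : (j.+1 * j.+1 <= 2 ^ g./2)%N.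
  apply: (@leq_trans (2 ^ j * 2 ^ j)); first by apply: leq_mul; exact: ltn_expl.
  by rewrite -expnD leq_exp2l.
apply: (@le_trans _ _ (j.+1%:R * j.+1%:R)); last by rewrite -natrX -natrM ler_nat.
apply: (@le_trans _ _ (`|C| * g.+1%:R)); first by rewrite ler_wpM2r ?ler0n // ler_norm.
apply: (@le_trans _ _ (`|C| * (4 * j.+1)%:R)); first by rewrite ler_wpM2l // ler_nat.
rewrite natrM mulrA [_ * 4%:R]mulrC ler_wpM2r ?ler0n //.
by apply: (le_trans mC); rewrite ler_nat leqW.
Qed.

Lemma error_bound (F : finFieldType) (R : realType) k (c1 : R) : (#|F| %% 4 = 1)%N -> 0 < c1 ->
  exists N, forall g n y, (N <= g)%N -> (1 <= g)%N ->
  (n = 2 * g + 1 \/ n = 2 * g + 2)%N -> (2 * (k * y) <= g)%N ->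
  (2 * k + 1)%:R * ((4 * #|F| ^ g.+2)%:R *
     (4%:R * sqrtq F R ^+ g * (4%:R * sqrtq F R ^+ y) ^+ k)) <=
  #|Pset F n|%:R * (c1 / 2%:R).
Proof.
move=> q4 c0; set v := sqrtq F R.
have v2 : 2%:R <= v by exact: sqrtq_ge2.
have v0 : 0 < v by exact: sqrtq_gt0.
have vq : v ^+ 2 = #|F|%:R by exact: sqrtq_sqr.
pose C0 : R := (2 * k + 1)%:R * (16%:R * 4%:R ^+ k).
have C00 : 0 <= C0 by rewrite !mulr_ge0 ?exprn_ge0 ?ler0n.
(* The 8 comes from 4n <= 8(g + 1), and v^2 from comparing the exponent 3g + 4 of the error with 3g
   + 2. *)
have [N hN] := linear_le_exp (8%:R * C0 * v ^+ 2 / c1).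
exists N => g n y Ng g1 hn kyg.
have lin := hN g Ng.
have P0 := card_Pset_half q4 hn g1.
have n0 : (0 < n)%N by case: hn => ->; clear; lia.
have vge0 m : 0 <= v ^+ m by rewrite exprn_ge0 // ltW.
have vpos m : 0 < v ^+ m by rewrite exprn_gt0.
have PR : v ^+ (4 * g + 2) <= 2%:R * n%:R * #|Pset F n|%:R.
  apply: (@le_trans _ _ ((#|F| ^ n)%:R)); last by rewrite -!natrM ler_nat.
  have -> : (4 * g + 2 = 2 * (2 * g + 1))%N by clear; lia.
  rewrite exprM vq -natrX ler_nat leq_exp2l ?finNzRing_gt1 //.
  by case: hn => ->; clear; lia.
have E1 : (2 * k + 1)%:R * ((4 * #|F| ^ g.+2)%:R * (4%:R * v ^+ g * (4%:R * v ^+ y) ^+ k)) =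
    C0 * v ^+ (3 * g + 4 + k * y).
  have -> : (3 * g + 4 + k * y = 2 * g.+2 + g + y * k)%N by rewrite [(y * k)%N]mulnC; clear; lia.
  rewrite natrM natrX -vq -exprM exprMn -exprM /C0 !exprD; ring.
rewrite E1.
have n4 : (n%:R : R) <= 2%:R * g.+1%:R.
  by rewrite -natrM ler_nat; case: hn => ->; clear; lia.
have main : C0 * v ^+ (3 * g + 4 + k * y) * (4%:R * n%:R) <= c1 * v ^+ (4 * g + 2).
  have h1 : 8%:R * C0 * v ^+ 2 * g.+1%:R <= c1 * v ^+ (g - k * y).
    apply: (@le_trans _ _ (c1 * 2%:R ^+ g./2)).
      have := ler_wpM2l (ltW c0) lin; rewrite [leLHS]mulrA [c1 * (_ / c1)]mulrC divfK //.
      by rewrite gt_eqF.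
    rewrite ler_pM2l //; apply: (@le_trans _ _ (v ^+ g./2)).
      by apply: lerXn2r; rewrite ?nnegrE ?ler0n // ltW.
    apply: ler_weXn2l; first by apply: le_trans v2; rewrite ler1n.
    by move: kyg; move: (k * y)%N => a; clear; lia.
  have E2 : (4 * g + 2 = (3 * g + 2 + k * y) + (g - k * y))%N.
    by move: kyg; move: (k * y)%N => a; clear; lia.
  rewrite E2 [v ^+ (_ + (g - _))]exprD.
  have -> : (3 * g + 4 + k * y = (3 * g + 2 + k * y) + 2)%N by clear; lia.
  rewrite [v ^+ (_ + 2)]exprD.
  apply: (@le_trans _ _ (v ^+ (3 * g + 2 + k * y) * (8%:R * C0 * v ^+ 2 * g.+1%:R))).
    have h2 := ler_wpM2l (mulr_ge0 (vge0 (3 * g + 2 + k * y)%N) (mulr_ge0 C00 (vge0 2))) n4.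
    move: h2; move: (v ^+ (3 * g + 2 + k * y)) (v ^+ 2) (n%:R) (g.+1%:R) => a b x w h2.
    lra.
  by rewrite [leRHS]mulrCA ler_pM2l.
have n0R : 0 < 4%:R * n%:R :> R by rewrite mulr_gt0 ?ltr0n.
rewrite -(ler_pM2r n0R); apply: (le_trans main).
have := ler_wpM2l (ltW c0) PR; lra.
Qed.

Lemma bin2_exponent k : (k.+1 + 'C(k.+1, 2) = k.+1 * (k.+1 + 1) %/ 2)%N.
Proof.
rewrite bin2 /= (_ : k.+1 * (k.+1 + 1) = k.+1 * 2 + k.+1 * k)%N; last by lia.
by rewrite divnMDl // divn2.
Qed.

Unset Implicit Arguments.

Theorem theorem1p1 (F : finFieldType) (R : realType) (k : nat) :
  (#|F| %% 4 = 1)%N -> ~~ odd k ->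
  exists c : R, 0 < c /\
  exists g0 : nat, forall g n : nat, (1 <= g)%N -> (g0 <= g)%N ->
    (n = 2 * g + 1 \/ n = 2 * g + 2)%N ->
    c * (n%:R) ^+ (k * (k + 1) %/ 2) <=
      (#|Pset F n|%:R)^-1 * \sum_(P in Pset F n) Lhalf R (monic_of P) ^+ k.
Proof.
move=> q4; have Ppos g n : (1 <= g)%N -> (n = 2 * g + 1 \/ n = 2 * g + 2)%N ->
    0 < (#|Pset F n|%:R : R).
  move=> g1 hn; rewrite ltr0n lt0n; apply/eqP => P0.
  have := card_Pset_half q4 hn g1; rewrite P0 muln0 leqn0 expn_eq0.
  by have := finNzRing_gt1 F; case: #|F|.
case: k => [_|k]; last rewrite /= negbK => ok.
  exists 1; split=> //; exists 0%N => g n g1 _ hn.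
  rewrite expr0 mulr1 (eq_bigr (fun=> 1)) => [|c _]; last by rewrite expr0.
  by rewrite sumr_const mulVf // gt_eqF // (Ppos g n).
have u0 : 0 < invsq F R by exact: invsq_gt0.
have uq : invsq F R ^+ 2 * #|F|%:R = 1.
  by rewrite -(sqrtq_sqr F R) -exprMn invsq_sqrtq ?expr1n.
have [c1 c10 [z0 hz]] := square_mass_lower u0 uq (finNzRing_gt1 F) k.+1.
have [N hN] := error_bound k q4 c10.
(* The parametrization needs s z <= y. With y = g / 2(k + 1) and z = y / s rounded down, n <= 2(g +
   1) <= B(z + 1), which turns powers of z + 1 into powers of n. *)
pose s := ('C(k.+1, 2) + 2)%N; pose B := (4 * k.+1 * s)%N.
have s0 : (0 < s)%N by rewrite /s addn2.
have B0 : 0 < (B%:R : R) by rewrite ltr0n /B !muln_gt0 s0.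
set ex := (k.+1 * (k.+1 + 1) %/ 2)%N.
exists (c1 / 2%:R / B%:R ^+ ex); split.
  by rewrite !divr_gt0 ?exprn_gt0 // ltr0n.
exists (N + 2 * k.+1 * s * z0)%N => g n g1 g0 hn.
pose y := (g %/ (2 * k.+1))%N; pose z := (y %/ s)%N.
have yk : (2 * (k * y) <= g)%N.
  have h := leq_trunc_div g (2 * k.+1); rewrite -/y in h.
  by apply: leq_trans h; rewrite mulnA [leqRHS]mulnC leq_mul2r leq_mul2l leqnSn !orbT.
have yg : (y < g)%N by rewrite /y ltn_Pdiv // mulnS; clear; lia.
have zz : (z0 <= z)%N.
  rewrite /z /y -divnMA leq_divRL ?muln_gt0 ?s0 //.
  by rewrite mulnC; apply: leq_trans g0; rewrite leq_addl.
have sz : (s * z <= y)%N by rewrite mulnC leq_trunc_div.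
have gz : (n <= B * z.+1)%N.
  have h1 : (g < y.+1 * (2 * k.+1))%N by rewrite ltn_ceil // muln_gt0.
  have h2 : (y < z.+1 * s)%N by rewrite ltn_ceil.
  apply: (@leq_trans (2 * (y.+1 * (2 * k.+1)))); first by case: hn => ->; move: h1; clear; lia.
  apply: (@leq_trans (2 * ((z.+1 * s) * (2 * k.+1)))).
    by rewrite leq_mul2l leq_mul2r h2 !orbT.
  by rewrite /B; apply: eq_leq; ring.
have mass := hz z y zz sz; rewrite bin2_exponent -/ex in mass.
have kyg : (k * y <= g)%N by move: yk; move: (k * y)%N => a; clear; lia.
have low := Lhalf_moment_lower R q4 hn g1 ok kyg yg.
have Ng : (N <= g)%N by apply: leq_trans g0; rewrite leq_addr.
have err := hN g n y Ng g1 hn yk.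
have P0 := Ppos g n g1 hn.
rewrite [leRHS]mulrC ler_pdivlMr // -addn1.
have zn : (n%:R / B%:R : R) ^+ ex <= z.+1%:R ^+ ex.
  apply: lerXn2r; rewrite ?nnegrE ?divr_ge0 ?ler0n //.
  by rewrite ler_pdivrMr // -natrM ler_nat mulnC.
have z1 : 1 <= (z.+1%:R : R) ^+ ex by rewrite exprn_ege1 // ler1n.
have -> : c1 / 2%:R / B%:R ^+ ex * n%:R ^+ ex = c1 / 2%:R * (n%:R / B%:R) ^+ ex.
  by rewrite expr_div_n; ring.
have h1 : c1 / 2%:R * (n%:R / B%:R) ^+ ex <= c1 / 2%:R * z.+1%:R ^+ ex.
  by rewrite ler_pM2l // divr_gt0 // ltr0n.
have h2 : c1 <= c1 * z.+1%:R ^+ ex by rewrite ler_peMr // ltW.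
(* Since (z + 1)^ex >= 1, half of the mass bound already covers c1/2, the error per prime allowed by
   [error_bound]. *)
have h3 : c1 / 2%:R * (n%:R / B%:R) ^+ ex + c1 / 2%:R <= square_mass F (invsq F R) k.+1 y by lra.
have h4 := ler_wpM2l (ltW P0) h3.
rewrite mulrDr in h4; rewrite mulrC.
by move: low err h4; lra.
Qed.
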